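(* Let $X$ be a real Banach space which admits an equivalent Fréchet smooth norm. Let a BV continuous nonconstant $f:[0,1]\to X$ be given, put $G:=[0,1]\setminus D_f$ and let $F:=\mathcal{A}_f$. Then the following are equivalent. (i) There exists an increasing homeomorphism $h$ of $[0,1]$ onto itself such that $f\circ h$ is a $C^2$ function. (ii) There exists an increasing homeomorphism $\varphi$ of $[0,1]$ onto itself such that $f\circ\varphi$ is $C^2$ and $(f\circ\varphi)'(x)\neq 0$ for each $x\in\varphi^{-1}(G)$. (iii) $\mathcal{H}^1(f(D_f))=0$ and $W^{\delta}(f,G)<\infty$ for each $\delta>0$. (iv) $\mathcal{H}^1(f(D_f))=0$ and $W^{\delta}(f,G)<\infty$ for some $\delta>0$. (v) $\mathcal{H}^1(f(D_f))=0$ and $\sum_{I\in\mathcal{P}}\sqrt{V(f,I)}<\infty$ whenever $\mathcal{P}$ is an $(f,\delta,\infty)$-partition of $G$ with $\delta>0$. (vi) $\mathcal{H}^1(f(D_f))=0$ and $\sum_{I\in\mathcal{P}^*}\sqrt{V(f,I)}<\infty$ for some $(f,0,K^* )$-partition $\mathcal{P}^*$ of $G$ with $0<K^*<\infty$. (vii) There exists a family $\mathcal{S}$ of pairwise non-overlapping compact intervals such that $\operatorname{int}(J)\subset G$ for each $J\in\mathcal{S}$ and $$\sum_{J\in\mathcal{S}}V(f,J)=V(f,[0,1]),\qquad \sum_{J\in\mathcal{S}}\sqrt{V(f,J)}<\infty,\qquad \sum_{J\in\mathcal{S}}V(f,J)\cdot\sqrt{S_J}<\infty,$$ where $S_J=\sup_{y\in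 v_f(\operatorname{int}(J))}\|F''(y)\|$. If $f$ is nonconstant on any interval (that is, constant on no interval), then in (ii) we can also assert $\lambda(\varphi^{-1}(G))=1$.
   Context: The norm of $X$ is denoted $\|\cdot\|$; all notions below are taken with respect to it. A norm is Fréchet smooth if it is Fréchet differentiable at every $x\neq 0$. All intervals are nondegenerate; $\lambda$ is Lebesgue measure on $\mathbb{R}$ and $\mathcal{H}^1$ is $1$-dimensional Hausdorff measure. Intervals are non-overlapping if their interiors are disjoint. For $f:[a,b]\to X$ and $M\subset[a,b]$, $V(f,M):=\sup\sum_{i=1}^n\|f(x_i)-f(x_{i-1})\|$ over all $x_0<\dots<x_n$ in $M$ ($V(f,M):=0$ if $M$ is empty or a singleton). $f$ is BV if $V(f,[a,b])<\infty$; then $v_f(x):=V(f,[a,x])$. If $f$ is nonconstant, continuous and BV, $\mathcal{A}_f$ denotes the unique map $F:[0,\ell]\to X$, $\ell:=v_f(b)$, with $f=F\circ v_f$. Derivatives at endpoints of closed intervals are one-sided. $f:[a,b]\to X$ is $C^2$ if $f''$ exists and is continuous on $[a,b]$. A map $g:[c,d]\to X$ is parametrized by the arc-length if $V(g,[u,v])=v-u$ for all $c\le u<v\le d$. For continuous $f:[a,b]\to X$, an arc-length parametrization of $f$ is a map $f\circ h$ which is parametrized by the arc-length, where $h:[c,d]\to[a,b]$ is an increasing homeomorphism. $D_f$: for continuous $f:[0,1]\to X$, $D_f$ is the set of all $x\in[0,1]$ for which there is no interval $(c,d)\subset[0,1]$ containing $x$ such that $f|_{[c,d]}$ has a $C^2$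 arc-length parametrization. ($D_f$ is closed and contains $0,1$; on $v_f(G)$ with $G=[0,1]\setminus D_f$, $F=\mathcal{A}_f$ is $C^2$, and $f$ is not constant on any interval contained in $G$. When $f$ is nonconstant, $\mathcal{H}^1(f(D_f))=0$ forces $G\neq\emptyset$.) In what follows $\emptyset\ne G\subset(0,1)$ is open, $f:[0,1]\to X$ is continuous and BV, nonconstant on each interval contained in $G$, $F:=\mathcal{A}_f$ is twice differentiable on $v_f(G)$, and for a compact interval $L$ with $\operatorname{int}(L)\subset G$, $S_L:=\sup_{x\in v_f(\operatorname{int}(L))}\|F''(x)\|\le\infty$. $W^\delta(f,G)$ ($0<\delta<\infty$) is the supremum of $\sum_{k=1}^n\sqrt{V(f,I_k)}$ over all finite non-overlapping systems $I_1,\dots,I_n$ of compact intervals with $\operatorname{int}(I_k)\subset G$ such that $S_{I_k}\cdot V(f,I_k)\ge\delta$ whenever $I_k\subset G$. Generalized partitions: a $\mathbb{Z}$-interval is a set $(l,m)\cap\mathbb{Z}$ with $l,m\in\mathbb{Z}\cup\{-\infty,\infty\}$. A family $\mathcal{P}$ of compact intervals is a generalized partition of a bounded interval $(a,b)$ if there are a $\mathbb{Z}$-interval $\mathcal{I}$ and a strictly increasing system $(x_i)_{i\in\mathcal{I}}$ with $\inf x_i=a$, $\sup x_i=b$ and $\mathcal{P}=\{[x_k,x_{k+1}]:k,k+1\in\mathcal{I}\}$. $\mathcal{P}$ is a generalized partition of a bounded open set $G\ne\emptyset$ if $\bigcup\{\operatorname{int}(I):I\in\mathcal{P}\}\subset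 G$ and, for each component $(a,b)$ of $G$, $\{I\in\mathcal{P}:\operatorname{int}(I)\subset(a,b)\}$ is a generalized partition of $(a,b)$. For $0\le\delta\le K\le\infty$, $\delta<\infty$, a generalized partition $\mathcal{P}$ of $G$ is an $(f,\delta,K)$-partition of $G$ if (a) $S_I<\infty$ and $S_I\cdot V(f,I)\le K$ for each $I\in\mathcal{P}$, and (b* ) $S_I\cdot V(f,I)\ge\delta$ for each $I\in\mathcal{P}$ with $I\subset G$.
   Formalization: All metric notions (variation, arc length, D_f, Hausdorff measure, S_J, W, partitions) are taken in an equivalent Fréchet smooth norm, not in an arbitrary given norm of X; for a non-smooth norm such as the max norm on R^2, (i) does not imply (iii). *)

(* Defs.v *)
From HB Require Import structures.
From mathcomp Require Import all_boot all_order all_algebra.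
From mathcomp Require Import all_classical all_reals all_analysis.

Set Implicit Arguments.
Unset Strict Implicit.
Unset Printing Implicit Defensive.

Import Order.TTheory GRing.Theory Num.Theory.
Import numFieldNormedType.Exports.

Local Open Scope classical_set_scope.
Local Open Scope ring_scope.

Section Norms.
Context {R : realType} {X : normedModType R}.
Implicit Types N : X -> R.

(* The lower bound c * `|x| <= N x also gives N x = 0 -> x = 0. *)
Definition equivalent_norm N : Prop :=
  [/\ (forall x y, N (x + y) <= N x + N y),
      (forall (a : R) x, N (a *: x) = `|a| * N x) &
      exists c C : R, [/\ 0 < c, 0 < C &
        forall x, c * `|x| <= N x /\ N x <= C * `|x|]].

(* [differentiable] is Frechet differentiability; it does not depend on the
   choice between equivalent norms on X. *)
Definition frechet_smooth N : Prop := forall x : X, x != 0 -> differentiable N x.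

End Norms.

(* Functions on a closed interval are represented by total functions on R, of
   which only the restriction to that interval is ever used. *)
Section Calculus.
Context {R : realType} {X : normedModType R}.

(* Derivative of the restriction of f to A; it is one-sided at an endpoint of
   A = [a, b]. *)
Definition has_derivative_in (A : set R) (f : R -> X) (x : R) (l : X) : Prop :=
  (fun y => (y - x)^-1 *: (f y - f x)) @ within A x^' --> l.

Definition C2_on (a b : R) (f : R -> X) : Prop :=
  exists f1 f2 : R -> X,
    [/\ (forall x : R, x \in `[a, b] -> has_derivative_in `[a, b] f x (f1 x)),
        (forall x : R, x \in `[a, b] -> has_derivative_in `[a, b] f1 x (f2 x)) &
        {within `[a, b], continuous f2}].

End Calculus.

Section Homeo.
Context {R : realType}.

Definition increasing_homeo (a b c d : R) (h : R -> R) : Prop :=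
  {in `[a, b] &, {homo h : x y / x < y}} /\
  exists g : R -> R,
    [/\ (forall x : R, x \in `[a, b] -> h x \in `[c, d] /\ g (h x) = x),
        (forall y : R, y \in `[c, d] -> g y \in `[a, b] /\ h (g y) = y),
        {within `[a, b], continuous h} &
        {within `[c, d], continuous g}].

End Homeo.

Section Variation.
Context {R : realType} {X : normedModType R}.
Variable N : X -> R.
Implicit Types (f : R -> X) (G : set R).

(* Everything metric below (variation, arc length, diameters, bounds for the
   second derivative) is computed in N, the Frechet smooth norm, and not in the
   library norm of X, which only provides the (equivalent) topology. Smoothness
   of the norm defining arc length matters: for the sup norm on R^2 a regular
   C^2 curve (t, t + u(t)) has no C^2 arc-length parametrization near a simple
   zero of u', and such zeros can accumulate at a set of positive measure. *)

(* The lists with at most one element contribute the value 0. *)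
Definition Var f (M : set R) : \bar R :=
  ereal_sup [set (\sum_(i < (size s).-1) N (f s`_i.+1 - f s`_i))%:E
            | s in [set s : seq R | sorted <%R s /\ [set` s] `<=` M]].

Definition BV01 f : Prop := (Var f `[0%R, 1%R] < +oo)%E.

Definition vfun f (x : R) : R := fine (Var f `[0, x]).

(* F is determined on [0, v_f(1)] only. *)
Definition arclength_map f : R -> X :=
  xget (fun=> 0) [set F : R -> X | forall x : R, x \in `[0, 1] -> f x = F (vfun f x)].

Definition parametrized_by_arclength (c d : R) (g : R -> X) : Prop :=
  forall u v : R, c <= u -> u < v -> v <= d -> Var g `[u, v] = (v - u)%:E.

Definition has_C2_arclength_parametrization (c d : R) f : Prop :=
  exists (u v : R) (h : R -> R),
    [/\ u < v, increasing_homeo u v c d h,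
        parametrized_by_arclength u v (f \o h) & C2_on u v (f \o h)].

Definition Dset f : set R :=
  [set x | x \in `[0, 1] /\
     ~ exists c d : R, [/\ 0 <= c, d <= 1, c < x < d &
                       has_C2_arclength_parametrization c d f]].

(* The explicit 0 makes the diameter of the empty set 0. *)
Definition diam (U : set X) : \bar R :=
  ereal_sup (0%E |` [set (N (p.1 - p.2))%:E | p in U `*` U]).

Definition hausdorff1_delta (d : R) (E : set X) : \bar R :=
  ereal_inf [set (\sum_(0 <= i <oo) diam (U i))%E
            | U in [set U : nat -> set X |
                E `<=` \bigcup_i U i /\ forall i, (diam (U i) <= d%:E)%E]].

Definition hausdorff1 (E : set X) : \bar R :=
  ereal_sup [set hausdorff1_delta d E | d in [set d : R | 0 < d]].

(* A compact interval [a, b] with a < b is encoded by the pair (a, b). *)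
Definition Icc (L : R * R) : set R := `[L.1, L.2].
Definition Ioo (L : R * R) : set R := `]L.1, L.2[.

Definition Ssup f (L : R * R) : \bar R :=
  ereal_sup [set (N (derive1n 2 (arclength_map f) y))%:E | y in vfun f @` Ioo L].

Definition W (delta : R) f G : \bar R :=
  ereal_sup [set w | exists (n : nat) (I : 'I_n -> R * R),
    [/\ (forall k, (I k).1 < (I k).2 /\ Ioo (I k) `<=` G),
        trivIset setT (fun k => Ioo (I k)),
        (forall k, Icc (I k) `<=` G ->
           (delta%:E <= Ssup f (I k) * Var f (Icc (I k)))%E) &
        w = (\sum_(k < n) sqrte (Var f (Icc (I k))))%E]].

Definition Zinterval (J : set int) : Prop :=
  exists l m : \bar int, J = [set k | (l < k%:E)%E /\ (k%:E < m)%E].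

Definition gen_partition_itv (a b : R) (P : set (R * R)) : Prop :=
  exists (J : set int) (x : int -> R),
    [/\ Zinterval J,
        (forall i j, J i -> J j -> i < j -> x i < x j),
        ereal_inf [set (x i)%:E | i in J] = a%:E,
        ereal_sup [set (x i)%:E | i in J] = b%:E &
        P = [set (x k, x (k + 1)) | k in [set k | J k /\ J (k + 1)]]].

Definition gen_partition G (P : set (R * R)) : Prop :=
  [/\ (forall I, P I -> I.1 < I.2),
      \bigcup_(I in P) Ioo I `<=` G &
      forall a b x : R, G x -> connected_component G x = `]a, b[%classic ->
        gen_partition_itv a b [set I | P I /\ Ioo I `<=` `]a, b[]].

Definition fdK_partition f (delta : R) (K : \bar R) G (P : set (R * R)) : Prop :=
  [/\ gen_partition G P,
      (forall I, P I -> (Ssup f I < +oo)%E /\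
                        (Ssup f I * Var f (Icc I) <= K)%E) &
      (forall I, P I -> Icc I `<=` G ->
                 (delta%:E <= Ssup f I * Var f (Icc I))%E)].

End Variation.

(* Main.v *)
(** Write v for the variation function of f, F for its arc-length map, and
    l = v 1.

    From a C^2 curve g = f o h one computes that F'' has norm at most
    2 N(g'') / N(g')^2 wherever g' does not vanish. Hence the critical points of
    g account for D up to the endpoints, and f(D) is null as in Sard's theorem;
    and an interval J = h^-1(I) with S_I V(f,I) >= delta satisfies
    V(f,I) = O(|J|^2), so the sums of sqrt V(f,I) are bounded by the sums of |J|.
    An (f,delta,delta)-partition exists by a greedy choice of the intervals
    starting from the middle of each component of G, and on it
    V sqrt S <= sqrt delta sqrt V.

    Conversely, look for a curve whose square speed at arc length y is Q(y). If
    psi' = sqrt (Q psi) then (F o psi)'' = Q F'' + Q'/2 F', so it suffices that Q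
    is C^1, positive exactly on v(G), that Q F'' is continuous, and that 1/sqrt Q
    is integrable. On an interval (a,b) of length V from the family in (vii)
    take k ((y - a)(b - y))^(3/2) with k = c / (V^2 + V^3 + S V^3): its travel time is
    at most a constant times (sqrt V + V + V sqrt S) / sqrt c, so the travel times
    remain summable for weights c that tend to 0 slowly enough. *)
Require Import Defs.
From HB Require Import structures.
From mathcomp Require Import all_boot all_order all_algebra.
From mathcomp Require Import all_classical all_reals all_analysis.
From mathcomp Require Import measurable_realfun.
From mathcomp Require Import ring lra zify.
Set Implicit Arguments.
Unset Strict Implicit.
Unset Printing Implicit Defensive.
Import Order.TTheory GRing.Theory Num.Theory.
Import numFieldNormedType.Exports.
Local Open Scope classical_set_scope.
Local Open Scope ring_scope.
Local Notation minr := Num.min.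
Local Notation maxr := Num.max.

(** * Calculus on subsets of the line *)

(** Smoothness of [N] serves the passage from a C^2 curve [g] to conditions on [F]: the unit tangent
    [g' / N g'] has to be C^1, which calls for the derivative of [N] and its joint continuity. The
    converse direction meets two obstacles. Outside [v(G)] nothing is known of [F''] and [F] is
    merely Lipschitz; there [Q] and [Q'] vanish, so both derivatives of [F o psi] are 0 whatever [F]
    does. Moreover [Q] must be positive on all of [v(G)], also at an endpoint shared by two
    intervals of (vii), where both of their bumps vanish; small auxiliary bumps over rational
    intervals fill these gaps and, being nonnegative, keep the lower bound for [Q] on which the
    travel time rests. The exponent of a bump has to exceed 1 for [Q] to be C^1 and to stay below 2
    for [1/sqrt Q] to be integrable; with 3/2 the travel time is bounded by an explicit combination
    of fourth roots. The hypothesis on total length makes the remaining arc lengths a null set, so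
    no time is lost there. The homeomorphism is the inverse of the time as a function of the given
    parameter. *)

Section LinearExpressions.
Context {R : pzRingType} {V : lmodType R}.

Inductive lexp := LVar of nat | LAdd of lexp & lexp | LOpp of lexp
  | LScale of R & lexp | LZero.

Fixpoint leval (env : seq V) e : V := match e with
  | LVar n => nth 0 env n
  | LAdd a b => leval env a + leval env b
  | LOpp a => - leval env a
  | LScale c a => c *: leval env a
  | LZero => 0 end.

(** Indices are compared by [eqn], so that [cbn] in [lin_step] decides the tests and leaves plain
    scalar expressions. *)
Fixpoint lcoef e (n : nat) : R := match e with
  | LVar m => if eqn m n then 1 else 0
  | LAdd a b => lcoef a n + lcoef b n
  | LOpp a => - lcoef a n
  | LScale c a => c * lcoef a n
  | LZero => 0 end.

Lemma leval_sum env e : leval env e = \sum_(i < size env) lcoef e i *: env`_i.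
Proof.
elim: e => [n|a IHa b IHb|a IHa|c a IHa|] /=; rewrite ?IHa ?IHb.
- have [ns|ns] := ltnP n (size env).
    rewrite (bigD1 (Ordinal ns))//= -[eqn n n]/(n == n) eqxx scale1r big1 ?addr0// => i /negPf iN.
    case: eqnP => [ni|]; last by rewrite scale0r.
    by move: iN; rewrite -val_eqE /= ni eqxx.
  rewrite nth_default// big1// => i _; case: eqnP => [ni|]; last by rewrite scale0r.
  by have := ltn_ord i; rewrite -ni ltnNge ns.
- by rewrite -big_split; apply: eq_bigr => i _; rewrite scalerDl.
- by rewrite -sumrN; apply: eq_bigr => i _; rewrite scaleNr.
- by rewrite scaler_sumr; apply: eq_bigr => i _; rewrite scalerA.
- by rewrite big1// => i _; rewrite scale0r.
Qed.

Fixpoint lsame e1 e2 n : Prop := match n with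
  | 0%N => True
  | m.+1 => lcoef e1 m = lcoef e2 m /\ lsame e1 e2 m end.

Lemma leval_eq env e1 e2 : lsame e1 e2 (size env) -> leval env e1 = leval env e2.
Proof.
move=> H; rewrite !leval_sum; apply: eq_bigr => -[i /= is_] _; congr (_ *: _).
elim: (size env) is_ H => // n IH; rewrite ltnS leq_eqVlt.
by case/orP => [/eqP ->|/IH H] /= [// _ /H].
Qed.

End LinearExpressions.

Ltac lin_mem x s := lazymatch s with
  | nil => constr:(false)
  | cons x _ => constr:(true)
  | cons _ ?s => lin_mem x s end.

Ltac lin_atoms env t := lazymatch t with
  | ?a + ?b => let env := lin_atoms env a in lin_atoms env b
  | - ?a => lin_atoms env a
  | ?c *: ?a => lin_atoms env a
  | 0 => env
  | _ => lazymatch lin_mem t env with true => env | false => constr:(cons t env) end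
  end.

Ltac lin_index x s := lazymatch s with
  | cons x _ => constr:(0%N)
  | cons _ ?s => let n := lin_index x s in constr:(S n) end.

Ltac lin_reify R env t := lazymatch t with
  | ?a + ?b => let a := lin_reify R env a in let b := lin_reify R env b in
      constr:(@LAdd R a b)
  | - ?a => let a := lin_reify R env a in constr:(@LOpp R a)
  | ?c *: ?a => let a := lin_reify R env a in constr:(@LScale R c a)
  | 0 => constr:(@LZero R)
  | _ => let n := lin_index t env in constr:(@LVar R n)
  end.

(* Reduces an equation between linear combinations of vectors to the equations
   between the coefficients of each vector. *)
Ltac lin_step R := lazymatch goal with |- @eq ?T ?x ?y =>
  let env := lin_atoms (@nil T) x in
  let env := lin_atoms env y in
  let a := lin_reify R env x in
  let b := lin_reify R env y in
  refine (@leval_eq R _ env a b _); cbn [lsame lcoef size eqn]; repeat split end.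
Ltac lin R := lin_step R; try ring.

Section Der.
Context {R : realType} {V : normedModType R}.
Implicit Types (A B : set R) (f g : R -> V) (l : V).

(* Differentiability in the form that makes sense also where the increment of
   the argument vanishes. *)
Definition der A f (x : R) l : Prop := forall e : R, 0 < e ->
  exists2 d : R, 0 < d & forall y, A y -> `|y - x| < d ->
    `|f y - f x - (y - x) *: l| <= e * `|y - x|.

Definition cts A f (x : R) := forall e : R, 0 < e ->
  exists2 d : R, 0 < d & forall y, A y -> `|y - x| < d -> `|f y - f x| <= e.

Lemma derP A f x l : has_derivative_in A f x l <-> der A f x l.
Proof.
split.
  move=> /cvgrPdist_le H e e0; have := H _ e0; rewrite /= => /nbhs_ballP[d /= d0 Hd].
  exists d => // y Ay yx; have [->|yx0] := eqVneq y x.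
    by rewrite !subrr scale0r subr0 !normr0 mulr0.
  have nyx : 0 < `|y - x| by rewrite normr_gt0 subr_eq0.
  have := Hd y; rewrite /ball/= distrC => /(_ yx yx0 Ay) Hy.
  have -> : f y - f x - (y - x) *: l = - ((y - x) *: (l - (y - x)^-1 *: (f y - f x))).
    by rewrite scalerBr scalerA mulfV ?subr_eq0// scale1r opprB.
  by rewrite normrN normrZ mulrC ler_wpM2r// ltW.
move=> H; apply/cvgrPdist_le => e e0; have [d d0 Hd] := H e e0.
apply/nbhs_ballP; exists d => //= y; rewrite /ball/= distrC => yx yx0 Ay.
have nyx : 0 < `|y - x| by rewrite normr_gt0 subr_eq0.
have := Hd y Ay yx.
have -> : f y - f x - (y - x) *: l = - ((y - x) *: (l - (y - x)^-1 *: (f y - f x))).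
  by rewrite scalerBr scalerA mulfV ?subr_eq0// scale1r opprB.
by rewrite normrN normrZ mulrC ler_pM2r.
Qed.

Lemma ctsP A f : {within A, continuous f} <-> forall x, A x -> cts A f x.
Proof.
rewrite subspace_continuousP; split=> H x Ax.
  have /cvgrPdist_le {}H := H x Ax.
  move=> e /H; rewrite /= => /nbhs_ballP[d /= d0 Hd]; exists d => // y Ay yx.
  by rewrite distrC; apply: Hd => //; rewrite /ball/= distrC.
apply/cvgrPdist_le => e /(H x Ax)[d d0 Hd]; apply/nbhs_ballP; exists d => //= y.
by rewrite /ball/= distrC => yx Ay; rewrite distrC; apply: Hd.
Qed.

Lemma ctsT_continuous f x : cts setT f x <-> {for x, continuous f}.
Proof.
split=> H.
  apply/cvgrPdist_le => e /H[d d0 Hd]; apply/nbhs_ballP; exists d => //= y.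
  by rewrite /ball/= distrC => yx; rewrite distrC; apply: Hd.
have /cvgrPdist_le {}H := H.
move=> e /H; rewrite /= => /nbhs_ballP[d /= d0 Hd]; exists d => // y Ay yx.
by rewrite distrC; apply: Hd => //; rewrite /ball/= distrC.
Qed.

Lemma der_sub A B f x l : B `<=` A -> der A f x l -> der B f x l.
Proof. by move=> BA H e /H[d d0 Hd]; exists d => // y /BA; apply: Hd. Qed.

Lemma cts_sub A B f x : B `<=` A -> cts A f x -> cts B f x.
Proof. by move=> BA H e /H[d d0 Hd]; exists d => // y /BA; apply: Hd. Qed.

Lemma der_loc A B f g x l (r : R) : 0 < r ->
  (forall y, A y -> `|y - x| < r -> B y /\ f y = g y) -> f x = g x ->
  der B g x l -> der A f x l.
Proof.
move=> r0 H fg D e /D[d d0 Hd]; exists (minr d r); rewrite ?lt_min ?d0// => y Ay.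
rewrite lt_min => /andP[yd yr]; have [By ->] := H _ Ay yr; rewrite fg; exact: Hd.
Qed.

Lemma cts_loc A B f g x (r : R) : 0 < r ->
  (forall y, A y -> `|y - x| < r -> B y /\ f y = g y) -> f x = g x ->
  cts B g x -> cts A f x.
Proof.
move=> r0 H fg D e /D[d d0 Hd]; exists (minr d r); rewrite ?lt_min ?d0// => y Ay.
rewrite lt_min => /andP[yd yr]; have [By ->] := H _ Ay yr; rewrite fg; exact: Hd.
Qed.

Lemma der_lip A f x l : der A f x l -> forall e, 0 < e -> exists2 d : R, 0 < d &
  forall y, A y -> `|y - x| < d -> `|f y - f x| <= (`|l| + e) * `|y - x|.
Proof.
move=> H e /H[d d0 Hd]; exists d => // y Ay yx.
rewrite -(subrK ((y - x) *: l) (f y - f x)) (le_trans (ler_normD _ _))// normrZ.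
by rewrite mulrDl addrC lerD ?Hd// mulrC.
Qed.

Lemma der_cts A f x l : der A f x l -> cts A f x.
Proof.
move=> /der_lip H e e0; have [d d0 Hd] := H 1 ltr01.
have p1 : 0 < `|l| + 1 by rewrite ltr_wpDl.
exists (minr d (e / (`|l| + 1))); first by rewrite lt_min d0 divr_gt0.
move=> y Ay; rewrite lt_min => /andP[y1 y2]; apply: le_trans (Hd _ Ay y1) _.
by rewrite mulrC -ler_pdivlMr// ltW.
Qed.

Lemma derD A f g x l m : der A f x l -> der A g x m ->
  der A (fun y => f y + g y) x (l + m).
Proof.
move=> F G e e0; have e2 : 0 < e / 2 by rewrite divr_gt0.
have [d d0 Hd] := F _ e2; have [c c0 Hc] := G _ e2.
exists (minr d c); first by rewrite lt_min d0.
move=> y Ay; rewrite lt_min => /andP[y1 y2].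
have -> : f y + g y - (f x + g x) - (y - x) *: (l + m) =
  (f y - f x - (y - x) *: l) + (g y - g x - (y - x) *: m).
  by lin R.
apply: le_trans (ler_normD _ _) _; rewrite [e]splitr mulrDl; apply: lerD.
  exact: Hd.
exact: Hc.
Qed.

Lemma der_cst A x l : der A (fun=> l) x 0.
Proof.
by move=> e e0; exists 1 => // y _ _; rewrite subrr scaler0 subr0 normr0 mulr_ge0// ltW.
Qed.

Lemma derN A f x l : der A f x l -> der A (fun y => - f y) x (- l).
Proof.
move=> H e /H[d d0 Hd]; exists d => // y Ay yx.
by rewrite scalerN -!opprD normrN; apply: Hd.
Qed.

Lemma der0P A f x : (forall e, 0 < e -> exists2 d : R, 0 < d & forall y, A y ->
  `|y - x| < d -> `|f y - f x| <= e * `|y - x|) <-> der A f x 0.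
Proof.
by split=> H e /H[d d0 Hd]; exists d => // y Ay yx;
  have := Hd y Ay yx; rewrite scaler0 subr0.
Qed.

Lemma ctsD A f g x : cts A f x -> cts A g x -> cts A (fun y => f y + g y) x.
Proof.
move=> F G e e0; have e2 : 0 < e / 2 by rewrite divr_gt0.
have [d d0 Hd] := F _ e2; have [c c0 Hc] := G _ e2.
exists (minr d c); first by rewrite lt_min d0.
move=> y Ay; rewrite lt_min => /andP[y1 y2].
have -> : f y + g y - (f x + g x) = (f y - f x) + (g y - g x).
  by lin R.
by apply: le_trans (ler_normD _ _) _; rewrite [e]splitr lerD ?Hd ?Hc.
Qed.

Lemma cts_cst A x l : cts A (fun=> l) x.
Proof. by move=> e e0; exists 1 => // y _ _; rewrite subrr normr0 ltW. Qed.

End Der.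

Section Der2.
Context {R : realType} {V : normedModType R}.
Implicit Types (A B : set R) (f g : R -> V) (a s : R -> R) (l : V).

Lemma ctsZ A a f x : cts A a x -> cts A f x -> cts A (fun y => a y *: f y) x.
Proof.
move=> Ha Hf e e0.
have p1 : 0 < `|a x| + 1 by rewrite ltr_wpDl.
have p2 : 0 < `|f x| + 1 by rewrite ltr_wpDl.
have e1 : 0 < e / 2 / (`|f x| + 1) by rewrite !divr_gt0.
have e2 : 0 < e / 2 / (`|a x| + 1) by rewrite !divr_gt0.
have [d d0 Hd] := Ha _ e1; have [c c0 Hc] := Hf _ e2.
have [b b0 Hb] := Ha _ ltr01.
exists (minr d (minr c b)); first by rewrite !lt_min d0 c0.
move=> y Ay; rewrite !lt_min => /and3P[y1 y2 y3].
have -> : a y *: f y - a x *: f x = a y *: (f y - f x) + (a y - a x) *: f x.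
  by rewrite scalerBr scalerBl addrA subrK.
apply: le_trans (ler_normD _ _) _; rewrite [e]splitr !normrZ lerD//.
  have := Hc _ Ay y2; rewrite ler_pdivlMr// => H; apply: le_trans H.
  rewrite mulrC ler_wpM2l//.
  rewrite -(subrK (a x) (a y)) (le_trans (ler_normD _ _))// addrC lerD2l.
  exact: Hb.
have := Hd _ Ay y1; rewrite ler_pdivlMr// => H; apply: le_trans H.
by rewrite ler_wpM2l// lerDl.
Qed.

Lemma derZ A a f x p l : der A a x p -> der A f x l ->
  der A (fun y => a y *: f y) x (a x *: l + p *: f x).
Proof.
move=> Ha Hf.
have [r r0 Hr] := der_cts Ha ltr01.
move=> e e0; set K : R := `|a x| + 1 + `|f x| + `|l| + 1.
have K0 : 0 < K by rewrite /K; have := normr_ge0 (a x); have := normr_ge0 (f x); have := normr_ge0 l; lra.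
have e3 : 0 < e / K by rewrite !divr_gt0.
have [d1 d10 H1] := Ha _ e3; have [d2 d20 H2] := Hf _ e3.
have [d3 d30 H3] := der_cts Ha e3.
exists (minr r (minr d1 (minr d2 d3))); first by rewrite !lt_min r0 d10 d20.
move=> y Ay; rewrite !lt_min => /and4P[y0 y1 y2 y3].
have -> : a y *: f y - a x *: f x - (y - x) *: (a x *: l + p *: f x) =
  a y *: (f y - f x - (y - x) *: l) + (a y - a x - (y - x) * p) *: f x +
  ((y - x) * (a y - a x)) *: l by lin R.
have axy : `|a y| <= `|a x| + 1.
  by rewrite -(subrK (a x) (a y)) (le_trans (ler_normD _ _))// addrC lerD2l Hr.
have := H1 y Ay y1; have := H2 y Ay y2; have := H3 y Ay y3 => h3 h2 h1.
apply: le_trans (ler_normD _ _) _; apply: le_trans (lerD (ler_normD _ _) (lexx _)) _.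
rewrite !normrZ ?normrM; set h : R := `|y - x|; have h0 : 0 <= h by exact: normr_ge0.
have -> : e * h = (e / K * h) * K by rewrite mulrAC mulfVK// gt_eqF.
have eh : 0 <= e / K * h by rewrite mulr_ge0// ltW.
apply: (@le_trans _ _ ((e / K * h) * ((`|a x| + 1) + `|f x| + `|l|))); last first.
  by rewrite ler_wpM2l// /K lerDl.
rewrite !mulrDr -!mulrDr; rewrite [X in _ <= X]mulrDr [X in _ <= X + _]mulrDr.
rewrite lerD// ?lerD//.
- by rewrite mulrC ler_pM.
- by rewrite ler_wpM2r.
- by rewrite ler_wpM2r// mulrC ler_wpM2r.
Qed.

Lemma der_comp A B (s : R -> R) f t p l : (forall y, A y -> B (s y)) ->
  der A s t p -> der B f (s t) l -> der A (fun y => f (s y)) t (p *: l).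
Proof.
move=> AB Hs Hf e e0.
set K : R := `|p| + 1 + `|l|.
have K0 : 0 < K by rewrite /K; have := normr_ge0 p; have := normr_ge0 l; lra.
have eK : 0 < e / K by rewrite divr_gt0.
have [d1 d10 H1] := Hf _ eK; have [d2 d20 H2] := Hs _ eK.
have [d3 d30 H3] := der_lip Hs ltr01.
have d1' : 0 < d1 / 2 by rewrite divr_gt0.
have [d4 d40 H4] := der_cts Hs d1'.
exists (minr d2 (minr d3 d4)); first by rewrite !lt_min d20 d30.
move=> y Ay; rewrite !lt_min => /and3P[y2 y3 y4].
have -> : f (s y) - f (s t) - (y - t) *: (p *: l) =
  (f (s y) - f (s t) - (s y - s t) *: l) + (s y - s t - (y - t) * p) *: l by lin R.
apply: le_trans (ler_normD _ _) _; rewrite normrZ.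
have h4 : `|s y - s t| < d1 by apply: le_lt_trans (H4 _ Ay y4) _; lra.
have := H1 _ (AB _ Ay) h4; have := H2 _ Ay y2; have := H3 _ Ay y3 => h3 h2 h1.
set h : R := `|y - t|; have h0 : 0 <= h by exact: normr_ge0.
have -> : e * h = (e / K) * ((`|p| + 1) * h) + (e / K * h) * `|l|.
  have -> : e = e / K * K by rewrite mulfVK// gt_eqF.
  by rewrite {2}/K mulfK ?gt_eqF//; ring.
apply: lerD; last by rewrite ler_wpM2r.
by apply: le_trans h1 _; rewrite ler_wpM2l// ltW.
Qed.

Lemma cts_comp A B (s : R -> R) f t : (forall y, A y -> B (s y)) ->
  cts A s t -> cts B f (s t) -> cts A (fun y => f (s y)) t.
Proof.
move=> AB Hs Hf e /Hf[d d0 Hd].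
have d2 : 0 < d / 2 by rewrite divr_gt0.
have [c c0 Hc] := Hs _ d2; exists c => // y Ay yt; apply: Hd; first exact: AB.
by apply: le_lt_trans (Hc _ Ay yt) _; lra.
Qed.

(* At the last point [c] where [|f t - f a| <= M' (t - a)] the derivative would
   still exceed [M' > M] on the right of [c]. *)
Lemma mean_value_ineq f f1 (a b M : R) : a <= b ->
  (forall t, a <= t <= b -> der `[a, b] f t (f1 t)) ->
  (forall t, a <= t <= b -> `|f1 t| <= M) ->
  `|f b - f a| <= M * (b - a).
Proof.
move=> ab D HM.
have M0 : 0 <= M by apply: le_trans (HM a _); rewrite ?lexx.
apply/ler_addgt0Pr => e0 e0p.
set e := e0 / (b - a + 1); have ba1 : 0 < b - a + 1 by lra.
have ep : 0 < e by rewrite divr_gt0.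
suff : `|f b - f a| <= (M + e) * (b - a).
  move=> H; apply: le_trans H _; rewrite mulrDl lerD2l.
  by rewrite /e mulrAC ler_pdivrMr// ler_wpM2l ?ltW//; lra.
set A := [set t : R | a <= t <= b /\ `|f t - f a| <= (M + e) * (t - a)].
have Aa : A a by split; rewrite ?lexx//= !subrr normr0 mulr0.
have hsA : has_sup A by split; [exists a|exists b => t [] /andP[]].
set c := sup A.
have ac : a <= c by apply: sup_ubound => //; case: hsA.
have cb : c <= b by apply: ge_sup; [exists a|move=> t [] /andP[]].
have cab : a <= c <= b by rewrite ac.
have Dc := D c cab.
have Ac : `|f c - f a| <= (M + e) * (c - a).
  apply/ler_addgt0Pr => k k0.
  have k2 : 0 < k / 2 by lra.
  have [d d0 Hd] := der_cts Dc k2.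
  have [t At tc] := sup_adherent d0 hsA.
  have tc' : t <= c by apply: sup_ubound => //; case: hsA.
  case: At => tab Ht.
  have := Hd t; rewrite /= in_itv/= ler0_norm; last by lra.
  move=> /(_ tab) => H; have {}H : `|f t - f c| <= k / 2 by apply: H; rewrite -/c in tc *; lra.
  rewrite -(subrK (f t) (f c)) -addrA; apply: le_trans (ler_normD _ _) _.
  rewrite distrC; have : (M + e) * (t - a) <= (M + e) * (c - a) by rewrite ler_wpM2l; lra.
  lra.
have [cltb|cb'] := ltP c b; last by have -> : b = c by apply/eqP; rewrite eq_le cb'.
exfalso.
have e2 : 0 < e / 2 by lra.
have [d d0 Hd] := der_lip Dc e2.
set t := minr b (c + d / 2).
have ct : c < t by rewrite lt_min cltb/=; lra.
have tb : t <= b by rewrite ge_min lexx.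
have td : t - c < d by have : t <= c + d / 2 by [rewrite ge_min lexx orbT]; lra.
suff : A t by move=> /(sup_ubound (proj2 hsA)); rewrite -/c; lra.
split; first by apply/andP; split; lra.
have := Hd t; rewrite /= in_itv/= ger0_norm; last by lra.
have -> : (a <= t <= b) by apply/andP; split; lra.
move=> /(_ isT td) H.
rewrite -(subrK (f c) (f t)) -addrA; apply: le_trans (ler_normD _ _) _.
have : (`|f1 c| + e / 2) * (t - c) <= (M + e) * (t - c).
  by rewrite ler_wpM2r//; have := HM c cab; lra.
by lra.
Qed.

(** This is the mean value inequality for [f t - t *: f1 x0]. Both ends of the increment are free,
    which is what bounding a variation near [x0] requires. *)
Lemma strict_der f f1 (a b x0 : R) : a <= x0 <= b ->
  (forall t, a <= t <= b -> der `[a, b] f t (f1 t)) -> cts `[a, b] f1 x0 ->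
  forall e, 0 < e -> exists2 d : R, 0 < d & forall x y, a <= x -> x <= y -> y <= b ->
   `|x - x0| < d -> `|y - x0| < d -> `|f y - f x - (y - x) *: f1 x0| <= e * (y - x).
Proof.
move=> x0ab D C e e0; have [d d0 Hd] := C e e0; exists d => // x y ax xy yb xd yd.
have := @mean_value_ineq (fun t => f t + - (t *: f1 x0)) (fun t => f1 t - f1 x0) x y e xy.
have -> : f y - y *: f1 x0 - (f x - x *: f1 x0) = f y - f x - (y - x) *: f1 x0 by lin R.
apply=> t /andP[xt ty].
  have tab : a <= t <= b by rewrite (le_trans ax)// (le_trans ty).
  apply: derD; first by apply: der_sub (D t tab) => u /=; rewrite !in_itv/= => /andP[u1 u2]; rewrite (le_trans ax u1) (le_trans u2 yb).
  apply: derN.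
  move=> k k0; exists 1 => // u _ _.
  have -> : u *: f1 x0 - t *: f1 x0 - (u - t) *: f1 x0 = 0 by lin R.
  by rewrite normr0 mulr_ge0// ltW.
apply: Hd; first by rewrite /= in_itv/= (le_trans ax)// (le_trans ty).
by move: xd yd; rewrite !ltr_norml => /andP[? ?] /andP[? ?]; apply/andP; split; lra.
Qed.

End Der2.

(** * Variation and arc length *)

Section NormVar.
Context {R : realType} {X : normedModType R} {N : X -> R}.
Hypothesis HN : equivalent_norm N.

Lemma eqnD x y : N (x + y) <= N x + N y. Proof. by case: HN. Qed.
Lemma eqnZ (a : R) x : N (a *: x) = `|a| * N x. Proof. by case: HN. Qed.
Lemma eqn_bounds : exists c C : R, [/\ 0 < c, 0 < C &
  forall x, c * `|x| <= N x /\ N x <= C * `|x|].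
Proof. by case: HN. Qed.
Lemma eqn0 : N 0 = 0. Proof. by rewrite -(scale0r (0 : X)) eqnZ normr0 mul0r. Qed.
Lemma eqnN x : N (- x) = N x. Proof. by rewrite -scaleN1r eqnZ normrN1 mul1r. Qed.
Lemma eqn_ge0 x : 0 <= N x.
Proof.
have [c [C [c0 C0 H]]] := eqn_bounds; have [+ _] := H x; apply: le_trans.
by rewrite mulr_ge0 ?normr_ge0// ltW.
Qed.
Lemma eqnB x y : N (x - y) = N (y - x). Proof. by rewrite -eqnN opprB. Qed.
Lemma eqn_tri x y z : N (x - z) <= N (x - y) + N (y - z).
Proof. by rewrite -{1}(subrK y x) -addrA eqnD. Qed.
Lemma eqn_eq0 x : N x = 0 -> x = 0.
Proof.
have [c [C [c0 C0 H]]] := eqn_bounds => x0; have [+ _] := H x; rewrite x0.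
by rewrite pmulr_rle0// normr_le0 => /eqP.
Qed.
Lemma eqn_gt0 x : x != 0 -> 0 < N x.
Proof. by move=> /eqP xn0; rewrite lt_neqAle eqn_ge0 andbT eq_sym; apply/eqP => /eqn_eq0. Qed.
Lemma eqn_lip x y : `|N x - N y| <= N (x - y).
Proof.
rewrite ler_norml; apply/andP; split.
  by rewrite lerNl opprB lerBlDr eqnB (le_trans _ (eqnD _ _))// subrK.
by rewrite lerBlDr (le_trans _ (eqnD _ _))// subrK.
Qed.

Section Variation.
Variable f : R -> X.
Implicit Types (s : seq R) (M : set R).

Fixpoint psum (x : R) s : R := if s is y :: s' then N (f y - f x) + psum y s' else 0.

Lemma psum_sum x s : \sum_(i < (size (x :: s)).-1) N (f (x :: s)`_i.+1 - f (x :: s)`_i)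
  = psum x s.
Proof.
elim: s x => [|y s IH] x /=; first by rewrite big_ord0.
by rewrite big_ord_recl /= -IH.
Qed.

Lemma psum_cat x s t : psum x (s ++ t) = psum x s + psum (last x s) t.
Proof. by elim: s x => [|y s IH] x /=; rewrite ?add0r// IH addrA. Qed.

Lemma psum_lt x s : path <=%R x s -> exists t,
  [/\ path <%R x t, (forall y, y \in t -> y \in s) & psum x t = psum x s].
Proof.
elim: s x => [|y s IH] x /=; first by exists [::].
move=> /andP[xy /IH[t [pt st et]]]; have [E|xy'] := eqVneq x y.
  exists t; split; rewrite ?E ?subrr ?eqn0 ?add0r//.
  by move=> z /st; rewrite inE => ->; rewrite orbT.
exists (y :: t); split => /=; first by rewrite lt_neqAle xy' xy.
  by move=> z; rewrite !inE => /orP[->//|/st ->]; rewrite orbT.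
by rewrite et.
Qed.

Lemma Var_ge M x s : path <=%R x s -> (forall y, y \in x :: s -> M y) ->
  ((psum x s)%:E <= Var N f M)%E.
Proof.
move=> /psum_lt[t [pt st <-]] sM; apply: ereal_sup_ubound; exists (x :: t).
  split => //= y /=; rewrite inE => /orP[/eqP ->|/st ys]; apply: sM; rewrite ?mem_head//.
  by rewrite inE ys orbT.
by rewrite psum_sum.
Qed.

Lemma Var_le M (B : \bar R) : (0 <= B)%E -> (forall x s, path <%R x s ->
  (forall y, y \in x :: s -> M y) -> ((psum x s)%:E <= B)%E) -> (Var N f M <= B)%E.
Proof.
move=> B0 H; apply: ge_ereal_sup => _ [[|x s] [/= ps sM] <-].
  by rewrite big_ord0.
by rewrite psum_sum H// => y ys; apply: sM.
Qed.

Lemma Var_ge0 M : (0 <= Var N f M)%E.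
Proof. by apply: ereal_sup_ubound; exists [::] => //=; rewrite big_ord0. Qed.

Lemma Var_sub M M' : M `<=` M' -> (Var N f M <= Var N f M')%E.
Proof.
move=> MM; apply: Var_le => [|x s ps sM]; first exact: Var_ge0.
by apply: Var_ge; [exact: (sub_path (@ltW _ _))|move=> y /sM /MM].
Qed.

End Variation.

Lemma Var_comp_le (f : R -> X) (h : R -> R) (M M' : set R) :
  (forall x, M x -> M' (h x)) -> (forall x y, M x -> M y -> x < y -> h x <= h y) ->
  (Var N (f \o h) M <= Var N f M')%E.
Proof.
move=> MM hh; apply: Var_le; first exact: Var_ge0.
move=> x s ps sM.
have -> : psum (f \o h) x s = psum f (h x) (map h s).
  by elim: s x {ps sM} => //= y s IH x; rewrite IH.
apply: Var_ge; last first.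
  by move=> y; rewrite -(map_cons h) => /mapP[z zs ->]; apply/MM/sM.
elim: s x ps sM => //= y s IH x /andP[xy ps] sM.
rewrite hh//=; try by apply: sM; rewrite !inE eqxx ?orbT.
by apply: IH => // z zs; apply: sM; rewrite inE zs orbT.
Qed.

Lemma eq_Var (f g : R -> X) M : (forall x, M x -> f x = g x) -> Var N f M = Var N g M.
Proof.
have H (f' g' : R -> X) : (forall x, M x -> f' x = g' x) -> (Var N f' M <= Var N g' M)%E.
  move=> fg; apply: Var_le; first exact: Var_ge0.
  move=> x s ps sM; have -> : psum f' x s = psum g' x s.
    elim: s x {ps} sM => //= y s IH x sM; rewrite !fg ?IH//.
    - by move=> z zs; apply: sM; rewrite inE zs orbT.
    - by apply: sM; rewrite mem_head.
    - by apply: sM; rewrite !inE eqxx orbT.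
  by apply: Var_ge => //; exact: (sub_path (@ltW _ _)).
by move=> fg; apply/le_anti/andP; split; apply: H => // x /fg.
Qed.

Section FiniteVariation.
Variables (f : R -> X) (A B : R).
Hypothesis fbv : (Var N f `[A, B] < +oo)%E.

Definition variation (a b : R) : R := fine (Var N f `[a, b]).

Lemma vvE a b : A <= a -> b <= B -> Var N f `[a, b] = (variation a b)%:E.
Proof.
move=> Aa bB; rewrite fineK// ge0_fin_numE ?Var_ge0//; apply: le_lt_trans fbv.
apply: Var_sub => x /=; rewrite !in_itv/= => /andP[xa xb].
by rewrite (le_trans Aa xa) (le_trans xb bB).
Qed.

Lemma vv_ge0 a b : 0 <= variation a b. Proof. by rewrite fine_ge0// Var_ge0. Qed.

Lemma vv_ge a b x s : A <= a -> b <= B -> path <=%R x s ->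
  (forall y, y \in x :: s -> a <= y <= b) -> psum f x s <= variation a b.
Proof.
move=> Aa bB ps sM; rewrite -lee_fin -vvE//; exact: Var_ge.
Qed.

Lemma vv_le a b K : A <= a -> b <= B -> 0 <= K -> (forall x s, path <%R x s ->
  (forall y, y \in x :: s -> a <= y <= b) -> psum f x s <= K) -> variation a b <= K.
Proof.
move=> Aa bB K0 H; rewrite -lee_fin -vvE//; apply: Var_le; first by rewrite lee_fin.
by move=> x s ps sM; rewrite lee_fin; apply: H => // y /sM; rewrite /= in_itv.
Qed.

(** Inserting [b] into the list cannot decrease the sum, by the triangle inequality; the enlarged
    list is then cut at [b]. *)
Lemma vv_split (b x : R) s : path <=%R x s -> x <= b -> exists s1 s2,
  [/\ path <=%R x s1, path <=%R b s2,
      (forall y, y \in s1 -> x <= y <= b),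
      (forall y, y \in s2 -> b <= y /\ y \in s) &
      psum f x s <= psum f x s1 + psum f b s2].
Proof.
elim: s x => [|y s IH] x /=.
  by move=> _ xb; exists [::], [::]; split => //=; rewrite addr0.
move=> /andP[xy ps] xb; have [yb|by_] := leP y b.
  have [s1 [s2 [p1 p2 m1 m2 e]]] := IH y ps yb; exists (y :: s1), s2; split => //=.
  - by rewrite xy.
  - by move=> z; rewrite inE => /orP[/eqP ->|/m1/andP[yz ->]]; rewrite ?xy// (le_trans xy yz).
  - by move=> z /m2[bz zs]; rewrite inE zs orbT.
  - by rewrite -addrA lerD2l.
exists [:: b], (y :: s); split => //=.
- by rewrite xb.
- by rewrite ps (ltW by_).
- by move=> z; rewrite inE => /eqP ->; rewrite xb lexx.
- move=> z zs; split => //; move: zs; rewrite inE => /orP[/eqP ->|]; first exact: ltW.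
  move=> zs; apply: (le_trans (ltW by_)).
  by move: ps; rewrite (path_sortedE le_trans) => /andP[/allP/(_ _ zs)].
- by rewrite addr0 addrA lerD2r addrC eqn_tri.
Qed.

Lemma vv_add a b c : A <= a -> a <= b -> b <= c -> c <= B -> variation a c = variation a b + variation b c.
Proof.
move=> Aa ab bc cB; have Ab := le_trans Aa ab; have bB := le_trans bc cB.
apply/le_anti/andP; split.
  apply: vv_le => //; first by rewrite addr_ge0// vv_ge0.
  move=> x s /(sub_path (@ltW _ _)) ps sM.
  have [xb|bx] := leP x b.
    have [s1 [s2 [p1 p2 m1 m2 e]]] := vv_split ps xb.
    apply: (le_trans e); apply: lerD; apply: vv_ge => //.
      move=> y; have /andP[ax _] := sM x (mem_head _ _).
      by rewrite inE => /orP[/eqP ->|/m1/andP[xy ->]]; rewrite ?ax ?xb// (le_trans ax).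
    move=> y; rewrite inE => /orP[/eqP ->|/m2[-> ys]]; first by rewrite lexx bc.
    by have /andP[_ ->] : a <= y <= c by apply: sM; rewrite inE ys orbT.
  apply: (@le_trans _ _ (variation b c)); last by rewrite lerDr vv_ge0.
  apply: vv_ge => // y ys; have /andP[_ ->] := sM y ys; rewrite andbT.
  apply: (le_trans (ltW bx)); move: ys; rewrite inE => /orP[/eqP ->//|ys].
  by move: ps; rewrite (path_sortedE le_trans) => /andP[/allP/(_ _ ys)].
have H x s y t : path <%R x s -> (forall z, z \in x :: s -> a <= z <= b) ->
    path <%R y t -> (forall z, z \in y :: t -> b <= z <= c) ->
    psum f x s + psum f y t <= variation a c.
  move=> ps ms pt mt; apply: (@le_trans _ _ (psum f x (s ++ (y :: t)))).
    by rewrite psum_cat lerD2l /= lerDr eqn_ge0.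
  apply: vv_ge => //.
    rewrite cat_path (sub_path (@ltW _ _) ps)/= (sub_path (@ltW _ _) pt) andbT.
    have /andP[_ l1] := ms _ (mem_last x s); have /andP[l2 _] := mt _ (mem_head y t).
    exact: le_trans l2.
  move=> z; rewrite -cat_cons mem_cat => /orP[/ms/andP[-> zb]|/mt/andP[bz ->]].
    by rewrite (le_trans zb).
  by rewrite (le_trans ab).
(* The two suprema are taken one after the other: first over lists in [[a, b]], with the list in
   [[b, c]] fixed. *)
have H2 y t : path <%R y t -> (forall z, z \in y :: t -> b <= z <= c) ->
    variation a b <= variation a c - psum f y t.
  move=> pt mt; apply: vv_le => //.
    rewrite subr_ge0; apply: vv_ge => //; first exact: (sub_path (@ltW _ _)).
    by move=> z /mt/andP[bz ->]; rewrite (le_trans ab).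
  by move=> x s ps ms; rewrite lerBrDr H.
rewrite addrC -lerBrDr; apply: vv_le => //.
  rewrite subr_ge0 -lee_fin -!vvE//; apply: Var_sub => x /=; rewrite !in_itv/=.
  by move=> /andP[-> xb]; rewrite (le_trans xb).
by move=> x s ps ms; rewrite lerBrDr addrC -lerBrDr H2.
Qed.

Lemma vv_xx a : A <= a -> a <= B -> variation a a = 0.
Proof. by move=> Aa aB; have := vv_add Aa (lexx a) (lexx a) aB; lra. Qed.

Lemma vv_ge_N a x y b : A <= a -> b <= B -> a <= x -> x <= y -> y <= b ->
  N (f y - f x) <= variation a b.
Proof.
move=> Aa bB ax xy yb; have := @vv_ge a b x [:: y] Aa bB; rewrite /= addr0 xy; apply=> // z.
rewrite !inE => /orP[|] /eqP ->; first by rewrite ax (le_trans xy).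
by rewrite yb (le_trans ax).
Qed.

(** Otherwise replacing the last step of a list, from [p] to [x], by the variation on [[p, x]] would
    always gain [e], and all sums would stay below [variation a x - e]. With its mirror image
    [vv_right] this yields continuity of the variation function. *)
Lemma vv_left (a x e : R) : A <= a -> a < x -> x <= B -> 0 < e -> exists2 p : R,
  a <= p < x & variation p x <= N (f x - f p) + e.
Proof.
move=> Aa ax xB e0; apply: contrapT => H.
suff : variation a x <= variation a x - e by lra.
have K p : a <= p < x -> N (f x - f p) + e <= variation p x.
  by move=> px; rewrite leNgt; apply/negP => /ltW h; apply: H; exists p.
apply: vv_le => //.
  by have := K a; rewrite lexx ax => /(_ isT); have := eqn_ge0 (f x - f a); lra.
move=> y s ps ms.
have [//|[p [apx Hp]]] : psum f y s <= variation a x - e \/ exists p, a <= p < x /\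
    psum f y s <= variation a p + N (f x - f p); last first.
  have := K _ apx; case/andP: apx => ap px; rewrite (@vv_add a p x)//; last exact: ltW.
  lra.
case/lastP: s ps ms => [|s z] ps ms.
  right; exists a; rewrite lexx ax; split => //=; rewrite addr_ge0 ?eqn_ge0 ?vv_ge0//.
right; rewrite -cats1 psum_cat/= addr0.
move: ps; rewrite rcons_path => /andP[ps lz].
have ms1 w : w \in y :: s -> a <= w <= x.
  by move=> ws; apply: ms; rewrite inE mem_rcons inE orbCA -in_cons ws orbT.
have /andP[az zx] : a <= z <= x by apply: ms; rewrite inE mem_rcons inE eqxx orbT.
have le_last w : w \in y :: s -> w <= last y s.
  move=> ws; elim: s y w ps {lz ms ms1} ws => [|u s IH] y w /=; first by rewrite inE => _ /eqP ->.
  move=> /andP[yu ps]; rewrite inE => /orP[/eqP ->|]; last exact: IH.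
  by apply: le_trans (ltW yu) (IH u u ps _); rewrite mem_head.
set l := last y s in le_last lz *.
have /andP[al _] : a <= l <= x by apply: ms1; rewrite mem_last.
have [zx'|xz] := ltP z x.
  exists z; rewrite az zx'; split => //; rewrite ler_wpDr ?eqn_ge0//.
  have -> : psum f y s + N (f z - f l) = psum f y (rcons s z) by rewrite -cats1 psum_cat/= addr0.
  apply: vv_ge => //; first exact: le_trans (ltW zx') xB.
    by rewrite (sub_path (@ltW _ _))// rcons_path ps.
  move=> w; rewrite inE mem_rcons inE orbCA -in_cons => /orP[/eqP ->|ws]; first by rewrite az lexx.
  by have /andP[-> _] := ms1 w ws; rewrite (le_trans (le_last _ ws) (ltW lz)).
have Ez : z = x by apply/le_anti; rewrite zx xz.
rewrite Ez in lz *; exists l; rewrite al lz; split => //; rewrite lerD2r; apply: vv_ge => //.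
- exact: le_trans (ltW lz) xB.
- exact: (sub_path (@ltW _ _)).
- by move=> w ws; have /andP[-> _] := ms1 w ws; rewrite le_last.
Qed.

End FiniteVariation.
End NormVar.

(** * Increasing homeomorphisms and derivatives of inverses *)

Section RealHomeo.
Context {R : realType}.

(** The identity [t (s x) = x] is asked at one point only, and [s] need not be monotone: in
    [psi_der] the two maps are inverse to each other only near the point considered. *)
Lemma der_inverse (A B : set R) (s t : R -> R) (x m : R) : 0 < m ->
  (forall y, B y -> A (t y)) -> (forall y, B y -> s (t y) = y) -> t (s x) = x ->
  der A s x m -> cts B t (s x) -> der B t (s x) m^-1.
Proof.
move=> m0 BA st ts D C e e0.
(* The bound [m / 2] makes [t] Lipschitz at [s x] with constant [2 / m]; the other bound absorbs
   this factor and the division by [m]. *)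
set k : R := minr (m / 2) (e * m * m / 2).
have k0 : 0 < k by rewrite lt_min !divr_gt0// !mulr_gt0.
have km : k <= m / 2 by rewrite ge_min lexx.
have ke : k <= e * m * m / 2 by rewrite ge_min lexx orbT.
have [d d0 Hd] := D k k0.
have d2 : 0 < d / 2 by lra.
have [c c0 Hc] := C _ d2.
exists c => // y By yc; have := Hc y By yc; rewrite ts => Ht.
have := Hd _ (BA _ By) (le_lt_trans Ht _); rewrite st// => H1.
have {}H1 : `|y - s x - (t y - x) * m| <= k * `|t y - x| by apply: H1; lra.
have H2 : `|t y - x| * (m / 2) <= `|y - s x|.
  have : `|(t y - x) * m| <= `|y - s x| + k * `|t y - x|.
    have -> : (t y - x) * m = (y - s x) - (y - s x - (t y - x) * m) by ring.
    by rewrite (le_trans (ler_normB _ _))// lerD2l.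
  rewrite normrM (gtr0_norm m0).
  have := ler_wpM2r (normr_ge0 (t y - x)) km; lra.
rewrite /GRing.scale/=.
have -> : t y - x - (y - s x) * m^-1 = - (m^-1 * (y - s x - (t y - x) * m)).
  by field; rewrite gt_eqF.
rewrite normrN normrM (gtr0_norm (_ : 0 < m^-1)) ?invr_gt0//.
rewrite mulrC ler_pdivrMr//; apply: (le_trans H1).
have := ler_wpM2r (normr_ge0 (t y - x)) ke.
have : e * m * (`|t y - x| * (m / 2)) <= e * m * `|y - s x|.
  by rewrite ler_wpM2l// mulr_ge0 ?ltW.
lra.
Qed.

Definition homeo_pair (a b c d : R) (h g : R -> R) : Prop :=
  [/\ (forall x, a <= x <= b -> c <= h x <= d /\ g (h x) = x),
      (forall y, c <= y <= d -> a <= g y <= b /\ h (g y) = y),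
      (forall x y, a <= x -> x < y -> y <= b -> h x < h y),
      (forall x, a <= x <= b -> cts `[a, b] h x) &
      (forall y, c <= y <= d -> cts `[c, d] g y)].

Lemma homeo_pair_sym a b c d h g : homeo_pair a b c d h g -> homeo_pair c d a b g h.
Proof.
move=> [hg gh hI hc gc]; split => // x y cx xy yd.
have [gx xE] : a <= g x <= b /\ h (g x) = x by apply: gh; rewrite cx (le_trans (ltW xy)).
have [gy yE] : a <= g y <= b /\ h (g y) = y by apply: gh; rewrite yd (le_trans cx (ltW xy)).
rewrite ltNge; apply/negP => H.
move: H; rewrite le_eqVlt => /orP[/eqP E|H].
  by move: xy; rewrite -xE -yE E ltxx.
have := hI (g y) (g x); case/andP: gy => -> _; case/andP: gx => _ ->.
by rewrite xE yE => /(_ isT H isT) /(lt_trans xy); rewrite ltxx.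
Qed.

Lemma homeo_pair_le a b c d h g x y : homeo_pair a b c d h g ->
  a <= x -> x <= y -> y <= b -> h x <= h y.
Proof.
move=> [_ _ H _ _] ax; rewrite le_eqVlt => /orP[/eqP ->//|xy yb].
by rewrite ltW// H.
Qed.

Lemma homeo_pair_ends a b c d h g : a <= b -> homeo_pair a b c d h g ->
  [/\ h a = c, h b = d, g c = a, g d = b & c <= d].
Proof.
move=> ab H; have H' := homeo_pair_sym H; case: (H) => hg gh hI _ _.
have [/andP[cha had] gha] : c <= h a <= d /\ g (h a) = a by apply: hg; rewrite lexx.
have [/andP[chb hbd] ghb] : c <= h b <= d /\ g (h b) = b by apply: hg; rewrite lexx andbT.
have cd : c <= d by apply: le_trans had.
have [/andP[agc gcb] hgc] : a <= g c <= b /\ h (g c) = c by apply: gh; rewrite lexx.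
have [/andP[agd gdb] hgd] : a <= g d <= b /\ h (g d) = d by apply: gh; rewrite lexx andbT.
have E1 : h a = c.
  by apply/le_anti; rewrite cha andbT -hgc (homeo_pair_le H)// ?agc ?gcb.
have E2 : h b = d.
  by apply/le_anti; rewrite hbd /= -hgd (homeo_pair_le H)// ?agd ?gdb.
by split => //; rewrite -?E1 -?E2.
Qed.

Lemma increasing_homeoP a b c d h :
  increasing_homeo a b c d h <-> exists g, homeo_pair a b c d h g.
Proof.
split=> [[hI [g [hg gh /ctsP hc /ctsP gc]]]|[g [hg gh hI hc gc]]].
  exists g; split.
  - by move=> x xab; have := hg x; rewrite !in_itv/=; apply.
  - by move=> y ycd; have := gh y; rewrite !in_itv/=; apply.
  - move=> x y ax xy yb; apply: hI => //; rewrite in_itv/= ?ax ?yb ?(le_trans _ yb) ?(le_trans ax)//; exact: ltW.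
  - by move=> x xab; apply: hc; rewrite /= in_itv.
  - by move=> y ycd; apply: gc; rewrite /= in_itv.
split.
  by move=> x y; rewrite !in_itv/= => /andP[ax _] /andP[_ yb] xy; apply: hI.
exists g; split.
- by move=> x; rewrite !in_itv/=; exact: hg.
- by move=> x; rewrite !in_itv/=; exact: gh.
- by apply/ctsP => x /=; rewrite in_itv; exact: hc.
- by apply/ctsP => x /=; rewrite in_itv; exact: gc.
Qed.

(** Surjectivity comes from the intermediate value theorem, and a monotone surjection between
    intervals, such as the inverse, is continuous. *)
Lemma incr_homeo a b (h : R -> R) : a <= b ->
  (forall x y, a <= x -> x < y -> y <= b -> h x < h y) ->
  (forall x, a <= x <= b -> cts `[a, b] h x) ->
  exists g, homeo_pair a b (h a) (h b) h g.
Proof.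
move=> ab hI hc.
have hL x y : a <= x -> x <= y -> y <= b -> h x <= h y.
  by move=> ax; rewrite le_eqVlt => /orP[/eqP ->//|xy yb]; rewrite ltW// hI.
have hC : {within `[a, b], continuous h} by apply/ctsP => x /=; rewrite in_itv; exact: hc.
have surj y : h a <= y <= h b -> exists x, a <= x <= b /\ h x = y.
  move=> yab; have hab : h a <= h b by case/andP: yab; exact: le_trans.
  have := @IVT _ h a b y ab hC.
  by rewrite (min_idPl hab) (max_idPr hab) => /(_ yab)[x]; rewrite in_itv/= => xab <-; exists x.
pose g y := xget a [set x | a <= x <= b /\ h x = y].
have gP y : h a <= y <= h b -> a <= g y <= b /\ h (g y) = y.
  by move=> /surj ex; exact: (xgetPex a ex).
have inj x y : a <= x <= b -> a <= y <= b -> h x = h y -> x = y.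
  move=> /andP[ax xb] /andP[ay yb] E; have [xy|yx|//] := ltgtP x y.
    by have := hI _ _ ax xy yb; rewrite E ltxx.
  by have := hI _ _ ay yx xb; rewrite E ltxx.
have hg x : a <= x <= b -> h a <= h x <= h b /\ g (h x) = x.
  move=> /andP[ax xb].
  have hx : h a <= h x <= h b by rewrite !hL.
  split => //; have [? ?] := gP _ hx; apply: inj => //; exact/andP.
have gI x y : h a <= x -> x < y -> y <= h b -> g x < g y.
  move=> ax xy yb; have [/andP[agx gxb] Ex] : a <= g x <= b /\ h (g x) = x by apply: gP; rewrite ax (le_trans (ltW xy)).
  have [/andP[agy gyb] Ey] : a <= g y <= b /\ h (g y) = y by apply: gP; rewrite yb (le_trans ax (ltW xy)).
  rewrite ltNge; apply/negP => H.
  by have := hL _ _ agy H gxb; rewrite Ex Ey leNgt xy.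
have aab : a <= a <= b by rewrite lexx.
have bab : a <= b <= b by rewrite lexx andbT.
have gC : {within `[h a, h b], continuous g}.
  apply: segment_inc_surj_continuous.
    move=> x y; rewrite !in_itv/= => /andP[ax xb] /andP[ay yb].
    have [xy|yx] := leP x y; last by apply/negbTE; rewrite -ltNge gI.
    by move: xy; rewrite le_eqVlt => /orP[/eqP ->|xy]; [rewrite lexx|rewrite ltW// gI].
  rewrite (hg a aab).2 (hg b bab).2 => x /=; rewrite in_itv/= => /hg[hx gx].
  by exists (h x); rewrite /= ?in_itv.
exists g; split => //.
by move=> y yab; have /ctsP := gC; apply; rewrite /= in_itv.
Qed.

End RealHomeo.

(** * Continuity and derivative of the variation function *)

Section ArcLength.
Context {R : realType} {X : normedModType R} {N : X -> R}.
Hypothesis HN : equivalent_norm N.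

Local Notation vv := (@variation R X N).

Lemma Var_homeo (f : R -> X) a b c d h g x y : homeo_pair a b c d h g ->
  a <= x -> x <= y -> y <= b -> Var N (f \o h) `[x, y] = Var N f `[h x, h y].
Proof.
move=> H ax xy yb; have H' := homeo_pair_sym H; case: (H) => hg gh _ _ _.
have ay := le_trans ax xy; have xb := le_trans xy yb.
have [/andP[chx hxd] ghx] : c <= h x <= d /\ g (h x) = x by apply: hg; rewrite ax.
have [/andP[chy hyd] ghy] : c <= h y <= d /\ g (h y) = y by apply: hg; rewrite ay.
apply/le_anti/andP; split.
  apply: (Var_comp_le HN) => [t|t s] /=; rewrite !in_itv/=.
    move=> /andP[xt ty]; rewrite !(homeo_pair_le H)//.
      exact: le_trans ax xt.
    exact: le_trans ty yb.
  move=> /andP[xt ty] /andP[xs sy] ts; apply: (homeo_pair_le H) => //.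
  - exact: le_trans ax xt.
  - exact: ltW.
  - exact: le_trans sy yb.
rewrite (@eq_Var _ _ _ HN f ((f \o h) \o g)); last first.
  move=> t /=; rewrite in_itv/= => /andP[xt ty].
  by rewrite (gh t _).2// (le_trans chx xt) (le_trans ty hyd).
apply: (Var_comp_le HN) => [t|t s] /=; rewrite !in_itv/=.
  move=> /andP[xt ty]; rewrite -{1}ghx -{1}ghy !(homeo_pair_le H')//.
    exact: le_trans chx xt.
  exact: le_trans ty hyd.
move=> /andP[xt ty] /andP[xs sy] ts; apply: (homeo_pair_le H') => //.
- exact: le_trans chx xt.
- exact: ltW.
- exact: le_trans sy hyd.
Qed.

Section FiniteVar.
Variables (f : R -> X) (A B : R).
Hypothesis fbv : (Var N f `[A, B] < +oo)%E.

Lemma vv_right (x b e : R) : A <= x -> x < b -> b <= B -> 0 < e -> exists2 p : R,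
  x < p <= b & vv f x p <= N (f p - f x) + e.
Proof.
move=> Ax xb bB e0; apply: contrapT => H.
suff : vv f x b <= vv f x b - e by lra.
have K p : x < p <= b -> N (f p - f x) + e <= vv f x p.
  by move=> px; rewrite leNgt; apply/negP => /ltW h; apply: H; exists p.
apply: (vv_le HN fbv) => //.
  by have := K b; rewrite lexx xb => /(_ isT); have := eqn_ge0 HN (f b - f x); lra.
move=> y s ps ms.
have [//|[p [pxb Hp]]] : psum (N := N) f y s <= vv f x b - e \/ exists p, x < p <= b /\
    psum (N := N) f y s <= N (f p - f x) + vv f p b; last first.
  have := K _ pxb; case/andP: pxb => xp pb; rewrite (@vv_add _ _ _ HN f A B fbv x p b)//; last exact: ltW.
  lra.
right; have sle := sub_path (@ltW _ _).
have /andP[xy yb] := ms y (mem_head _ _).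
move: xy; rewrite le_eqVlt => /orP[/eqP xy|xy]; last first.
  exists y; rewrite xy yb; split => //; apply: (@le_trans _ _ (vv f y b)); last by rewrite lerDr eqn_ge0.
  apply: (vv_ge HN fbv); [exact: le_trans (ltW xy)|by []|exact: sle|].
  move=> w; rewrite inE => /orP[/eqP ->|ws]; first by rewrite lexx.
  have /andP[_ ->] : x <= w <= b by apply: ms; rewrite inE ws orbT.
  by move: (sle _ _ _ _ ps); rewrite (path_sortedE le_trans) => /andP[/allP/(_ _ ws) ->].
case: s ps ms => [|p s] ps ms /=.
  by exists b; rewrite xb lexx; split => //; apply: addr_ge0; [exact: eqn_ge0|exact: vv_ge0].
move: ps => /= /andP[yp ps].
have /andP[_ pb] : x <= p <= b by apply: ms; rewrite !inE eqxx orbT.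
exists p; rewrite xy yp pb; split => //; rewrite lerD2l; apply: (vv_ge HN fbv) => //.
- by apply: (le_trans Ax); rewrite xy ltW.
- exact: sle.
move=> w; rewrite inE => /orP[/eqP ->|ws]; first by rewrite lexx.
have /andP[_ ->] : x <= w <= b by apply: ms; rewrite !inE ws !orbT.
by move: (sle _ _ _ _ ps); rewrite (path_sortedE le_trans) => /andP[/allP/(_ _ ws) ->].
Qed.

(** For [y] between the point [p] of [vv_left] and [x], subtracting the variation on [[p, y]] from
    that on [[p, x]] leaves at most [N (f x - f y) + e / 2], which is small because [f] is
    continuous. The right side is symmetric. *)
Lemma vv_cts x : A <= x <= B -> cts `[A, B] f x -> cts `[A, B] (vv f A) x.
Proof.
move=> /andP[Ax xB] C e e0; have [c0 [C0 [c00 C00 HC]]] := eqn_bounds HN.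
have e2 : 0 < e / 2 by lra.
have e3 : 0 < e / 2 / C0 by rewrite divr_gt0.
have [d d0 Hd] := C _ e3.
have HdN y : A <= y <= B -> `|y - x| < d -> N (f y - f x) <= e / 2.
  move=> yAB yx; have [_ H] := HC (f y - f x); apply: (le_trans H).
  by rewrite mulrC -ler_pdivlMr//; apply: Hd => //=; rewrite in_itv.
have [dl dl0 Hl] : exists2 dl : R, 0 < dl & forall y, A <= y -> y <= x ->
    x - y < dl -> vv f y x <= e.
  move: (Ax); rewrite le_eqVlt => /orP[/eqP Ax'|{}Ax].
    exists 1 => // y Ay yA _; have -> : y = x by apply/le_anti; rewrite yA -Ax' Ay.
    by rewrite (vv_xx HN fbv)// ltW.
  have [p /andP[Ap px] Hp] := vv_left HN fbv (lexx A) Ax xB e2.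
  exists (minr d (x - p)); first by rewrite lt_min d0 subr_gt0.
  move=> y Ay yx; rewrite lt_min => /andP[y1 y2].
  have py : p <= y by lra.
  have := vv_add HN fbv Ap py yx xB.
  have := @vv_ge_N _ _ _ HN f A B fbv p p y y Ap (le_trans yx xB) (lexx _) py (lexx _).
  have := eqn_tri HN (f x) (f y) (f p).
  have : N (f x - f y) <= e / 2.
    by rewrite eqnB//; apply: HdN; rewrite ?Ay ?(le_trans yx)// ler0_norm; lra.
  lra.
have [dr dr0 Hr] : exists2 dr : R, 0 < dr & forall y, x <= y -> y <= B ->
    y - x < dr -> vv f x y <= e.
  move: (xB); rewrite le_eqVlt => /orP[/eqP xB'|{}xB].
    exists 1 => // y xy yB _; have -> : y = x by apply/le_anti; rewrite xy xB' yB.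
    by rewrite (vv_xx HN fbv)// ltW.
  have [p /andP[xp pB] Hp] := vv_right Ax xB (lexx B) e2.
  exists (minr d (p - x)); first by rewrite lt_min d0 subr_gt0.
  move=> y xy yB; rewrite lt_min => /andP[y1 y2].
  have yp : y <= p by lra.
  have := vv_add HN fbv Ax xy yp pB.
  have := @vv_ge_N _ _ _ HN f A B fbv y y p p (le_trans Ax xy) pB (lexx _) yp (lexx _).
  have := eqn_tri HN (f p) (f y) (f x).
  have : N (f y - f x) <= e / 2.
    by apply: HdN; rewrite ?(le_trans Ax xy)// ger0_norm; lra.
  lra.
exists (minr dl dr); first by rewrite lt_min dl0.
move=> y; rewrite /= in_itv/= => /andP[Ay yB]; rewrite lt_min => /andP[].
have [xy|yx] := leP x y.
  rewrite ger0_norm ?subr_ge0// => _ /(Hr _ xy yB) H.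
  by rewrite (vv_add HN fbv (lexx _) Ax xy yB) addrAC subrr add0r ger0_norm// vv_ge0.
rewrite (ler0_norm (_ : y - x <= 0)); last lra. rewrite opprB => /(Hl _ Ay (ltW yx)) H _.
rewrite (vv_add HN fbv (lexx _) Ay (ltW yx) xB) opprD addrA subrr add0r normrN ger0_norm//.
by rewrite vv_ge0.
Qed.

Lemma vv_lip_le a b (L : R) : A <= a -> a <= b -> b <= B ->
  (forall x y, a <= x -> x <= y -> y <= b -> N (f y - f x) <= L * (y - x)) ->
  vv f a b <= L * (b - a).
Proof.
move=> Aa ab bB H.
have L0 : 0 <= L * (b - a) by apply: le_trans (H a b _ _ _); rewrite ?eqn_ge0 ?lexx.
move: (ab); rewrite le_eqVlt => /orP[/eqP <-|altb].
  by rewrite subrr mulr0 (vv_xx HN fbv)// (le_trans ab).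
have {}L0 : 0 <= L by move: L0; rewrite pmulr_lge0// subr_gt0.
apply: (vv_le HN fbv) => //; first by rewrite mulr_ge0// subr_ge0.
move=> x s /(sub_path (@ltW _ _)) ps ms.
apply: (@le_trans _ _ (L * (b - x))); last first.
  by rewrite ler_wpM2l// lerD2l lerN2; have /andP[] := ms x (mem_head _ _).
elim: s x ps ms => [|y s IH] x /= => [_ ms|/andP[xy ps] ms].
  by rewrite mulr_ge0// subr_ge0; have /andP[] := ms x (mem_head _ _).
have /andP[ax _] := ms x (mem_head _ _).
have /andP[_ yb] : a <= y <= b by apply: ms; rewrite !inE eqxx orbT.
have -> : L * (b - x) = L * (y - x) + L * (b - y) by ring.
apply: lerD; first exact: H.
by apply: IH => // z zs; apply: ms; rewrite inE zs orbT.
Qed.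

(** Near [x0] every increment of [f] is [(t - s) *: f1 x0] up to [e * (t - s)], by [strict_der]. So
    [f] is Lipschitz there with constant [N (f1 x0) + e], which bounds the variation from above,
    while a single increment bounds it from below. *)
Lemma vv_der (f1 : R -> X) : A <= B ->
  (forall t, A <= t <= B -> der `[A, B] f t (f1 t)) ->
  (forall t, A <= t <= B -> cts `[A, B] f1 t) ->
  forall x, A <= x <= B -> der `[A, B] (vv f A) x (N (f1 x)).
Proof.
move=> AB D C x0 x0AB e e0; have [c0 [C0 [c00 C00 HC]]] := eqn_bounds HN.
have e3 : 0 < e / C0 by rewrite divr_gt0.
have [d d0 Hd] := strict_der x0AB D (C _ x0AB) e3.
have HdN x y : A <= x -> x <= y -> y <= B -> `|x - x0| < d -> `|y - x0| < d ->
    N (f y - f x - (y - x) *: f1 x0) <= e * (y - x).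
  move=> Ax xy yB h1 h2; have [_ H] := HC (f y - f x - (y - x) *: f1 x0).
  apply: (le_trans H); rewrite mulrC -ler_pdivlMr// mulrAC; exact: Hd.
have key x y : A <= x -> x <= y -> y <= B -> `|x - x0| < d -> `|y - x0| < d ->
    `|vv f x y - (y - x) * N (f1 x0)| <= e * (y - x).
  move=> Ax xy yB h1 h2.
  have E s t : s <= t -> (t - s) * N (f1 x0) = N ((t - s) *: f1 x0).
    by move=> st; rewrite eqnZ// ger0_norm// subr_ge0.
  have up : vv f x y <= (N (f1 x0) + e) * (y - x).
    apply: vv_lip_le => // s t xs st ty.
    have -> : f t - f s = (f t - f s - (t - s) *: f1 x0) + (t - s) *: f1 x0 by rewrite subrK.
    apply: (le_trans (eqnD HN _ _)); rewrite -E//.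
    suff : N (f t - f s - (t - s) *: f1 x0) <= e * (t - s) by lra.
    apply: HdN => //; [exact: le_trans xs|exact: le_trans yB| |];
      by move: h1 h2; rewrite !ltr_norml => /andP[? ?] /andP[? ?]; apply/andP; split; lra.
  have lo : (y - x) * N (f1 x0) <= vv f x y + e * (y - x).
    rewrite E//; have -> : (y - x) *: f1 x0 = (f y - f x) - (f y - f x - (y - x) *: f1 x0).
      by lin R.
    apply: (le_trans (eqnD HN _ _)); rewrite eqnN//; apply: lerD; last exact: HdN.
    exact: (vv_ge_N HN fbv).
  rewrite ler_norml; apply/andP; split; lra.
exists d => // y; rewrite /= in_itv/= => /andP[Ay yB] yx0; case/andP: (x0AB) => Ax0 x0B.
have d0' : `|x0 - x0| < d by rewrite subrr normr0.
rewrite /GRing.scale/=; have [xy|/ltW yx] := leP x0 y.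
  have := key x0 y Ax0 xy yB d0' yx0.
  rewrite (ger0_norm (_ : 0 <= y - x0)) ?subr_ge0//.
  have -> // : vv f A y - vv f A x0 = vv f x0 y by have := vv_add HN fbv (lexx _) Ax0 xy yB; lra.
have := key y x0 Ay yx x0B yx0 d0'.
rewrite (distrC y) (ger0_norm (_ : 0 <= x0 - y)) ?subr_ge0// -normrN.
congr (`|_| <= _); have := vv_add HN fbv (lexx _) Ay yx x0B; move=> ->; ring.
Qed.

End FiniteVar.
End ArcLength.

Section Interior.
Context {R : realType} {V : normedModType R}.
Implicit Types (f g : R -> V).

Lemma itv_ball (a b x : R) : a < x < b -> exists2 r : R, 0 < r &
  forall y, `|y - x| < r -> a < y < b.
Proof.
move=> /andP[ax xb]; exists (minr (x - a) (b - x)); first by rewrite lt_min !subr_gt0 ax.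
by move=> y; rewrite lt_min !ltr_norml => /andP[/andP[? ?] /andP[? ?]]; apply/andP; split; lra.
Qed.

Lemma der_interior f (a b x : R) l : a < x < b -> der `[a, b] f x l -> der setT f x l.
Proof.
move=> /itv_ball[r r0 H]; apply: (der_loc r0) => // y _ /H /andP[ay yb].
by split => //; rewrite /= in_itv/= !ltW.
Qed.

Lemma cts_interior f (a b x : R) : a < x < b -> cts `[a, b] f x -> cts setT f x.
Proof.
move=> /itv_ball[r r0 H]; apply: (cts_loc r0) => // y _ /H /andP[ay yb].
by split => //; rewrite /= in_itv/= !ltW.
Qed.

Lemma der_derive1 f (x : R) l : der setT f x l -> f^`()%classic x = l.
Proof.
move=> D; rewrite derive1E; apply: cvg_lim => //.
apply/cvgrPdist_le => e /D[d d0 Hd]; apply/nbhs_ballP; exists d => //= h.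
rewrite /ball/= sub0r normrN => hd h0.
have nh : 0 < `|h| by rewrite normr_gt0.
have := Hd (h + x) I; rewrite addrK => /(_ hd).
have -> : f (h + x) - f x - h *: l = - (h *: (l - h^-1 *: (f (h *: 1 + x) - f x))).
  rewrite scalerBr scalerA mulfV// scale1r opprB /GRing.scale/= mulr1//.
by rewrite normrN normrZ mulrC ler_pM2r.
Qed.

Lemma der_shift (A B : set R) f (s x : R) l : (forall y, A y -> B (y + s)) ->
  der B f (x + s) l -> der A (fun y => f (y + s)) x l.
Proof.
move=> AB D e /D[d d0 Hd]; exists d => // y Ay yx; have := Hd (y + s) (AB _ Ay).
by rewrite opprD addrACA subrr addr0; apply.
Qed.

Lemma cts_shift (A B : set R) f (s x : R) : (forall y, A y -> B (y + s)) ->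
  cts B f (x + s) -> cts A (fun y => f (y + s)) x.
Proof.
move=> AB D e /D[d d0 Hd]; exists d => // y Ay yx; apply: Hd; first exact: AB.
by rewrite opprD addrACA subrr addr0.
Qed.

Lemma C2_onP (a b : R) f : C2_on a b f <-> exists f1 f2 : R -> V,
  [/\ (forall x, a <= x <= b -> der `[a, b] f x (f1 x)),
      (forall x, a <= x <= b -> der `[a, b] f1 x (f2 x)) &
      (forall x, a <= x <= b -> cts `[a, b] f2 x)].
Proof.
split=> -[f1 [f2 [H1 H2 H3]]]; exists f1, f2; split.
- by move=> x xab; apply/derP/H1; rewrite in_itv.
- by move=> x xab; apply/derP/H2; rewrite in_itv.
- by move=> x xab; move/ctsP: H3; apply; rewrite /= in_itv.
- by move=> x; rewrite in_itv => xab; apply/derP/H1.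
- by move=> x; rewrite in_itv => xab; apply/derP/H2.
- by apply/ctsP => x /=; rewrite in_itv => xab; apply: H3.
Qed.

Lemma eq_C2_on (a b : R) f g : (forall x, a <= x <= b -> f x = g x) ->
  C2_on a b g -> C2_on a b f.
Proof.
move=> fg /C2_onP[f1 [f2 [H1 H2 H3]]]; apply/C2_onP; exists f1, f2; split => // x xab.
apply: (der_loc ltr01 _ _ (H1 x xab)); last exact: fg.
by move=> y /= Ay _; split => //; apply: fg; move: Ay; rewrite in_itv.
Qed.

End Interior.

(** * The arc-length map and the regular set [G] *)

Section ArcLengthMap.
Context {R : realType} {X : normedModType R} {N : X -> R}.
Hypothesis HN : equivalent_norm N.
Variable f : R -> X.
Hypothesis fbv : BV01 N f.
Hypothesis fcts : forall x, 0 <= x <= 1 -> cts `[0, 1] f x.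

Local Notation v := (vfun N f).
Local Notation F := (arclength_map N f).
Local Notation vv := (@variation R X N).

Lemma v_add x y : 0 <= x -> x <= y -> y <= 1 -> v y = v x + vv f x y.
Proof. exact: (vv_add HN fbv (lexx 0)). Qed.

Lemma v_le x y : 0 <= x -> x <= y -> y <= 1 -> v x <= v y.
Proof. by move=> x0 xy y1; rewrite (v_add x0 xy y1) lerDl vv_ge0. Qed.

Lemma v_cts x : 0 <= x <= 1 -> cts `[0, 1] v x.
Proof. by move=> x01; apply: (vv_cts HN fbv x01); apply: fcts. Qed.

Lemma v0 : v 0 = 0. Proof. exact: (vv_xx HN fbv). Qed.

Lemma VarE x y : 0 <= x -> x <= y -> y <= 1 -> Var N f `[x, y] = (v y - v x)%:E.
Proof.
move=> x0 xy y1; rewrite (vvE HN fbv)//; congr (_%:E).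
by rewrite (v_add x0 xy y1) addrAC subrr add0r.
Qed.

Lemma f_lip x y : 0 <= x -> x <= y -> y <= 1 -> N (f y - f x) <= v y - v x.
Proof.
move=> x0 xy y1; rewrite (v_add x0 xy y1) addrAC subrr add0r.
exact: (vv_ge_N HN fbv).
Qed.

Lemma v_ge0 x : 0 <= x <= 1 -> 0 <= v x <= v 1.
Proof. by move=> /andP[x0 x1]; rewrite -{1}v0 !v_le. Qed.

(** [arclength_map] is a chosen factor of [f] through [v]; one exists because [v x = v t] forces
    [f x = f t], by [f_lip]. *)
Lemma F_v x : 0 <= x <= 1 -> F (v x) = f x.
Proof.
move=> x01; have ex : exists F0 : R -> X, forall x : R, x \in `[0, 1] -> f x = F0 (v x).
  pose g y := xget 0 [set x | 0 <= x <= 1 /\ v x = y].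
  exists (f \o g) => t; rewrite in_itv/= => t01.
  have [] : 0 <= g (v t) <= 1 /\ v (g (v t)) = v t.
    by apply: (xgetPex 0 (P := [set x | 0 <= x <= 1 /\ v x = v t])); exists t.
  move: t01 => /andP[t0 t1] /andP[g0 g1] E.
  apply/eqP; rewrite -subr_eq0; apply/eqP/(eqn_eq0 HN)/le_anti; rewrite (eqn_ge0 HN) andbT.
  have [gt|tg] := leP (g (v t)) t; first by have := f_lip g0 gt t1; rewrite E subrr.
  by rewrite (eqnB HN); have := f_lip t0 (ltW tg) g1; rewrite E subrr.
have := xgetPex (fun=> 0) ex; rewrite -/(arclength_map N f) => /(_ x).
by rewrite in_itv/= x01 => /(_ isT) ->.
Qed.

Lemma v_surj y : 0 <= y <= v 1 -> exists2 x, 0 <= x <= 1 & v x = y.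
Proof.
move=> yl; have vC : {within `[0, 1], continuous v}.
  by apply/ctsP => x /=; rewrite in_itv; exact: v_cts.
have v1 : 0 <= v 1 by case/andP: yl; exact: le_trans.
have := @IVT _ v 0 1 y ler01 vC.
by rewrite v0 (min_idPl v1) (max_idPr v1) => /(_ yl)[x]; rewrite in_itv/= => xab <-; exists x.
Qed.

Lemma F_lip y z : 0 <= y -> y <= z -> z <= v 1 -> N (F z - F y) <= z - y.
Proof.
move=> y0 yz z1; have [x x01 xE] : exists2 x, 0 <= x <= 1 & v x = y.
  by apply: v_surj; rewrite y0 (le_trans yz).
have [t t01 tE] : exists2 x, 0 <= x <= 1 & v x = z.
  by apply: v_surj; rewrite z1 (le_trans y0).
rewrite -xE -tE !F_v//; case/andP: (x01) => x0 x1; case/andP: (t01) => t0 t1.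
have [xt|/ltW tx] := leP x t; first exact: f_lip.
have E : v x = v t by apply/le_anti/andP; split; [rewrite xE tE|exact: v_le].
by rewrite (eqnB HN) E subrr -[leRHS](subrr (v x)) {2}E f_lip.
Qed.

(** For [f] this means being constant on no subinterval of [[c, d]], a condition implicit in the
    existence of an arc-length parametrization. *)
Definition v_strict c d := forall x y, c <= x -> x < y -> y <= d -> v x < v y.

Lemma v_homeo c d : 0 <= c -> c < d -> d <= 1 -> v_strict c d ->
  exists g, homeo_pair c d (v c) (v d) v g.
Proof.
move=> c0 cd d1 vs; apply: incr_homeo => //; first exact: ltW.
move=> x /andP[cx xd]; apply: cts_sub (v_cts _); last by rewrite (le_trans c0)// (le_trans xd).
by move=> y /=; rewrite !in_itv/= => /andP[cy yd]; rewrite (le_trans c0)// (le_trans yd).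
Qed.

(** An arc-length parametrization is unique up to translation: [v (h s) = v c + (s - u)] makes
    [f o h] a translate of [F]. Conversely the inverse of [v] on [[c, d]] provides one. Membership
    in [D] thereby becomes a statement about [v] and [F]. *)
Lemma C2_arclengthP c d : 0 <= c -> c < d -> d <= 1 ->
  has_C2_arclength_parametrization N c d f <-> v_strict c d /\ C2_on (v c) (v d) F.
Proof.
move=> c0 cd d1; split; last first.
  move=> [vs C2]; have [g H] := v_homeo c0 cd d1 vs; have H' := homeo_pair_sym H.
  have vcd : v c < v d by apply: vs.
  exists (v c), (v d), g; split => //.
  - by apply/increasing_homeoP; exists v.
  - move=> s t cs st td; rewrite (Var_homeo HN f H' cs (ltW st) td).
    case: (H') => gP vP gI _ _.
    have [/andP[cg gd] E] : c <= g s <= d /\ v (g s) = s.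
      by apply: gP; rewrite cs (le_trans (ltW st)).
    have [/andP[cg' gd'] E'] : c <= g t <= d /\ v (g t) = t.
      by apply: gP; rewrite td (le_trans cs (ltW st)).
    rewrite VarE ?E ?E'//; first exact: le_trans cg.
      by rewrite ltW// gI.
    exact: le_trans gd' d1.
  - apply: eq_C2_on C2 => y ycd /=; case: (H') => gP _ _ _ _.
    have [/andP[cg gd] E] := gP _ ycd.
    by rewrite -{2}E F_v// (le_trans c0 cg) (le_trans gd).
move=> [u [w [h [uw /increasing_homeoP[g H] arc C2]]]].
have H' := homeo_pair_sym H; case: (H) => hP gP hI _ _.
have [hu hw gc gd _] := homeo_pair_ends (ltW uw) H.
have key s : u <= s -> s <= w -> v (h s) = v c + (s - u).
  move=> us sw; move: (us); rewrite le_eqVlt => /orP[/eqP <-|us'].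
    by rewrite hu subrr addr0.
  have := arc u s (lexx _) us' sw; rewrite (Var_homeo HN f H (lexx u) us sw) hu.
  have [/andP[chs hsd] _] : c <= h s <= d /\ g (h s) = s by apply: hP; rewrite us.
  rewrite VarE//; last exact: le_trans hsd d1.
  by move=> [E]; lra.
have vd : v d = v c + (w - u) by rewrite -hw key// ltW.
split.
  move=> x y cx xy yd.
  have [/andP[ug gw] E] : u <= g x <= w /\ h (g x) = x.
    by apply: gP; rewrite cx (le_trans (ltW xy)).
  have [/andP[ug' gw'] E'] : u <= g y <= w /\ h (g y) = y.
    by apply: gP; rewrite yd (le_trans cx (ltW xy)).
  have [_ _ gI _ _] := H'.
  by have := gI _ _ cx xy yd; rewrite -E -E' !key//; rewrite !E !E'; lra.
have FE y : v c <= y <= v d -> F y = f (h (y + (u - v c))).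
  move=> /andP[cy yd]; have E : y = v (h (y + (u - v c))) by rewrite key; lra.
  rewrite {1}E F_v//.
  have [/andP[ch hd] _] : c <= h (y + (u - v c)) <= d /\ g (h (y + (u - v c))) = y + (u - v c).
    by apply: hP; apply/andP; split; lra.
  by rewrite (le_trans c0 ch) (le_trans hd).
have AB y : `[v c, v d]%classic y -> `[u, w]%classic (y + (u - v c)).
  by rewrite /= !in_itv/= => /andP[? ?]; apply/andP; split; lra.
apply: (eq_C2_on FE); move/C2_onP : C2 => [k1 [k2 [D1 D2 D3]]]; apply/C2_onP.
have yP y : v c <= y <= v d -> u <= y + (u - v c) <= w.
  by move=> /andP[? ?]; apply/andP; split; lra.
exists (fun y => k1 (y + (u - v c))), (fun y => k2 (y + (u - v c))); split => y /yP yP'.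
- exact: (der_shift AB (D1 _ yP')).
- exact: (der_shift AB (D2 _ yP')).
- exact: (cts_shift AB (D3 _ yP')).
Qed.

Local Notation G := (`[0%R, 1%R]%classic `\` Dset N f : set R).
Local Notation F1 := (F^`()%classic).
Local Notation F2 := (derive1n 2 F).

(** Inside the interval the derivatives within [[v c, v d]] are those of the total function [F].
    Unit speed follows by comparing [vv_der] with the fact that [F] has variation [t - s] on
    [[s, t]]. *)
Lemma F_regular c d y : v_strict c d -> 0 <= c -> c < d -> d <= 1 ->
  C2_on (v c) (v d) F -> v c < y < v d ->
  [/\ der setT F y (F1 y), der setT F1 y (F2 y), cts setT F2 y & N (F1 y) = 1].
Proof.
move=> vs c0 cd d1 /C2_onP[k1 [k2 [D1 D2 D3]]] yI.
have sub z : v c < z < v d -> v c <= z <= v d by move=> /andP[/ltW -> /ltW].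
have E1 z : v c < z < v d -> F1 z = k1 z.
  by move=> zI; apply/der_derive1/(der_interior zI)/D1/sub.
have D2' z : v c < z < v d -> der setT F1 z (k2 z).
  move=> zI; have [r r0 Hr] := itv_ball zI.
  apply: (der_loc r0 _ _ (D2 z (sub _ zI))); last exact: E1.
  by move=> t _ /Hr tI; split; [rewrite /= in_itv/= sub|exact: E1].
have E2 z : v c < z < v d -> F2 z = k2 z.
  by move=> zI; apply: der_derive1; exact: D2'.
have [r r0 Hr] := itv_ball yI.
split.
- by rewrite E1//; apply/(der_interior yI)/D1/sub.
- by rewrite E2//; exact: D2'.
- apply: (cts_loc r0 _ _ (D3 y (sub _ yI))); last exact: E2.
  by move=> t _ /Hr tI; split; [rewrite /= in_itv/= sub|exact: E2].
rewrite E1//.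
have [g H] := v_homeo c0 cd d1 vs; have H' := homeo_pair_sym H.
have vcd : v c <= v d by apply/ltW/vs.
have VE s t : v c <= s -> s <= t -> t <= v d -> Var N F `[s, t] = (t - s)%:E.
  move=> cs st td; case: (H') => gP vP gI _ _.
  have -> : Var N F `[s, t] = Var N (f \o g) `[s, t].
    apply: (eq_Var HN) => z /=; rewrite in_itv/= => /andP[sz zt].
    have [/andP[cg gd] E] : c <= g z <= d /\ v (g z) = z.
      by apply: gP; rewrite (le_trans cs)// (le_trans zt).
    by rewrite -{1}E F_v// (le_trans c0 cg) (le_trans gd).
  rewrite (Var_homeo HN f H' cs st td).
  have [/andP[cg gd] E] : c <= g s <= d /\ v (g s) = s.
    by apply: gP; rewrite cs (le_trans st).
  have [/andP[cg' gd'] E'] : c <= g t <= d /\ v (g t) = t.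
    by apply: gP; rewrite td (le_trans cs st).
  rewrite VarE ?E ?E'//; first exact: le_trans cg.
    exact: (homeo_pair_le H').
  exact: le_trans gd' d1.
have Fbv : (Var N F `[v c, v d] < +oo)%E by rewrite VE// ltry.
have C1 t : v c <= t <= v d -> cts `[v c, v d] k1 t by move=> /D2 /der_cts.
have := vv_der HN Fbv vcd D1 C1 (sub _ yI); move=> /(der_interior yI)/der_derive1 <-.
apply: der_derive1; apply: (der_interior yI).
apply: (der_loc (g := fun t => t - v c) (B := setT) ltr01) => //.
- by move=> t /=; rewrite in_itv/= => /andP[ct td] _; split => //; rewrite /variation VE.
- by case/andP: (sub _ yI) => cy yd; rewrite /variation VE.
by move=> e e0; exists 1 => // t _ _; rewrite /GRing.scale/= mulr1 opprB addrA subrK subrr normr0 mulr_ge0// ltW.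
Qed.

Lemma G_local x : G x -> exists c d, [/\ 0 <= c, d <= 1, c < x < d,
  v_strict c d /\ C2_on (v c) (v d) F & forall y, c < y < d -> G y].
Proof.
move=> [x01 xD]; apply: contrapT => H; apply: xD; split=> // -[c [d [c0 d1 cxd]]].
have cd : c < d by case/andP: cxd; exact: lt_trans.
move=> /[dup] A /(C2_arclengthP c0 cd d1) K; apply: H; exists c, d; split => //.
move=> y cyd; case/andP: (cyd) => cy yd; split.
  by rewrite /= in_itv/= (le_trans c0 (ltW cy)) (le_trans (ltW yd)).
by move=> [_]; apply; exists c, d.
Qed.

Lemma G_intro c d x : 0 <= c -> d <= 1 -> c < x < d -> v_strict c d ->
  C2_on (v c) (v d) F -> G x.
Proof.
move=> c0 d1 cxd vs C2; have cd : c < d by case/andP: cxd; exact: lt_trans.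
case/andP: (cxd) => cx xd; split.
  by rewrite /= in_itv/= (le_trans c0 (ltW cx)) (le_trans (ltW xd)).
by move=> [_]; apply; exists c, d; split => //; apply/C2_arclengthP.
Qed.

Lemma G_open x : G x -> exists2 r : R, 0 < r & forall y, `|y - x| < r -> G y.
Proof.
by move=> /G_local[c [d [c0 d1 /itv_ball[r r0 H] _ K]]]; exists r => // y /H /K.
Qed.

Lemma G_01 x : G x -> 0 < x < 1.
Proof.
move=> /G_local[c [d [c0 d1 /andP[cx xd] _ _]]].
by rewrite (le_lt_trans c0 cx) (lt_le_trans xd).
Qed.

(** Near a point of [G] the function [v] increases strictly, so one end in [G] is enough. In
    particular [v] takes the same value at a point of [G] and at no other point. *)
Lemma G_v_lt x y : 0 <= x -> x < y -> y <= 1 -> (G x \/ G y) -> v x < v y.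
Proof.
move=> x0 xy y1 [] /G_local[c [d [c0 d1 /andP[ac cb] [vs _] _]]].
  apply: (@lt_le_trans _ _ (v (minr y d))).
    by apply: vs; [exact: ltW|rewrite lt_min xy|rewrite ge_min lexx orbT].
  apply: v_le => //; last by rewrite ge_min lexx.
  by rewrite le_min (le_trans x0 (ltW xy)) (le_trans c0 (ltW (lt_trans ac cb))).
apply: (@le_lt_trans _ _ (v (maxr x c))).
  apply: v_le => //; first by rewrite le_max lexx.
  by rewrite ge_max (le_trans (ltW xy))//= (le_trans (ltW ac)).
by apply: vs; [rewrite le_max lexx orbT|rewrite gt_max xy|exact: ltW].
Qed.

Lemma vG_regular y : (v @` G) y ->
  [/\ der setT F y (F1 y), der setT F1 y (F2 y), cts setT F2 y & N (F1 y) = 1].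
Proof.
move=> [x /G_local[c [d [c0 d1 /andP[cx xd] [vs C2] _]]] <-].
have cd := lt_trans cx xd.
by apply: (F_regular vs c0 cd d1 C2); rewrite !vs// ltW.
Qed.

Lemma vG_open y : (v @` G) y -> exists2 r : R, 0 < r & forall z, `|z - y| < r -> (v @` G) z.
Proof.
move=> [x /G_local[c [d [c0 d1 /andP[cx xd] [vs C2] GI]]] <-].
have cd := lt_trans cx xd.
have [g H] := v_homeo c0 cd d1 vs; have H' := homeo_pair_sym H.
have vI : v c < v x < v d by rewrite !vs// ltW.
have [r r0 Hr] := itv_ball vI; exists r => // z /Hr /andP[cz zd].
case: (H') => gP vP gI _ _.
have [/andP[cg gd] E] : c <= g z <= d /\ v (g z) = z by apply: gP; rewrite !ltW.
exists (g z) => //; apply: GI; rewrite !lt_neqAle cg gd !andbT.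
apply/andP; split; apply/eqP => E2; first by move: cz; rewrite -E -E2 ltxx.
by move: zd; rewrite -E E2 ltxx.
Qed.

Lemma vG_range y : (v @` G) y -> 0 < y < v 1.
Proof.
move=> [x Gx <-]; have /andP[x0 x1] := G_01 Gx.
by rewrite -{1}v0; apply/andP; split; apply: G_v_lt => //; rewrite ?ltW//; [right|left].
Qed.

End ArcLengthMap.

(** * Reparametrization by a prescribed speed *)

Section SqrtSpeed.
Context {R : realType} {X : normedModType R}.

Lemma der_sqrt (y : R) : 0 < y -> der setT (@Num.sqrt R) y (2 * Num.sqrt y)^-1.
Proof.
move=> y0 e e0; set s : R := Num.sqrt y; have s0 : 0 < s by rewrite sqrtr_gt0.
have ss : s * s = y by rewrite -expr2 sqr_sqrtr// ltW.
exists (minr y (e * (2 * s * y))); first by rewrite lt_min y0 !mulr_gt0.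
move=> z _; rewrite lt_min => /andP[zy zd].
have z0 : 0 < z by move: zy; rewrite ltr_norml => /andP[? ?]; lra.
set r : R := Num.sqrt z; have r0 : 0 < r by rewrite sqrtr_gt0.
have rr : r * r = z by rewrite -expr2 sqr_sqrtr// ltW.
rewrite /GRing.scale/=.
have -> : r - s - (z - y) * (2 * s)^-1 = - ((z - y) * (z - y) * ((2 * s) * (r + s) ^+ 2)^-1).
  by rewrite -rr -ss; field; rewrite !gt_eqF// addr_gt0.
have p0 : 0 < 2 * s * (r + s) ^+ 2 by rewrite !mulr_gt0// addr_gt0.
rewrite normrN !normrM (gtr0_norm (_ : 0 < _^-1)) ?invr_gt0//.
rewrite ler_pdivrMr//; set h : R := `|z - y| in zy zd *.
have h0 : 0 <= h by exact: normr_ge0.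
have -> : e * h * (2 * s * (r + s) ^+ 2) = h * (e * (2 * s * (r + s) ^+ 2)) by ring.
rewrite ler_wpM2l//; apply: (le_trans (ltW zd)).
by rewrite !ler_wpM2l ?mulr_ge0 ?(ltW s0) ?(ltW e0)// -ss; nra.
Qed.

Variables (F F1 F2 : R -> X) (U : set R) (l C : R) (Q Q1 psi : R -> R).
Hypothesis C0 : 0 < C.
Hypothesis HF : forall y, U y -> der setT F y (F1 y).
Hypothesis HF1 : forall y, U y -> der setT F1 y (F2 y).
Hypothesis F1C : forall y, U y -> `|F1 y| <= C.
Hypothesis Flip : forall y z, 0 <= y <= l -> 0 <= z <= l -> `|F z - F y| <= C * `|z - y|.
Hypothesis Qge0 : forall y, 0 <= Q y.
Hypothesis Qgt0 : forall y, U y -> 0 < Q y.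
Hypothesis QN0 : forall y, ~ U y -> Q y = 0.
Hypothesis HQ : forall y, der setT Q y (Q1 y).
Hypothesis HQ1 : forall y, cts setT Q1 y.
Hypothesis HH : forall y, 0 <= y <= l -> cts `[0, l] (fun y => Q y *: F2 y) y.
Hypothesis psiI : forall t, 0 <= t <= 1 -> 0 <= psi t <= l.
Hypothesis Hpsi : forall t, 0 <= t <= 1 -> der `[0, 1] psi t (Num.sqrt (Q (psi t))).

Let q t : R := Num.sqrt (Q (psi t)).

(** Such a [y] is a minimum of [Q]; a small step against the sign of [Q1 y] would make [Q]
    negative. *)
Lemma Q1_N0 y : ~ U y -> Q1 y = 0.
Proof.
move=> Uy; apply/eqP/negP => /negP Q10.
have := HQ y; have e0 : 0 < `|Q1 y| / 2 by rewrite divr_gt0// normr_gt0.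
move=> /(_ _ e0)[d d0 Hd].
pose z : R := y - Num.sg (Q1 y) * (d / 2).
have zy : `|z - y| = d / 2.
  rewrite /z addrAC subrr add0r normrN normrM normr_sg Q10 mul1r ger0_norm//; lra.
have := Hd z I; rewrite zy (QN0 Uy) subr0 => H.
have {}H : `|Q z - (z - y) *: Q1 y| <= `|Q1 y| / 2 * (d / 2) by apply: H; lra.
have E : (z - y) *: Q1 y = - (`|Q1 y| * (d / 2)).
  by rewrite /GRing.scale/= /z normrEsg; ring.
move: H; rewrite E opprK => H.
have := Qge0 z; have p : 0 < `|Q1 y| * (d / 2) by rewrite mulr_gt0 ?normr_gt0//; lra.
rewrite ger0_norm in H; last by have := Qge0 z; lra.
lra.
Qed.

(* Regularizing the square root makes the chain rule available also at the
   zeros of [Q]; the bound survives the limit. *)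
Lemma sqrt_speed_lip (a b e : R) : 0 <= a -> a <= b -> b <= 1 ->
  (forall t, a <= t <= b -> `|Q1 (psi t)| <= 2 * e) ->
  (q a = 0 -> q b <= e * (b - a)) /\ (q b = 0 -> q a <= e * (b - a)).
Proof.
move=> a0 ab b1 He.
have key k : 0 < k -> `|Num.sqrt (Q (psi b) + k) - Num.sqrt (Q (psi a) + k)| <= e * (b - a).
  move=> k0.
  pose w t : R := Num.sqrt (Q (psi t) + k).
  have w0 t : 0 < Q (psi t) + k by rewrite ltr_wpDl.
  have qw t : q t <= w t by rewrite ler_wsqrtr// lerDl ltW.
  have w0' t : 0 < w t by rewrite sqrtr_gt0.
  apply: (@mean_value_ineq _ _ w (fun t => q t * (Q1 (psi t) * (2 * w t)^-1)) a b e ab).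
    move=> t /andP[ta tb]; have t01 : 0 <= t <= 1 by rewrite (le_trans a0)// (le_trans tb).
    have sub : `[a, b] `<=` `[0, 1].
      by move=> u /=; rewrite !in_itv/= => /andP[? ?]; apply/andP; split; lra.
    have D1 : der setT (fun y => Num.sqrt (Q y + k)) (psi t) (Q1 (psi t) *: (2 * w t)^-1).
      apply: (@der_comp _ _ setT setT (fun y => Q y + k) (@Num.sqrt R)) => //.
        by rewrite -[Q1 _]addr0; apply: derD (HQ _) (der_cst _ _ _).
      exact: der_sqrt.
    exact: (@der_comp _ _ `[a, b] setT psi _ t (q t) _ _ (der_sub sub (Hpsi t01)) D1).
  move=> t tab; have H := He t tab.
  have w2 : 0 < 2 * w t by rewrite mulr_gt0.
  rewrite mulrA normrM (gtr0_norm (_ : 0 < _^-1)) ?invr_gt0// ler_pdivrMr//.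
  rewrite normrM ger0_norm ?sqrtr_ge0//; have -> : e * (2 * w t) = w t * (2 * e) by ring.
  by apply: ler_pM => //; exact: sqrtr_ge0.
have lim (x y : R) : 0 <= x -> 0 <= y -> (forall k, 0 < k -> `|Num.sqrt (x + k) - Num.sqrt (y + k)| <= e * (b - a)) ->
    Num.sqrt y = 0 -> Num.sqrt x <= e * (b - a).
  move=> x0 y0 H /eqP; rewrite sqrtr_eq0 => yle.
  have {yle y0} E : y = 0 by apply/le_anti; rewrite yle.
  apply/ler_addgt0Pr => k k0.
  have k2 : 0 < k ^+ 2 by rewrite exprn_gt0.
  have := H _ k2; rewrite E add0r sqrtr_sqr (gtr0_norm k0) => H1.
  have h2 : Num.sqrt x <= Num.sqrt (x + k ^+ 2) by rewrite ler_wsqrtr// lerDl ltW.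
  by move: H1; rewrite ler_norml => /andP[_ H1]; lra.
split; apply: (lim _ _ (Qge0 _) (Qge0 _)) => k k0; first exact: key.
by rewrite distrC; exact: key.
Qed.

(** [Q1 o psi] is continuous and vanishes at [t], so it stays below [2 * e] between [t] and [s];
    [sqrt_speed_lip] turns this into [q s <= e * |s - t|]. *)
Lemma q_der0 t : 0 <= t <= 1 -> ~ U (psi t) -> der `[0, 1] q t 0.
Proof.
move=> t01 Ut; apply/der0P => e e0.
have C1 : cts `[0, 1] (fun t => Q1 (psi t)) t.
  apply: (@cts_comp _ _ `[0, 1] setT psi Q1 t) => //.
  exact: der_cts (Hpsi t01).
have e2 : 0 < 2 * e by lra.
have [d d0 Hd] := C1 _ e2; exists d => // s s01 st.
have qt : q t = 0 by rewrite /q QN0// sqrtr0.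
have qs : 0 <= q s by exact: sqrtr_ge0.
rewrite qt subr0 ger0_norm//.
move: s01; rewrite /= in_itv/= => /andP[s0 s1]; case/andP: t01 => t0 t1.
have B u : (t <= u <= s) || (s <= u <= t) -> `|Q1 (psi u)| <= 2 * e.
  move=> ut; have := Hd u; rewrite /= in_itv/= (Q1_N0 Ut) subr0; apply.
    by case/orP: ut => /andP[? ?]; apply/andP; split; lra.
  by move: st; rewrite !ltr_norml => /andP[? ?]; case/orP: ut => /andP[? ?]; apply/andP; split; lra.
have [ts|/ltW st'] := leP t s.
  rewrite ger0_norm ?subr_ge0//; apply: (sqrt_speed_lip t0 ts s1 _).1 qt => u ut.
  by apply: B; rewrite ut.
rewrite ler0_norm ?subr_le0// opprB; apply: (sqrt_speed_lip s0 st' t1 _).2 qt => u ut.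
by apply: B; rewrite ut orbT.
Qed.

(** The factor [sqrt Q] from [psi'] cancels the denominator in the derivative of the square root.
    Therefore the square of the speed, and not the speed itself, is what has to be C^1 as a function
    of arc length. *)
Lemma q_der t : 0 <= t <= 1 -> der `[0, 1] q t (Q1 (psi t) / 2).
Proof.
move=> t01; have [Ut|Ut] := pselect (U (psi t)); last first.
  by rewrite (Q1_N0 Ut) mul0r; exact: q_der0.
have Q0 := Qgt0 Ut; have q0 : 0 < q t by rewrite sqrtr_gt0.
have D1 : der setT (fun y => Num.sqrt (Q y)) (psi t) (Q1 (psi t) *: (2 * q t)^-1).
  by apply: (@der_comp _ _ setT setT Q (@Num.sqrt R)) => //; exact: der_sqrt.
have := @der_comp _ _ `[0, 1] setT psi _ t _ _ _ (Hpsi t01) D1.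
have -> : Q1 (psi t) / 2 = q t *: (Q1 (psi t) *: (2 * q t)^-1).
  by rewrite /GRing.scale/=; field; rewrite gt_eqF.
exact.
Qed.

Lemma comp_der t : 0 <= t <= 1 -> der `[0, 1] (fun t => F (psi t)) t (q t *: F1 (psi t)).
Proof.
move=> t01; have [Ut|Ut] := pselect (U (psi t)).
  by apply: (@der_comp _ _ `[0, 1] setT psi F t) => //; [exact: Hpsi|exact: HF].
have qt : q t = 0 by rewrite /q QN0// sqrtr0.
rewrite qt scale0r; apply/der0P => e e0.
have := Hpsi t01; rewrite -/(q t) qt => /der0P H.
have eC : 0 < e / C by rewrite divr_gt0.
have [d d0 Hd] := H _ eC; exists d => // s s01 st.
apply: le_trans (Flip _ _) _; [exact: psiI|by apply: psiI; move: s01; rewrite /= in_itv|].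
by have := Hd s s01 st; rewrite mulrAC ler_pdivlMr// mulrC.
Qed.

(** On [U] this is the product rule. Elsewhere [q] has derivative 0, and the factor [F1] is
    harmless: it is bounded on [U], while [q] vanishes at times when [psi] is outside [U]. *)
Lemma comp_der2 t : 0 <= t <= 1 -> der `[0, 1] (fun t => q t *: F1 (psi t)) t
  (Q (psi t) *: F2 (psi t) + (Q1 (psi t) / 2) *: F1 (psi t)).
Proof.
move=> t01; have [Ut|Ut] := pselect (U (psi t)).
  have := derZ (q_der t01) (@der_comp _ _ `[0, 1] setT psi F1 t _ _ (fun _ _ => I) (Hpsi t01) (HF1 Ut)).
  rewrite scalerA -/(q t); have -> : q t * q t = Q (psi t).
    by rewrite -expr2 sqr_sqrtr.
  exact.
rewrite (QN0 Ut) (Q1_N0 Ut) mul0r !scale0r addr0; apply/der0P => e e0.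
have /der0P H := q_der0 t01 Ut.
have eC : 0 < e / C by rewrite divr_gt0.
have [d d0 Hd] := H _ eC; exists d => // s s01 st.
have qt : q t = 0 by rewrite /q QN0// sqrtr0.
rewrite qt scale0r subr0; have := Hd s s01 st; rewrite qt subr0 => Hs.
have [Us|Us] := pselect (U (psi s)); last first.
  have -> : q s = 0 by rewrite /q QN0// sqrtr0.
  by rewrite scale0r normr0 mulr_ge0// ltW.
rewrite normrZ; apply: (@le_trans _ _ (`|q s| * C)); first by rewrite ler_wpM2l// F1C.
by move: Hs; rewrite mulrAC ler_pdivlMr.
Qed.

Lemma speed_C2 : C2_on 0 1 (fun t => F (psi t)).
Proof.
apply/C2_onP; exists (fun t => q t *: F1 (psi t)),
  (fun t => Q (psi t) *: F2 (psi t) + (Q1 (psi t) / 2) *: F1 (psi t)); split.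
- exact: comp_der.
- exact: comp_der2.
move=> t t01; have Cpsi := der_cts (Hpsi t01); apply: ctsD.
  apply: (@cts_comp _ _ `[0, 1] `[0, l] psi (fun y => Q y *: F2 y) t) => //.
  by apply: HH; exact: psiI.
have CQ : cts `[0, 1] (fun t => Q1 (psi t)) t.
  exact: (@cts_comp _ _ `[0, 1] setT psi Q1 t).
have [Ut|Ut] := pselect (U (psi t)).
  apply: ctsZ.
    have -> : (fun t => Q1 (psi t) / 2) = (fun t => (Q1 (psi t)) *: (2^-1 : R)) by [].
    by apply: ctsZ => //; exact: cts_cst.
  by apply: (@cts_comp _ _ `[0, 1] setT psi F1 t) => //; exact: der_cts (HF1 Ut).
move=> e e0; have eC : 0 < e / C by rewrite divr_gt0.
have [d d0 Hd] := CQ _ eC; exists d => // s s01 st.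
rewrite (Q1_N0 Ut) mul0r scale0r subr0.
have := Hd s s01 st; rewrite (Q1_N0 Ut) subr0 => Hs.
have [Us|Us] := pselect (U (psi s)); last first.
  by rewrite (Q1_N0 Us) mul0r scale0r normr0 ltW.
rewrite normrZ normrM (ger0_norm (_ : 0 <= 2^-1))//.
apply: (@le_trans _ _ (`|Q1 (psi s)| * C)).
  have := F1C Us; have := normr_ge0 (Q1 (psi s)); have := normr_ge0 (F1 (psi s)); nra.
by move: Hs; rewrite ler_pdivlMr.
Qed.

End SqrtSpeed.

(** * From a time function to a C^2 reparametrization *)

Section TimeChange.
Context {R : realType} {X : normedModType R} {N : X -> R}.
Hypothesis HN : equivalent_norm N.
Variable f : R -> X.
Hypothesis fbv : BV01 N f.
Hypothesis fcts : forall x, 0 <= x <= 1 -> cts `[0, 1] f x.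

Local Notation v := (vfun N f).
Local Notation F := (arclength_map N f).
Local Notation G := (`[0%R, 1%R]%classic `\` Dset N f : set R).
Local Notation F1 := (F^`()%classic).
Local Notation F2 := (derive1n 2 F).

(** [T] is the travel time as a function of arc length, and [m] the extra time, locally constant on
    [G], for stretches where [v] stands still. [T_speed] says that at speed at most [M] the distance
    [z - y] takes time at least [(z - y) / M]. *)
Variables (Q T m phi : R -> R).
Hypothesis Qge0 : forall y, 0 <= Q y.
Hypothesis Qcts : forall y, cts setT Q y.
Hypothesis QG : forall x, G x -> 0 < Q (v x).
Hypothesis QN : forall y, ~ (v @` G) y -> Q y = 0.
Hypothesis T_speed : forall y z M, 0 <= y -> y <= z -> z <= v 1 -> 0 < M ->
  (forall w, y <= w <= z -> Num.sqrt (Q w) <= M) -> z - y <= M * (T z - T y).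
Hypothesis T_der : forall y, (v @` G) y -> der setT T y (Num.sqrt (Q y))^-1.
Hypothesis m_le : forall x y, 0 <= x -> x <= y -> y <= 1 -> m x <= m y.
Hypothesis m_loc : forall x, G x -> exists2 r : R, 0 < r &
  forall y, `|y - x| < r -> m y = m x.
Hypothesis H : homeo_pair 0 1 0 1 (fun x => T (v x) + m x) phi.

Lemma phi01 t : 0 <= t <= 1 -> 0 <= phi t <= 1.
Proof. by case: H => _ H2 _ _ _ /H2[]. Qed.

Lemma phiK t : 0 <= t <= 1 -> T (v (phi t)) + m (phi t) = t.
Proof. by case: H => _ H2 _ _ _ /H2[]. Qed.

Lemma phi_cts t : 0 <= t <= 1 -> cts `[0, 1] phi t.
Proof. by case: H => _ _ _ _; apply. Qed.

Lemma phi_le s t : 0 <= s -> s <= t -> t <= 1 -> phi s <= phi t.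
Proof. exact: (homeo_pair_le (homeo_pair_sym H)). Qed.

Lemma psi_cts t : 0 <= t <= 1 -> cts `[0, 1] (fun t => v (phi t)) t.
Proof.
move=> t01; apply: (@cts_comp _ _ `[0, 1] `[0, 1] phi v t).
- by move=> s; rewrite /= !in_itv; exact: phi01.
- exact: phi_cts.
- exact: (v_cts HN fbv fcts (phi01 t01)).
Qed.

Lemma psi_le s t : 0 <= s -> s <= t -> t <= 1 -> v (phi s) <= v (phi t).
Proof.
move=> s0 st t1.
have s01 : 0 <= s <= 1 by rewrite s0 (le_trans st).
have t01 : 0 <= t <= 1 by rewrite t1 (le_trans s0).
have /andP[ps0 _] := phi01 s01; have /andP[_ pt1] := phi01 t01.
by apply: (v_le HN fbv) => //; exact: phi_le.
Qed.

Lemma psi_lip s t M : 0 <= s -> s <= t -> t <= 1 -> 0 < M ->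
  (forall w, v (phi s) <= w <= v (phi t) -> Num.sqrt (Q w) <= M) ->
  v (phi t) - v (phi s) <= M * (t - s).
Proof.
move=> s0 st t1 M0 HM.
have s01 : 0 <= s <= 1 by rewrite s0 (le_trans st).
have t01 : 0 <= t <= 1 by rewrite t1 (le_trans s0).
have /andP[ps0 ps1] := phi01 s01; have /andP[pt0 pt1] := phi01 t01.
have vs : 0 <= v (phi s) by have /andP[] := v_ge0 HN fbv (phi01 s01).
have vt : v (phi t) <= v 1 by have /andP[] := v_ge0 HN fbv (phi01 t01).
apply: (le_trans (T_speed vs (psi_le s0 st t1) vt M0 HM)).
rewrite ler_wpM2l ?(ltW M0)// -{2}(phiK t01) -{2}(phiK s01).
have := m_le ps0 (phi_le s0 st t1) pt1; lra.
Qed.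

(** When [phi t] is in [G], the map [v o phi] is near [t] the inverse of [T + m (phi t)], as [m] is
    locally constant. Otherwise [Q] vanishes at [v (phi t)] and is small nearby, and [psi_lip]
    bounds the increments of [v o phi] by the small speed. *)
Lemma psi_der t : 0 <= t <= 1 ->
  der `[0, 1] (fun t => v (phi t)) t (Num.sqrt (Q (v (phi t)))).
Proof.
move=> t01; have [Gx|Gx] := pselect (G (phi t)).
  have [r r0 Hr] := m_loc Gx; have r2 : 0 < r / 2 by lra.
  have [d d0 Hd] := phi_cts t01 r2.
  have Q0 := QG Gx; have q0 : 0 < (Num.sqrt (Q (v (phi t))))^-1 by rewrite invr_gt0 sqrtr_gt0.
  set mx := m (phi t).
  have Ds : der setT (fun y => T y + mx) (v (phi t)) (Num.sqrt (Q (v (phi t))))^-1.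
    by rewrite -[_^-1]addr0; apply: derD; [apply: T_der; exists (phi t)|exact: der_cst].
  pose B := [set s : R | 0 <= s <= 1 /\ `|s - t| < d].
  have := @der_inverse _ setT B (fun y => T y + mx) (fun t => v (phi t)) (v (phi t)) _ q0.
  rewrite (phiK t01) invrK => K; apply: (der_loc d0 _ _ (K _ _ _ Ds _)) => //.
  - move=> s [s01 st]; rewrite -[RHS](phiK s01); congr (_ + _); apply/esym/Hr.
    apply: le_lt_trans (Hd s _ st) _; last lra.
    by rewrite /= in_itv.
  - apply: cts_sub (psi_cts t01) => s /= [s01 _]; by rewrite in_itv.
have Q0 : Q (v (phi t)) = 0.
  apply: QN => -[x Gx' E]; apply: Gx.
  have /andP[x0 x1] := G_01 HN fbv fcts Gx'; have /andP[p0 p1] := phi01 t01.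
  have [xp|px|<-//] := ltgtP x (phi t).
    by have := G_v_lt HN fbv fcts (ltW x0) xp p1 (or_introl Gx'); rewrite E ltxx.
  by have := G_v_lt HN fbv fcts p0 px (ltW x1) (or_intror Gx'); rewrite E ltxx.
rewrite Q0 sqrtr0; apply/der0P => e e0.
have e2 : 0 < e ^+ 2 by rewrite exprn_gt0.
have [d d0 Hd] := Qcts (v (phi t)) e2.
have d2 : 0 < d / 2 by lra.
have [c c0 Hc] := psi_cts t01 d2; exists c => // s /[dup] s01 + st.
rewrite /= in_itv/= => /andP[s0 s1]; case/andP: (t01) => t0 t1.
have B w : `|w - v (phi t)| <= d / 2 -> Num.sqrt (Q w) <= e.
  move=> wd; rewrite -(ger0_norm (ltW e0)) -sqrtr_sqr ler_wsqrtr//.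
  have := Hd w I; rewrite Q0 subr0 (ger0_norm (Qge0 w)); apply; lra.
have := Hc s s01 st; have [ts|/ltW st'] := leP t s.
  rewrite (ger0_norm (_ : 0 <= s - t)) ?subr_ge0//.
  have le := psi_le t0 ts s1; rewrite ger0_norm ?subr_ge0// => cl.
  apply: psi_lip => // w /andP[w1 w2]; apply: B; rewrite ger0_norm; lra.
rewrite (ler0_norm (_ : s - t <= 0)) ?subr_le0// opprB.
have le := psi_le s0 st' t1; rewrite ler0_norm ?subr_le0// opprB => cl.
apply: psi_lip => // w /andP[w1 w2]; apply: B; rewrite ler0_norm; lra.
Qed.

Variable Q1 : R -> R.
Hypothesis HQ : forall y, der setT Q y (Q1 y).
Hypothesis HQ1 : forall y, cts setT Q1 y.
Hypothesis HH : forall y, 0 <= y <= v 1 -> cts `[0, v 1] (fun y => Q y *: F2 y) y.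

Lemma reparam_ii : [/\ increasing_homeo 0 1 0 1 phi, C2_on 0 1 (f \o phi) &
  forall x : R, x \in `[0, 1] -> G (phi x) -> (f \o phi)^`()%classic x != 0].
Proof.
have [c [C [c0 C0 HC]]] := eqn_bounds HN.
have psiI t : 0 <= t <= 1 -> 0 <= v (phi t) <= v 1 by move=> /phi01; exact: v_ge0.
have fF t : 0 <= t <= 1 -> (f \o phi) t = F (v (phi t)).
  by move=> /phi01 p01; rewrite /= (F_v HN fbv p01).
have normN x : `|x| <= c^-1 * N x.
  by have [h _] := HC x; rewrite mulrC ler_pdivlMr// mulrC.
have ci : 0 < c^-1 by rewrite invr_gt0.
have Flip y z : 0 <= y <= v 1 -> 0 <= z <= v 1 -> `|F z - F y| <= c^-1 * `|z - y|.
  move=> /andP[y0 y1] /andP[z0 z1]; apply: (le_trans (normN _)); rewrite ler_wpM2l ?(ltW ci)//.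
  have [yz|/ltW zy] := leP y z.
    by rewrite ger0_norm ?subr_ge0//; apply: (F_lip HN fbv fcts).
  by rewrite (eqnB HN) distrC ger0_norm ?subr_ge0//; apply: (F_lip HN fbv fcts).
have HF y : (v @` G) y -> der setT F y (F1 y) by move=> /(vG_regular HN fbv fcts)[].
have HF1 y : (v @` G) y -> der setT F1 y (F2 y) by move=> /(vG_regular HN fbv fcts)[].
have NF1 y : (v @` G) y -> N (F1 y) = 1 by move=> /(vG_regular HN fbv fcts)[].
have F1C y : (v @` G) y -> `|F1 y| <= c^-1.
  by move=> /NF1 E; rewrite (le_trans (normN _))// E mulr1.
have QU y : (v @` G) y -> 0 < Q y by move=> [x Gx <-]; exact: QG.
have C2 := @speed_C2 _ _ F F1 F2 (v @` G) (v 1) c^-1 Q Q1 (fun t => v (phi t)) ci HF HF1 F1C Flip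
  Qge0 QU QN HQ HQ1 HH psiI psi_der.
split.
- by apply/increasing_homeoP; exists (fun x => T (v x) + m x); exact: homeo_pair_sym.
- by apply: eq_C2_on C2.
move=> t; rewrite in_itv/= => t01 Gt.
have D := @comp_der _ _ F F1 (v @` G) (v 1) c^-1 Q (fun t => v (phi t)) ci HF Flip QN
  psiI psi_der t t01.
(* The derivative in (ii) is two-sided. As [phi] fixes 0 and 1, which are not in [G], the time [t]
   is interior. *)
have tI : 0 < t < 1.
  have [h1 h2 h3 h4 _] := homeo_pair_ends ler01 H; have [k1 k2 k3 k4 _] := homeo_pair_ends ler01 (homeo_pair_sym H).
  have /andP[p0 p1] := G_01 HN fbv fcts Gt; case/andP: t01 => t0 t1.
  rewrite !lt_neqAle t0 t1 !andbT; apply/andP; split; apply/eqP => E.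
    by move: p0; rewrite -E k1 ltxx.
  by move: p1; rewrite E k2 ltxx.
have D2 : der setT (f \o phi) t (Num.sqrt (Q (v (phi t))) *: F1 (v (phi t))).
  have [r r0 Hr] := itv_ball tI; apply: (der_loc r0 _ _ D); last by rewrite fF.
  by move=> s _ /Hr/andP[s0 s1]; rewrite fF ?ltW//; split => //; rewrite /= in_itv/= !ltW.
rewrite (der_derive1 D2) scaler_eq0 negb_or gt_eqF/= ?sqrtr_gt0 ?QG//.
apply/eqP => E; have := NF1 (v (phi t)); rewrite E eqn0// => K.
by have := oner_neq0 R; rewrite -K ?eqxx//; exists (phi t).
Qed.

End TimeChange.

(** * The bump functions of exponent 3/2 *)

Section Bump.
Context {R : realType}.

Lemma sqrt_cts (x : R) : cts setT (@Num.sqrt R) x.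
Proof. by apply/ctsT_continuous; exact: sqrt_continuous. Qed.

(** As [Num.sqrt] vanishes on negative numbers, this is the power 3/2 of the positive part. So
    [cbump a b] is 0 outside []a, b[] without a case distinction. *)
Definition pow32 (x : R) : R := x * Num.sqrt x.

Lemma pow32_ge0 x : 0 <= pow32 x.
Proof.
have [x0|x0] := leP 0 x; first by rewrite mulr_ge0// sqrtr_ge0.
by rewrite /pow32 ler0_sqrtr ?mulr0// ltW.
Qed.

Lemma pow32_gt0 x : 0 < x -> 0 < pow32 x.
Proof. by move=> x0; rewrite mulr_gt0// sqrtr_gt0. Qed.

Lemma pow32_le0 x : x <= 0 -> pow32 x = 0.
Proof. by move=> x0; rewrite /pow32 ler0_sqrtr ?mulr0. Qed.

Lemma pow32_der (x : R) : der setT pow32 x (3 / 2 * Num.sqrt x).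
Proof.
have [x0|x0|->] := ltgtP x 0.
- rewrite ler0_sqrtr ?mulr0; last exact: ltW.
  have nx : 0 < - x by rewrite oppr_gt0.
  apply: (der_loc (g := fun=> 0) (B := setT) nx); last exact: der_cst.
    move=> y _ H; split => //; apply: pow32_le0.
    by move: H; rewrite ltr_norml => /andP[? ?]; lra.
  exact/pow32_le0/ltW.
- have D : der setT (fun y : R => y) x 1.
    by move=> e e0; exists 1 => // y _ _; rewrite /GRing.scale/= mulr1 subrr normr0 mulr_ge0// ltW.
  have := derZ D (der_sqrt x0).
  have -> // : x *: (2 * Num.sqrt x)^-1 + 1 *: Num.sqrt x = 3 / 2 * Num.sqrt x.
  rewrite /GRing.scale/= -{1}(sqr_sqrtr (ltW x0)); field.
  by rewrite gt_eqF// sqrtr_gt0.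
rewrite sqrtr0 mulr0; apply/der0P => e e0.
have e2 : 0 < e ^+ 2 by rewrite exprn_gt0.
exists (e ^+ 2) => // y _; rewrite subr0 /pow32 mul0r subr0 normrM => ye.
rewrite mulrC ler_wpM2r// ger0_norm ?sqrtr_ge0//.
rewrite -(ger0_norm (ltW e0)) -sqrtr_sqr ler_wsqrtr//.
by apply: (le_trans (ler_norm _)); exact: ltW.
Qed.

Definition cbump (a b y : R) : R := pow32 ((y - a) * (b - y)).
Definition cbump' (a b y : R) : R := 3 / 2 * Num.sqrt ((y - a) * (b - y)) * (a + b - 2 * y).

Lemma cbump_der a b y : der setT (cbump a b) y (cbump' a b y).
Proof.
have Did : der setT (fun y : R => y) y 1.
  by move=> e e0; exists 1 => // z _ _; rewrite /GRing.scale/= mulr1 subrr normr0 mulr_ge0// ltW.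
have D : der setT (fun y : R => (y - a) * (b - y)) y (a + b - 2 * y).
  have := derZ (derD Did (der_cst setT y (- a))) (derD (der_cst setT y b) (derN Did)).
  have -> // : (y - a) *: (0 - 1 : R) + (1 + 0) *: (b - y) = a + b - 2 * y.
  by rewrite /GRing.scale/=; ring.
have := @der_comp _ _ setT setT _ pow32 y _ _ (fun _ _ => I) D (pow32_der _).
have -> // : (a + b - 2 * y) *: (3 / 2 * Num.sqrt ((y - a) * (b - y))) = cbump' a b y.
by rewrite /GRing.scale/= /cbump'; ring.
Qed.

Lemma cbump'_cts a b y : cts setT (cbump' a b) y.
Proof.
have Cid : cts setT (fun y : R => y) y by move=> e e0; exists e => // z _ /ltW.
have C1 : cts setT (fun y : R => (y - a) * (b - y)) y.
  apply: (ctsZ (a := fun y => y - a) (f := fun y => b - y)).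
    by apply: ctsD => //; exact: cts_cst.
  apply: ctsD; first exact: cts_cst.
  by move=> e e0; exists e => // z _ /ltW; rewrite -opprD normrN.
have C2 := @cts_comp _ _ setT setT _ (@Num.sqrt R) y (fun _ _ => I) C1 (sqrt_cts _).
have C3 : cts setT (fun y => 3 / 2 * Num.sqrt ((y - a) * (b - y))) y.
  exact: (ctsZ (a := fun=> 3 / 2) (cts_cst _ _ _) C2).
apply: (ctsZ C3 (f := fun y => a + b - 2 * y)); apply: ctsD; first exact: cts_cst.
move=> e e0; exists (e / 2); first by rewrite divr_gt0.
move=> z _ zy; have -> : - (2 * z) - - (2 * y) = - (2 * (z - y)) by ring.
by rewrite normrN normrM ger0_norm//; lra.
Qed.

Lemma cbump_out a b y : a <= b -> ~~ (a < y < b) -> cbump a b y = 0 /\ cbump' a b y = 0.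
Proof.
move=> ab H; have H2 : (y - a) * (b - y) <= 0.
  move: H; rewrite negb_and -!leNgt => /orP[ya|by_].
    by rewrite mulr_le0_ge0; lra.
  by rewrite mulr_ge0_le0; lra.
by rewrite /cbump /cbump' pow32_le0// ler0_sqrtr// mulr0 mul0r.
Qed.

Lemma cbump_ge0 a b y : 0 <= cbump a b y. Proof. exact: pow32_ge0. Qed.

Lemma cbump_gt0 a b y : a < y < b -> 0 < cbump a b y.
Proof. by move=> /andP[ay yb]; rewrite pow32_gt0// mulr_gt0 ?subr_gt0. Qed.

(** Since [sqrt ((y - a) * (b - y)) <= (b - a) / 2], the constants come out as 1/8 and 3/4; they are
    rounded up to 1. *)
Lemma cbump_le a b y : a <= b -> cbump a b y <= (b - a) ^+ 3 /\
  `|cbump' a b y| <= (b - a) ^+ 2.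
Proof.
move=> ab; have [/andP[ay yb]|H] := boolP (a < y < b); last first.
  have [-> ->] := cbump_out ab H; rewrite normr0; split; apply: exprn_ge0; lra.
set P := (y - a) * (b - y).
have P0 : 0 <= P by rewrite mulr_ge0; lra.
have s0 : 0 <= Num.sqrt P by exact: sqrtr_ge0.
have ss : Num.sqrt P ^+ 2 = P by rewrite sqr_sqrtr.
have sV : Num.sqrt P <= (b - a) / 2.
  rewrite -(@ger0_norm _ ((b - a) / 2)); last by lra.
  rewrite -sqrtr_sqr ler_wsqrtr// /P.
  have := sqr_ge0 (a + b - 2 * y); lra.
have V0 : 0 <= b - a by lra.
split.
  rewrite /cbump -/P /pow32 -{1}ss -exprSr.
  apply: (@le_trans _ _ (((b - a) / 2) ^+ 3)); first by rewrite lerXn2r ?nnegrE//; lra.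
  by rewrite lerXn2r ?nnegrE//; lra.
rewrite /cbump' -/P normrM (ger0_norm (_ : 0 <= 3 / 2 * Num.sqrt P)); last by lra.
have H : `|a + b - 2 * y| <= b - a by rewrite ler_norml; apply/andP; split; lra.
apply: (@le_trans _ _ (3 / 2 * ((b - a) / 2) * (b - a))); last by nra.
by apply: ler_pM => //; lra.
Qed.

Context {V : normedModType R}.

(** Outside []a, b[] the values of [F2] are uncontrolled, but there the bump is 0; at the ends the
    bump tends to 0 and [F2] is bounded by [S] inside. *)
Lemma cbump_cts_scale (a b k S : R) (F2 : R -> V) y : a <= b -> 0 <= k -> 0 <= S ->
  (forall y, a < y < b -> `|F2 y| <= S) -> (forall y, a < y < b -> cts setT F2 y) ->
  cts setT (fun y => (k * cbump a b y) *: F2 y) y.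
Proof.
move=> ab k0 S0 FS FC.
have CB : cts setT (fun y => k * cbump a b y) y.
  apply: (ctsZ (a := fun=> k)); first exact: cts_cst.
  exact: der_cts (cbump_der _ _ _).
have [yab|H] := boolP (a < y < b); first by apply: ctsZ => //; exact: FC.
have [E _] := cbump_out ab H => e e0.
have S1 : 0 < S + 1 by lra.
have e1 : 0 < e / (S + 1) by rewrite divr_gt0.
have [d d0 Hd] := CB _ e1; exists d => // z _ /(Hd z I).
rewrite E mulr0 scale0r !subr0 ler_pdivlMr// => H1.
have [zab|/(cbump_out ab)[-> _]] := boolP (a < z < b); last by rewrite mulr0 scale0r normr0 ltW.
rewrite normrZ; apply: le_trans H1; rewrite ler_wpM2l//.
by apply: (le_trans (FS _ zab)); lra.
Qed.

End Bump.

(** * Termwise differentiation of series *)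

Section UniformLimits.
Context {R : realType} {V : normedModType R}.

Lemma cts_unif (A : set R) (g : nat -> R -> V) (h : R -> V) x :
  A x -> (forall n, cts A (g n) x) ->
  (forall e : R, 0 < e -> exists n, forall y, A y -> `|h y - g n y| <= e) -> cts A h x.
Proof.
move=> Ax C H e e0; have e3 : 0 < e / 3 by lra.
have [n Hn] := H _ e3; have [d d0 Hd] := C n _ e3; exists d => // y Ay yx.
have -> : h y - h x = (h y - g n y) + ((g n y - g n x) - (h x - g n x)) by lin R.
apply: (le_trans (ler_normD _ _)); have := Hn y Ay; have := Hn x Ax; have := Hd y Ay yx.
have := ler_normB (g n y - g n x) (h x - g n x); lra.
Qed.

End UniformLimits.

Section UniformDer.
Context {R : realType}.

(** The mean value inequality for [P m - P n0], with [m] tending to infinity, shows that the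
    increments of [Q - P n0] are at most [e / 2] times the step; [P n0] is differentiable at [x]. *)
Lemma der_unif (P D : nat -> R -> R) (Q Q1 : R -> R) :
  (forall n x, der setT (P n) x (D n x)) ->
  (forall x (e : R), 0 < e -> exists n0, forall n, (n0 <= n)%N -> `|Q x - P n x| <= e) ->
  (forall e : R, 0 < e -> exists n0, forall n x, (n0 <= n)%N -> `|Q1 x - D n x| <= e) ->
  forall x, der setT Q x (Q1 x).
Proof.
move=> PD PQ DQ x e e0; have e4 : 0 < e / 4 by lra.
have [n0 Hn0] := DQ _ e4.
have [d d0 Hd] := PD n0 x _ e4; exists d => // y _ yx.
have key m a b : (n0 <= m)%N -> a <= b ->
    `|P m b - P n0 b - (P m a - P n0 a)| <= e / 2 * (b - a).
  move=> nm ab; apply: (@mean_value_ineq _ _ (fun t => P m t - P n0 t) (fun t => D m t - D n0 t)) => // t _.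
    by apply: (@der_sub _ _ setT) => //; apply: derD; [|apply: derN]; exact: PD.
  have := Hn0 m t nm; have := Hn0 n0 t (leqnn _).
  have := ler_normB (Q1 t - D n0 t) (Q1 t - D m t).
  have -> : Q1 t - D n0 t - (Q1 t - D m t) = D m t - D n0 t by ring.
  lra.
have key2 m : (n0 <= m)%N -> `|P m y - P n0 y - (P m x - P n0 x)| <= e / 2 * `|y - x|.
  move=> nm; have [xy|/ltW yx'] := leP x y; first by rewrite (ger0_norm (_ : 0 <= y - x)) ?subr_ge0// key.
  by rewrite distrC (distrC y x) (ger0_norm (_ : 0 <= x - y)) ?subr_ge0// key.
have H1 : `|Q y - P n0 y - (Q x - P n0 x)| <= e / 2 * `|y - x|.
  apply/ler_addgt0Pr => k k0; have k2 : 0 < k / 2 by lra.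
  have [n1 H1] := PQ y _ k2; have [n2 H2] := PQ x _ k2.
  pose m := maxn n0 (maxn n1 n2).
  have h0 : (n0 <= m)%N by rewrite leq_maxl.
  have h1 : (n1 <= m)%N by rewrite /m maxnCA leq_maxl.
  have h2 : (n2 <= m)%N by rewrite /m maxnA leq_maxr.
  have := key2 m h0; have := H1 m h1; have := H2 m h2.
  have -> : Q y - P n0 y - (Q x - P n0 x) =
     (P m y - P n0 y - (P m x - P n0 x)) + ((Q y - P m y) - (Q x - P m x)) by ring.
  move=> i1 i2 i3; apply: (le_trans (ler_normD _ _)).
  have := ler_normB (Q y - P m y) (Q x - P m x); lra.
have := Hd y I yx; have := Hn0 n0 x (leqnn _) => H2 H3.
have -> : Q y - Q x - (y - x) *: Q1 x = (Q y - P n0 y - (Q x - P n0 x)) +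
   ((P n0 y - P n0 x - (y - x) *: D n0 x) - (y - x) * (Q1 x - D n0 x)).
  by rewrite /GRing.scale/=; ring.
apply: (le_trans (ler_normD _ _)).
have := ler_normB (P n0 y - P n0 x - (y - x) *: D n0 x) ((y - x) * (Q1 x - D n0 x)).
rewrite normrM; have := ler_wpM2l (normr_ge0 (y - x)) H2; lra.
Qed.

Context {V : normedModType R}.

(* The tail condition covers both disjointly supported terms whose size tends
   to [0] and normally convergent series. *)
Lemma C1_series (t t' : nat -> R -> R) (F2 : R -> V) :
  (forall n x, der setT (t n) x (t' n x)) -> (forall n x, cts setT (t' n) x) ->
  (forall n x, cts setT (fun y => t n y *: F2 y) x) ->
  (forall n y, 0 <= t n y) ->
  (forall e : R, 0 < e -> exists n0, forall n m y, (n0 <= n)%N ->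
    [/\ \sum_(n <= i < m) t i y <= e, \sum_(n <= i < m) `|t' i y| <= e &
        (\sum_(n <= i < m) t i y) * `|F2 y| <= e]) ->
  exists Q Q1 : R -> R, [/\ (forall x, der setT Q x (Q1 x)), (forall x, cts setT Q1 x),
    (forall x, cts setT (fun y => Q y *: F2 y) x),
    (forall n y, t n y <= Q y) & (forall y, (forall n, t n y = 0) -> Q y = 0)].
Proof.
move=> D C CF t0 tail.
have cv (s : nat -> R -> R) : (forall e : R, 0 < e -> exists n0, forall n m y,
    (n0 <= n)%N -> \sum_(n <= i < m) `|s i y| <= e) -> exists Q : R -> R,
    forall e : R, 0 < e -> exists n0, forall n y, (n0 <= n)%N ->
     `|Q y - \sum_(0 <= i < n) s i y| <= e.
  move=> H; have cvs y : cvgn (series (fun i => s i y)).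
    apply/cauchy_cvgP/cauchy_seriesP => e e0; have e2 : 0 < e / 2 by lra.
    have [n0 Hn0] := H _ e2; exists ([set n | (n0 <= n)%N], setT).
      by split; [exists n0|exists 0%N].
    move=> [n m] /= [nn _]; apply: (le_lt_trans (ler_norm_sum _ _ _)).
    by apply: (le_lt_trans (Hn0 n m y nn)); lra.
  exists (fun y => limn (series (fun i => s i y))) => e e0; have e2 : 0 < e / 2 by lra.
  have [n0 Hn0] := H _ e2; exists n0 => n y nn.
  have /cvgrPdist_le/(_ _ e2)[N _ HN] := cvs y.
  pose m := maxn N n; have := HN m (leq_maxl _ _); have := Hn0 n m y nn => h1 h2.
  have -> : limn (series (fun i => s i y)) - \sum_(0 <= i < n) s i y =
     (limn (series (fun i => s i y)) - series (fun i => s i y) m) + \sum_(n <= i < m) s i y.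
    have -> : series (fun i => s i y) m = \sum_(0 <= i < m) s i y by [].
    rewrite (@big_cat_nat _ _ _ n 0 m)//=; last by rewrite leq_maxr.
    by ring.
  apply: (le_trans (ler_normD _ _)); have := ler_norm_sum (index_iota n m) (fun i => s i y) xpredT.
  lra.
have [Q HQ] : exists Q : R -> R, forall e : R, 0 < e -> exists n0, forall n y, (n0 <= n)%N ->
     `|Q y - \sum_(0 <= i < n) t i y| <= e.
  apply: cv => e /tail[n0 Hn0]; exists n0 => n m y nn; have [+ _ _] := Hn0 n m y nn.
  by apply: le_trans; apply: ler_sum => i _; rewrite ger0_norm.
have [Q1 HQ1] : exists Q : R -> R, forall e : R, 0 < e -> exists n0, forall n y, (n0 <= n)%N ->
     `|Q y - \sum_(0 <= i < n) t' i y| <= e.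
  by apply: cv => e /tail[n0 Hn0]; exists n0 => n m y nn; have [_ + _] := Hn0 n m y nn.
have DP n x : der setT (fun y => \sum_(0 <= i < n) t i y) x (\sum_(0 <= i < n) t' i x).
  elim: n => [|n IH].
    rewrite big_geq//; have -> : (fun y => \sum_(0 <= i < 0) t i y) = fun=> 0.
      by apply/funext => y; rewrite big_geq.
    exact: der_cst.
  rewrite big_nat_recr//=; have -> : (fun y => \sum_(0 <= i < n.+1) t i y) =
      fun y => \sum_(0 <= i < n) t i y + t n y.
    by apply/funext => y; rewrite big_nat_recr.
  exact: derD.
have CP n x : cts setT (fun y => \sum_(0 <= i < n) t' i y) x.
  elim: n => [|n IH].
    have -> : (fun y => \sum_(0 <= i < 0) t' i y) = fun=> 0.
      by apply/funext => y; rewrite big_geq.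
    exact: cts_cst.
  have -> : (fun y => \sum_(0 <= i < n.+1) t' i y) =
      fun y => \sum_(0 <= i < n) t' i y + t' n y.
    by apply/funext => y; rewrite big_nat_recr.
  exact: ctsD.
have CFP n x : cts setT (fun y => (\sum_(0 <= i < n) t i y) *: F2 y) x.
  elim: n => [|n IH].
    have -> : (fun y => (\sum_(0 <= i < 0) t i y) *: F2 y) = fun=> 0.
      by apply/funext => y; rewrite big_geq// scale0r.
    exact: cts_cst.
  have -> : (fun y => (\sum_(0 <= i < n.+1) t i y) *: F2 y) =
      fun y => (\sum_(0 <= i < n) t i y) *: F2 y + t n y *: F2 y.
    by apply/funext => y; rewrite big_nat_recr//= scalerDl.
  exact: ctsD.
exists Q, Q1; split.
- apply: (der_unif DP) => [x e /HQ[n0 H]|e /HQ1[n0 H]]; first by exists n0 => n /H.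
  by exists n0.
- move=> x; apply: (@cts_unif _ _ _ (fun n y => \sum_(0 <= i < n) t' i y)) => // e /HQ1[n0 H].
  by exists n0 => y _; apply: H.
- move=> x; apply: (@cts_unif _ _ _ (fun n y => (\sum_(0 <= i < n) t i y) *: F2 y)) => // e e0.
  have e2 : 0 < e / 2 by lra.
  have [n0 H] := tail _ e2; exists n0 => y _.
  rewrite -scalerBl normrZ.
  (* No bound on [F2] is available, so [n1] depends on [y]; the terms between [n0] and [m] are
     controlled uniformly in [y] by the third clause of [tail]. *)
  have F0 : 0 < `|F2 y| + 1 by rewrite ltr_wpDl.
  have e3 : 0 < e / 2 / (`|F2 y| + 1) by rewrite divr_gt0.
  have [n1 H1] := HQ _ e3; pose m := maxn n0 n1.
  have := H1 m y (leq_maxr _ _); have [_ _ h2] := H n0 m y (leqnn _) => h1.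
  have -> : Q y - \sum_(0 <= i < n0) t i y =
     (Q y - \sum_(0 <= i < m) t i y) + \sum_(n0 <= i < m) t i y.
    by rewrite (@big_cat_nat _ _ _ n0 0 m)//=; [ring|rewrite leq_maxl].
  have s0 : 0 <= \sum_(n0 <= i < m) t i y by apply: sumr_ge0.
  apply: (@le_trans _ _ ((`|Q y - \sum_(0 <= i < m) t i y| + \sum_(n0 <= i < m) t i y) * `|F2 y|)).
    by rewrite ler_wpM2r// -{2}(ger0_norm s0) ler_normD.
  rewrite mulrDl; have : `|Q y - \sum_(0 <= i < m) t i y| * `|F2 y| <= e / 2.
    move: h1; rewrite ler_pdivlMr// mulrDr mulr1 => h1.
    by have := normr_ge0 (Q y - \sum_(0 <= i < m) t i y); lra.
  lra.
- move=> n y; apply/ler_addgt0Pr => e /HQ[n0 H].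
  pose m := maxn n0 n.+1; have := H m y (leq_maxl _ _); rewrite ler_norml => /andP[h _].
  have : t n y <= \sum_(0 <= i < m) t i y.
    rewrite (@big_cat_nat _ _ _ n.+1 0 m)//=; last by rewrite leq_maxr.
    rewrite big_nat_recr//= addrAC addrC lerDl addr_ge0//; exact: sumr_ge0.
  lra.
move=> y ty; apply/eqP; rewrite -normr_le0; apply/ler_addgt0Pr => e /HQ[n0 H].
have := H n0 y (leqnn _); rewrite big1 => [|i _]; last exact: ty.
by rewrite subr0 add0r.
Qed.

End UniformDer.

(** * Construction of the square speed [Q] *)

Section SpeedProfile.
Context {R : realType} {V : normedModType R}.

Lemma sum_disjoint_le (g : nat -> R) (e : R) n m : 0 <= e ->
  (forall i, (n <= i)%N -> 0 <= g i <= e) ->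
  (forall i j, g i != 0 -> g j != 0 -> i = j) -> \sum_(n <= i < m) g i <= e.
Proof.
move=> e0 ge inj; elim: m => [|m IH]; first by rewrite big_geq.
have [nm|mn] := leqP n m; last by rewrite big_geq.
rewrite big_nat_recr//=; have [->|gm] := eqVneq (g m) 0; first by rewrite addr0.
rewrite big_nat big1 ?add0r; first by have /andP[] := ge m nm.
move=> i /andP[_ im]; apply/eqP; apply: contraTT im => gi.
by rewrite (inj _ _ gi gm) ltnn.
Qed.

(* A square root of the tail [r_n] of the series will do, since
   [(r_n - r_(n+1)) / sqrt r_n <= 2 (sqrt r_n - sqrt r_(n+1))]. *)
Lemma summable_weights (al : nat -> R) (A : R) : (forall n, 0 <= al n) ->
  (forall n, \sum_(0 <= i < n) al i <= A) ->
  exists c : nat -> R, [/\ (forall n, 0 <= c n), (forall n, 0 < al n -> 0 < c n),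
    (forall e : R, 0 < e -> exists n0, forall n, (n0 <= n)%N -> c n <= e) &
    exists B, forall n, \sum_(0 <= i < n) al i / Num.sqrt (c i) <= B].
Proof.
move=> al0 HA; pose P n : R := \sum_(0 <= i < n) al i.
have hs : has_sup (range P) by split; [exists (P 0%N), 0%N|exists A => _ [n _ <-]; exact: HA].
set L := sup (range P).
have PL n : P n <= L by apply: sup_ubound; [case: hs|exists n].
have PS n : P n.+1 = P n + al n by rewrite /P big_nat_recr.
pose c n := L - P n; have c0 n : 0 <= c n by rewrite subr_ge0.
have cS n : c n = al n + c n.+1 by rewrite /c PS; ring.
exists c; split => //.
- by move=> n an; rewrite cS ltr_pwDl.
- move=> e e0; have [_ [n0 _ <-] Hn0] := sup_adherent e0 hs.
  exists n0 => n nn; have : P n0 <= P n.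
    by rewrite /P (@big_cat_nat _ _ _ n0 0 n)//= lerDl sumr_ge0.
  by rewrite /c; move: Hn0; rewrite -/L; lra.
exists (2 * Num.sqrt (c 0%N)) => n.
suff : \sum_(0 <= i < n) al i / Num.sqrt (c i) <= 2 * Num.sqrt (c 0%N) - 2 * Num.sqrt (c n).
  by have := sqrtr_ge0 (c n); lra.
elim: n => [|n IH]; first by rewrite big_geq// subrr.
rewrite big_nat_recr//=.
suff : al n / Num.sqrt (c n) <= 2 * Num.sqrt (c n) - 2 * Num.sqrt (c n.+1) by lra.
have le : Num.sqrt (c n.+1) <= Num.sqrt (c n) by rewrite ler_wsqrtr// (cS n) lerDr.
have [s0|s0] := leP (Num.sqrt (c n)) 0.
  have -> : Num.sqrt (c n) = 0 by apply/le_anti; rewrite s0 sqrtr_ge0.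
  rewrite invr0 mulr0; have := sqrtr_ge0 (c n.+1); lra.
rewrite ler_pdivrMr//.
have -> : al n = Num.sqrt (c n) ^+ 2 - Num.sqrt (c n.+1) ^+ 2.
  by rewrite !sqr_sqrtr// cS; ring.
have := sqrtr_ge0 (c n.+1); nra.
Qed.

Variables (U : set R) (F2 : R -> V).
Hypothesis Uopen : forall y, U y -> exists2 r : R, 0 < r & forall z, `|z - y| < r -> U z.
Hypothesis UF : forall y, U y -> cts setT F2 y.

(** Degenerate intervals are allowed: they pad sequences and contribute a zero bump. *)
Definition admissible (p : (R * R) * R) : Prop := [/\ p.1.1 <= p.1.2, 0 <= p.2,
  (forall y, p.1.1 < y < p.1.2 -> U y) & (forall y, p.1.1 < y < p.1.2 -> `|F2 y| <= p.2)].

(** The three terms dominate the derivative of the bump, the bump, and the bump times [F2]. Dividing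
    by their sum makes all three quantities at most [c] when the coefficient is [c / weight]. *)
Definition weight (p : (R * R) * R) : R := let V := p.1.2 - p.1.1 in
  V ^+ 2 + V ^+ 3 + p.2 * V ^+ 3.

Lemma weight_ge0 p : admissible p -> 0 <= weight p.
Proof.
move=> [ab S0 _ _]; have V0 : 0 <= p.1.2 - p.1.1 by rewrite subr_ge0.
by rewrite /weight !addr_ge0// ?mulr_ge0// exprn_ge0.
Qed.

Lemma cbump_bounds p (k e : R) y : admissible p -> 0 <= k -> k * weight p <= e ->
  [/\ 0 <= k * cbump p.1.1 p.1.2 y <= e, `|k * cbump' p.1.1 p.1.2 y| <= e &
      k * cbump p.1.1 p.1.2 y * `|F2 y| <= e].
Proof.
move=> [ab S0 UI FS] k0; rewrite /weight => ke.
have V0 : 0 <= p.1.2 - p.1.1 by rewrite subr_ge0.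
have [B1 B2] := cbump_le y ab; have B0 := cbump_ge0 p.1.1 p.1.2 y.
set VV := p.1.2 - p.1.1 in V0 ke B1 B2 *.
have V2 : 0 <= VV ^+ 2 by exact: exprn_ge0.
have V3 : 0 <= VV ^+ 3 by exact: exprn_ge0.
have SV3 : 0 <= p.2 * VV ^+ 3 by exact: mulr_ge0.
have e1 : k * VV ^+ 2 <= e by apply: le_trans ke; rewrite ler_wpM2l//; lra.
have e2 : k * VV ^+ 3 <= e by apply: le_trans ke; rewrite ler_wpM2l//; lra.
have e3 : k * (p.2 * VV ^+ 3) <= e by apply: le_trans ke; rewrite ler_wpM2l//; lra.
have e0 : 0 <= e by apply: le_trans e1; rewrite mulr_ge0.
split.
- by rewrite mulr_ge0//= (le_trans _ e2)// ler_wpM2l.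
- by rewrite normrM (ger0_norm k0) (le_trans _ e1)// ler_wpM2l.
have [yab|/(cbump_out ab)[-> _]] := boolP (p.1.1 < y < p.1.2); last first.
  by rewrite mulr0 mul0r.
apply: le_trans e3; rewrite -mulrA ler_wpM2l// mulrC.
by apply: ler_pM => //; exact: FS.
Qed.

(** Continuity of [F2] makes it bounded on a rational interval around each point of [U]. Pairs of
    rationals are enumerated by [unpickle]; a code whose interval is not admissible is given the
    degenerate box. Bumps over these boxes ensure that [Q] is positive on all of [U]. *)
Lemma local_boxes : exists p : nat -> (R * R) * R, (forall n, admissible (p n)) /\
  forall y, U y -> exists n, (p n).1.1 < y < (p n).1.2.
Proof.
pose good (n : nat) (p : (R * R) * R) := admissible p /\
  forall q : rat * rat, unpickle n = Some q ->
    (exists S, admissible (ratr q.1, ratr q.2, S)) -> p.1 = (ratr q.1, ratr q.2).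
have /(@boolp.choice _ _ good)[p Hp] : forall n, exists p, good n p.
  move=> n.
  have adm0 : admissible (0, 0, 0) by split => //= y /andP[/lt_trans h /h]; rewrite ltxx.
  case E : (unpickle n : option (rat * rat)) => [q|]; last first.
    by exists (0, 0, 0); split => // q; rewrite E.
  have [[S HS]|nS] := pselect (exists S, admissible (ratr q.1, ratr q.2, S)).
    by exists (ratr q.1, ratr q.2, S); split => // q'; rewrite E => -[<-].
  by exists (0, 0, 0); split => // q'; rewrite E => -[<-].
exists p; split; first by move=> n; case: (Hp n).
move=> y Uy; have [r r0 Hr] := Uopen Uy; have [d d0 Hd] := UF Uy ltr01.
pose s := minr r d; have s0 : 0 < s by rewrite lt_min r0.
have ys1 : y - s < y by lra.
have ys2 : y < y + s by lra.
have [q1] := rat_in_itvoo ys1; rewrite in_itv/= => /andP[q1y yq1].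
have [q2] := rat_in_itvoo ys2; rewrite in_itv/= => /andP[q2y yq2].
have near z : ratr q1 < z < ratr q2 -> `|z - y| < r /\ `|z - y| < d.
  move=> /andP[z1 z2]; apply/andP; rewrite -lt_min -/s ltr_norml; apply/andP; split; lra.
exists (pickle (q1, q2)); have [_] := Hp (pickle (q1, q2)).
move=> /(_ (q1, q2)); rewrite pickleK => /(_ erefl) ->; first by rewrite /= yq1.
exists (`|F2 y| + 1); split => /=.
- by rewrite ltW// (lt_trans yq1).
- by rewrite addr_ge0.
- by move=> z /near[/Hr].
move=> z /near[_ zd]; rewrite -(subrK (F2 y) (F2 z)) (le_trans (ler_normD _ _))// addrC lerD2l.
exact: Hd.
Qed.

Lemma geo_tail (h : R) (n m : nat) : 0 <= h -> 2 * h = 1 ->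
  \sum_(n <= i < m) h ^+ i <= 2 * h ^+ n.
Proof.
move=> h0 h2; have hk k : 0 <= h ^+ k by exact: exprn_ge0.
have [nm|mn] := leqP n m; last by rewrite big_geq ?(ltnW mn)// mulr_ge0.
suff : \sum_(n <= i < m) h ^+ i <= 2 * h ^+ n - 2 * h ^+ m by have := hk m; lra.
rewrite -(subnKC nm); elim: (m - n)%N => [|k IH]; first by rewrite addn0 big_geq// subrr.
rewrite addnS big_nat_recr ?leq_addr//= exprS mulrA h2 mul1r; lra.
Qed.

Lemma geo_small (h e : R) : 0 <= h -> 2 * h = 1 -> 0 < e ->
  exists n0, forall n, (n0 <= n)%N -> h ^+ n <= e.
Proof.
move=> h0 h2 e0; have h1 : `|h| < 1 by rewrite ger0_norm//; lra.
have /cvgrPdist_le/(_ _ e0)[n0 _ H] := cvg_expr h1.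
by exists n0 => n nn; have := H n nn; rewrite /= sub0r normrN ger0_norm// exprn_ge0.
Qed.

(** [Q] adds to the bumps over the given intervals, of size [c n], bumps over the boxes of
    [local_boxes], of size [2^-n]. The former have disjoint supports, so [c n -> 0] suffices for
    their tails; the latter overlap and need a convergent series. *)
Lemma speed_exists (p : nat -> (R * R) * R) (c : nat -> R) :
  (forall n, admissible (p n)) ->
  (forall n m y, (p n).1.1 < y < (p n).1.2 -> (p m).1.1 < y < (p m).1.2 -> n = m) ->
  (forall n, 0 <= c n) ->
  (forall e : R, 0 < e -> exists n0, forall n, (n0 <= n)%N -> c n <= e) ->
  exists Q Q1 : R -> R, [/\ (forall x, der setT Q x (Q1 x)), (forall x, cts setT Q1 x),
    (forall x, cts setT (fun y => Q y *: F2 y) x),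
    (forall y, U y -> 0 < Q y) /\ (forall y, ~ U y -> Q y = 0) &
    (forall n y, c n / weight (p n) * cbump (p n).1.1 (p n).1.2 y <= Q y)].
Proof.
move=> adm disj c0 csmall.
have [b [admb cover]] := local_boxes.
have [rt [rt0 rt2]] : exists h : R, 0 < h /\ 2 * h = 1.
  by exists (2^-1); rewrite invr_gt0 mulfV ?pnatr_eq0.
have hk n : 0 < rt ^+ n by exact: exprn_gt0.
pose k n := c n / weight (p n).
have k0 n : 0 <= k n by rewrite divr_ge0// weight_ge0.
have kw n : k n * weight (p n) <= c n.
  have := weight_ge0 (adm n); rewrite /k le_eqVlt => /orP[/eqP <-|w0]; first by rewrite mulr0.
  by rewrite mulfVK// gt_eqF.
(* The summand 1 takes care of degenerate boxes, whose weight is 0. *)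
pose d n : R := rt ^+ n / (weight (b n) + 1).
have w1 n : 0 < weight (b n) + 1 by rewrite ltr_wpDl// weight_ge0.
have d0 n : 0 < d n by rewrite divr_gt0.
have dw n : d n * weight (b n) <= rt ^+ n.
  rewrite /d mulrAC ler_pdivrMr// ler_wpM2l ?(ltW (hk n))//; lra.
pose t1 n y : R := k n * cbump (p n).1.1 (p n).1.2 y.
pose t2 n y : R := d n * cbump (b n).1.1 (b n).1.2 y.
pose t1' n y : R := k n * cbump' (p n).1.1 (p n).1.2 y.
pose t2' n y : R := d n * cbump' (b n).1.1 (b n).1.2 y.
have B1 n y : [/\ 0 <= t1 n y <= c n, `|t1' n y| <= c n & t1 n y * `|F2 y| <= c n].
  exact: cbump_bounds.
have B2 n y : [/\ 0 <= t2 n y <= rt ^+ n, `|t2' n y| <= rt ^+ n & t2 n y * `|F2 y| <= rt ^+ n].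
  by apply: cbump_bounds => //; exact: ltW.
have DZ (q : R) a a' y : der setT (cbump a a') y (cbump' a a' y) ->
    der setT (fun y => q * cbump a a' y) y (q * cbump' a a' y).
  move=> D; have := derZ (der_cst setT y q) D.
  by rewrite /GRing.scale/= mul0r addr0.
have CZ (q : R) a a' y : cts setT (fun y => q * cbump' a a' y) y.
  exact: (ctsZ (a := fun=> q) (cts_cst _ _ _) (cbump'_cts _ _ _)).
pose t n y := t1 n y + t2 n y.
pose t' n y := t1' n y + t2' n y.
have Dt n y : der setT (t n) y (t' n y).
  by apply: derD; apply: DZ; exact: cbump_der.
have Ct n y : cts setT (t' n) y by apply: ctsD; exact: CZ.
have [| | |Q [Q1 [HQ HQ1 HQF Qge Q0]]] := @C1_series _ _ t t' F2 Dt Ct; last first.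
- exists Q, Q1; split => //; last first.
    by move=> n y; apply: le_trans (Qge n y); rewrite lerDl; have [/andP[]] := B2 n y.
  split=> y Uy.
    have [n yn] := cover y Uy; apply: lt_le_trans (Qge n y).
    have [/andP[h _] _ _] := B1 n y; rewrite ltr_wpDl// mulr_gt0// ?d0//.
    exact: cbump_gt0.
  apply: Q0 => n; rewrite /t /t1 /t2.
  have nb q : admissible q -> cbump q.1.1 q.1.2 y = 0.
    move=> [ab _ UI _]; apply: (cbump_out ab _).1; apply/negP => /UI.
    exact: Uy.
  by rewrite !nb// !mulr0 addr0.
- move=> e e0.
  have e2 : 0 < e / 2 by lra.
  have e4 : 0 < e / 4 by lra.
  have [n1 H1] := csmall _ e2; have [n2 H2] := geo_small (ltW rt0) rt2 e4.
  exists (maxn n1 n2) => n m y; rewrite geq_max => /andP[nn1 nn2].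
  have zero1 i : ~~ ((p i).1.1 < y < (p i).1.2) -> t1 i y = 0 /\ t1' i y = 0.
    by case: (adm i) => ab _ _ _ /(cbump_out ab)[h1 h2]; rewrite /t1 /t1' h1 h2 !mulr0.
  have inj i j (g : nat -> R) : (forall i, ~~ ((p i).1.1 < y < (p i).1.2) -> g i = 0) ->
      g i != 0 -> g j != 0 -> i = j.
    move=> h gi gj; apply: (disj i j y); apply: contraT => /h E.
      by rewrite E eqxx in gi.
    by rewrite E eqxx in gj.
  have S2 (g : nat -> R) : (forall i, g i <= rt ^+ i) -> \sum_(n <= i < m) g i <= e / 2.
    move=> gi; apply: (@le_trans _ _ (\sum_(n <= i < m) rt ^+ i)); first by apply: ler_sum.
    by apply: (le_trans (geo_tail _ _ (ltW rt0) rt2)); have := H2 n nn2; lra.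
  have S1 (g : nat -> R) : (forall i, 0 <= g i <= c i) ->
      (forall i, ~~ ((p i).1.1 < y < (p i).1.2) -> g i = 0) -> \sum_(n <= i < m) g i <= e / 2.
    move=> gi g0; apply: sum_disjoint_le; [exact: ltW| |by move=> i j; exact: inj].
    move=> i ni; have /andP[-> h] := gi i; rewrite /= (le_trans h)//.
    by apply: H1; exact: leq_trans ni.
  have sp : e = e / 2 + e / 2 by lra.
  split.
  + rewrite big_split/= sp lerD//.
      by apply: S1 => i; [have [] := B1 i y|move=> /zero1[]].
    by apply: S2 => i; have [/andP[]] := B2 i y.
  + apply: (@le_trans _ _ (\sum_(n <= i < m) (`|t1' i y| + `|t2' i y|))).
      by apply: ler_sum => i _; exact: ler_normD.
    rewrite big_split/= sp lerD//.
      apply: S1 => i; first by rewrite normr_ge0; have [] := B1 i y.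
      by move=> /zero1[_ ->]; rewrite normr0.
    by apply: S2 => i; have [] := B2 i y.
  rewrite big_split/= mulrDl sp lerD// mulr_suml.
    apply: S1 => i; last by move=> /zero1[-> _]; rewrite mul0r.
    by have [/andP[h _] _ h2] := B1 i y; rewrite h2 andbT mulr_ge0.
  by apply: S2 => i; have [] := B2 i y.
- by move=> n y; have [/andP[h _] _ _] := B1 n y; have [/andP[h' _] _ _] := B2 n y; rewrite addr_ge0.
move=> n x.
have -> : (fun y => (t1 n y + t2 n y) *: F2 y) = (fun y => t1 n y *: F2 y + t2 n y *: F2 y).
  by apply/funext => y; rewrite scalerDl.
apply: ctsD.
  case: (adm n) => ab S0 UI FS; apply: (cbump_cts_scale (S := (p n).2)) => //.
  by move=> y /UI; exact: UF.
case: (admb n) => ab S0 UI FS; apply: (cbump_cts_scale (S := (b n).2)) => //; first exact: ltW.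
by move=> y /UI; exact: UF.
Qed.

End SpeedProfile.

(** * Travel time as the integral of [1 / sqrt Q] *)

Section SlowTime.
Context {R : realType}.
Local Notation mu := (@lebesgue_measure R).

Lemma mu_itv (x y : R) (b c : bool) : x <= y ->
  mu [set` Interval (BSide b x) (BSide c y)] = (y - x)%:E.
Proof.
move=> xy; rewrite lebesgue_measure_itv/= lte_fin; case: ltP => // yx.
by suff -> : y - x = 0 by []; lra.
Qed.

Lemma derivable_der (T : R -> R) y : derivable T y 1 -> der setT T y (T^`()%classic y).
Proof.
move=> D e e0; move: (D) => /cvg_ex[/= l Hl].
have E : T^`()%classic y = l by rewrite derive1E; apply: cvg_lim.
move/cvgrPdist_le : Hl => /(_ _ e0) /nbhs_ballP[d /= d0 Hd].
exists d => // z _ zy; have [->|zy0] := eqVneq z y.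
  by rewrite !subrr scale0r subr0 !normr0 mulr0.
have := Hd (z - y); rewrite /ball/= sub0r normrN subr_eq0 => /(_ zy zy0).
rewrite /GRing.scale/= mulr1 subrK E => H.
have -> : T z - T y - (z - y) * l = - ((z - y) * (l - (z - y)^-1 * (T z - T y))).
  by field; rewrite subr_eq0.
by rewrite normrN normrM mulrC ler_wpM2r.
Qed.

Lemma der_derivable (T : R -> R) y l : der setT T y l -> derivable T y 1.
Proof.
move=> D; apply/cvg_ex; exists l; apply/cvgrPdist_le => e /D[d d0 Hd].
apply/nbhs_ballP; exists d => //= h.
rewrite /ball/= sub0r normrN => hd h0.
have nh : 0 < `|h| by rewrite normr_gt0.
have := Hd (h + y) I; rewrite addrK => /(_ hd).
rewrite /GRing.scale/= mulr1.
have -> : T (h + y) - T y - h * l = - (h * (l - h^-1 * (T (h + y) - T y))).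
  by field.
by rewrite normrN normrM mulrC ler_pM2r.
Qed.

Lemma ctsV (g : R -> R) x : g x != 0 -> cts setT g x -> cts setT (fun y => (g y)^-1) x.
Proof. by move=> gx /ctsT_continuous H; apply/ctsT_continuous; apply: continuousV. Qed.

(** Where [Q] vanishes this is 0, because [0^-1 = 0], and not the infinite slowness of the true
    integrand. In [TotalTime] those points form a null set, so the integral is not affected. *)
Definition rho (Q : R -> R) (y : R) : R := (Num.sqrt (Q y))^-1.

Lemma rho_ge0 Q y : 0 <= rho Q y. Proof. by rewrite invr_ge0 sqrtr_ge0. Qed.

Variable Q : R -> R.
Hypothesis Qcts : forall y, cts setT Q y.

Lemma measurable_rho (A : set R) : measurable_fun A (EFin \o rho Q).
Proof.
apply: (@measurable_funS _ _ _ _ setT) => //.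
apply/measurable_EFinP.
have -> : rho Q = (fun x => x `^ (-1)) \o (fun y => Num.sqrt (Q y)).
  by apply/funext => y; rewrite /rho /= powR_inv1// sqrtr_ge0.
apply: measurableT_comp; first exact: measurable_powR.
apply: continuous_measurable_fun => y.
apply/ctsT_continuous; apply: (@cts_comp _ _ setT setT Q) => //; exact: sqrt_cts.
Qed.

Lemma rho_cts y : 0 < Q y -> cts setT (rho Q) y.
Proof.
move=> Q0; apply: ctsV; first by rewrite gt_eqF// sqrtr_gt0.
apply: (@cts_comp _ _ setT setT Q) => //; exact: sqrt_cts.
Qed.

(* [4 / (sqrt k V^(3/4)) ((y - a)^(1/4) - (b - y)^(1/4))] has derivative at
   least [1 / sqrt Q], by subadditivity of [x^(3/4)]. *)
Lemma rho_bump_integral (a b k : R) : a < b -> 0 < k ->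
  (forall y, a < y < b -> k * cbump a b y <= Q y) ->
  (\int[mu]_(y in `]a, b[) (rho Q y)%:E <= (8 / (Num.sqrt k * Num.sqrt (b - a)))%:E)%E.
Proof.
move=> ab k0 HQ; set VV : R := b - a; have V0 : 0 < VV by rewrite subr_gt0.
pose rr (x : R) : R := Num.sqrt (Num.sqrt x).
have rr0 x : 0 < x -> 0 < rr x by move=> x0; rewrite !sqrtr_gt0.
have rr2 x : rr x ^+ 2 = Num.sqrt x by rewrite sqr_sqrtr// sqrtr_ge0.
have rr4 x : 0 <= x -> rr x ^+ 4 = x by move=> x0; rewrite (exprM _ 2 2) rr2 sqr_sqrtr.
set D := rr VV; have D0 : 0 < D by exact: rr0.
set sk := Num.sqrt k; have sk0 : 0 < sk by rewrite sqrtr_gt0.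
pose K := 4 / (sk * D ^+ 3).
have K0 : 0 < K by rewrite divr_gt0// mulr_gt0// exprn_gt0.
pose E y := K * (rr (y - a) - rr (b - y)).
pose E' y := K * ((2 * Num.sqrt (y - a))^-1 * (2 * rr (y - a))^-1 +
                  (2 * Num.sqrt (b - y))^-1 * (2 * rr (b - y))^-1).
have rrle x : 0 <= x -> x <= VV -> rr x <= D.
  by move=> x0 xV; rewrite !ler_wsqrtr.
have Did (y : R) : der setT (fun y : R => y) y 1.
  by move=> e e0; exists 1 => // z _ _; rewrite /GRing.scale/= mulr1 subrr normr0 mulr_ge0// ltW.
have rr_der x : 0 < x -> der setT rr x ((2 * Num.sqrt x)^-1 *: (2 * rr x)^-1).
  move=> x0; apply: (@der_comp _ _ setT setT (@Num.sqrt R) (@Num.sqrt R)) => //.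
    exact: der_sqrt.
  by apply: der_sqrt; rewrite sqrtr_gt0.
have E_der y : a < y < b -> der setT E y (E' y).
  move=> /andP[ay yb].
  have D1 : der setT (fun y => rr (y - a)) y (1 *: ((2 * Num.sqrt (y - a))^-1 *: (2 * rr (y - a))^-1)).
    apply: (@der_comp _ _ setT setT (fun y => y - a) rr) => //.
      by have := derD (Did y) (der_cst setT y (- a)); rewrite addr0.
    by apply: rr_der; rewrite subr_gt0.
  have D2 : der setT (fun y => rr (b - y)) y (-1 *: ((2 * Num.sqrt (b - y))^-1 *: (2 * rr (b - y))^-1)).
    apply: (@der_comp _ _ setT setT (fun y => b - y) rr) => //.
      by have := derD (der_cst setT y b) (derN (Did y)); rewrite add0r.
    by apply: rr_der; rewrite subr_gt0.
  have := derZ (der_cst setT y K) (derD D1 (derN D2)).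
  by rewrite /GRing.scale/= mul0r addr0 mul1r mulN1r opprK.
have E'_cts y : a < y < b -> cts setT E' y.
  move=> /andP[ay yb].
  have Cid s : cts setT (fun y : R => y + s) y by move=> e e0; exists e => // z _ /ltW; rewrite opprD addrACA subrr addr0.
  have Cid2 : cts setT (fun y : R => b - y) y.
    by apply: ctsD; [exact: cts_cst|move=> e e0; exists e => // z _ /ltW; rewrite -opprD normrN].
  have C2 (g : R -> R) : cts setT g y -> cts setT (fun y => Num.sqrt (g y)) y.
    by move=> C; apply: (@cts_comp _ _ setT setT g (@Num.sqrt R)) => //; exact: sqrt_cts.
  have C3 (g : R -> R) : 0 < g y -> cts setT g y -> cts setT (fun y => (2 * g y)^-1) y.
    move=> gy C; apply: ctsV; first by rewrite gt_eqF// mulr_gt0.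
    exact: (ctsZ (a := fun=> 2) (cts_cst _ _ _) C).
  have C4 (g : R -> R) : 0 < g y -> cts setT g y ->
      cts setT (fun y => (2 * Num.sqrt (g y))^-1 * (2 * rr (g y))^-1) y.
    move=> gy C; apply: (ctsZ (a := fun y => (2 * Num.sqrt (g y))^-1)).
      by apply: C3; [rewrite sqrtr_gt0|exact: C2].
    by apply: C3; [exact: rr0|exact: (C2 _ (C2 _ C))].
  apply: (ctsZ (a := fun=> K)); first exact: cts_cst.
  by apply: ctsD; apply: C4; rewrite ?subr_gt0//; exact: Cid.
have rhoE y : a < y < b -> rho Q y <= E' y.
  move=> /andP[ay yb].
  set s := y - a; set r := b - y.
  have s0 : 0 < s by rewrite subr_gt0.
  have r0 : 0 < r by rewrite subr_gt0.
  have A0 : 0 < rr s by exact: rr0.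
  have B0 : 0 < rr r by exact: rr0.
  set A := rr s in A0 *; set B := rr r in B0 *.
  have As : Num.sqrt s = A ^+ 2 by rewrite rr2.
  have Bs : Num.sqrt r = B ^+ 2 by rewrite rr2.
  have AD : A <= D by apply: rrle; rewrite ?ltW// /VV /s; lra.
  have BD : B <= D by apply: rrle; rewrite ?ltW// /VV /r; lra.
  have D4 : D ^+ 4 = A ^+ 4 + B ^+ 4 by rewrite !rr4 ?ltW// /VV /s /r; ring.
  have D3 : D ^+ 3 <= A ^+ 3 + B ^+ 3.
    have A3 : 0 < A ^+ 3 by rewrite exprn_gt0.
    have B3 : 0 < B ^+ 3 by rewrite exprn_gt0.
    by rewrite -(ler_pM2l D0) mulrDr -exprS D4 !(exprS _ 3) lerD// ler_wpM2r// exprn_ge0// ltW.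
  have sb : Num.sqrt (s * r) = (A * B) ^+ 2 by rewrite sqrtrM ?ltW// As Bs exprMn.
  have bE : k * cbump a b y = (sk * (A * B) ^+ 3) ^+ 2.
    rewrite /cbump /pow32 -/s -/r sb.
    have -> : s * r = A ^+ 4 * B ^+ 4 by rewrite !rr4 ?ltW.
    have kE : k = sk ^+ 2 by rewrite sqr_sqrtr ?ltW.
    by rewrite [in LHS]kE; ring.
  have yab : a < y < b by rewrite ay.
  have lowQ : sk * (A * B) ^+ 3 <= Num.sqrt (Q y).
    have p0 : 0 <= sk * (A * B) ^+ 3 by rewrite ltW// mulr_gt0// exprn_gt0// mulr_gt0.
    by rewrite -(ger0_norm p0) -sqrtr_sqr -bE ler_wsqrtr// HQ.
  have AB3 : 0 < sk * (A * B) ^+ 3 by rewrite mulr_gt0// exprn_gt0// mulr_gt0.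
  apply: (@le_trans _ _ (sk * (A * B) ^+ 3)^-1).
    by rewrite /rho lef_pV2// posrE// (lt_le_trans AB3).
  have -> : E' y = (A ^+ 3 + B ^+ 3) / (D ^+ 3 * (sk * (A * B) ^+ 3)).
    rewrite /E' -/s -/r -/A -/B As Bs /K; field.
    by rewrite !gt_eqF.
  have H1 : 1 <= (A ^+ 3 + B ^+ 3) / D ^+ 3 by rewrite ler_pdivlMr ?exprn_gt0// mul1r.
  move: AB3; move: (sk * (A * B) ^+ 3) => P P0.
  rewrite invfM mulrA; have : 0 < P^-1 by rewrite invr_gt0.
  nra.
have bound (a' b' : R) : a < a' -> a' < b' -> b' < b ->
    (\int[mu]_(y in `[a', b']) (rho Q y)%:E <= (8 / (sk * Num.sqrt VV))%:E)%E.
  move=> aa ab' bb.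
  have sub y : a' <= y <= b' -> a < y < b.
    by move=> /andP[? ?]; apply/andP; split; lra.
  have E'c : {within `[a', b'], continuous E'}.
    apply/ctsP => y /=; rewrite in_itv/= => /sub /E'_cts; exact: cts_sub.
  apply: (@le_trans _ _ (\int[mu]_(y in `[a', b']) (E' y)%:E)%E).
    apply: ge0_le_integral => //.
    - by move=> y _; rewrite lee_fin rho_ge0.
    - exact: measurable_rho.
    - apply/measurable_EFinP.
      exact: subspace_continuous_measurable_fun.
    - by move=> y; rewrite /= in_itv/= => /sub/rhoE; rewrite lee_fin.
  have Ec y : a <= y <= b -> E y <= E b /\ E a <= E y.
    move=> /andP[ay yb]; rewrite /E; split; rewrite ler_wpM2l ?(ltW K0)// lerB// !ler_wsqrtr//; lra.
  have Ects y : a < y < b -> E x @[x --> y] --> E y.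
    by move=> /E_der /der_cts /ctsT_continuous.
  rewrite (@continuous_FTC2 _ E' E)//; last first.
  - move=> y; rewrite in_itv/= => /andP[y1 y2]; apply/der_derive1/E_der/sub.
    by rewrite !ltW.
  - split.
    + move=> y; rewrite in_itv/= => /andP[y1 y2]; apply: der_derivable; apply: E_der; apply: sub.
      by rewrite !ltW.
    + by apply: cvg_at_right_filter; apply: Ects; apply: sub; rewrite lexx ltW.
    + by apply: cvg_at_left_filter; apply: Ects; apply: sub; rewrite lexx ltW.
  rewrite -EFinB lee_fin.
  have [h1 _] : E b' <= E b /\ E a <= E b' by apply: Ec; apply/andP; split; lra.
  have [_ h2] : E a' <= E b /\ E a <= E a' by apply: Ec; apply/andP; split; lra.
  have Eb : E b = K * D by rewrite /E subrr /rr !sqrtr0 subr0.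
  have Ea : E a = - (K * D) by rewrite /E subrr /rr !sqrtr0 sub0r mulrN.
  have -> : 8 / (sk * Num.sqrt VV) = 2 * (K * D).
    rewrite /K -rr2 -/D; field; by rewrite !gt_eqF.
  lra.
(* The open interval is exhausted by compact ones, on which [E'] is continuous. Dividing by at least
   3 keeps even the first of them nondegenerate. *)
pose Fn (n : nat) : set R := `[a + VV / (n.+3)%:R, b - VV / (n.+3)%:R]%classic.
have nz n : 0 < (n.+3)%:R :> R by [].
have inc : {homo Fn : n m / (n <= m)%N >-> (n <= m)%O}.
  move=> n m nm; apply/subsetPset => y; rewrite /Fn /= !in_itv/= => /andP[h1 h2].
  have : VV / m.+3%:R <= VV / n.+3%:R.
    by rewrite ler_wpM2l ?(ltW V0)// lef_pV2 ?posrE// ler_nat.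
  by move: (VV / m.+3%:R) (VV / n.+3%:R) h1 h2 => u w h1 h2 h; apply/andP; split; lra.
have UF : \bigcup_n Fn n = `]a, b[%classic.
  apply/seteqP; split => y.
    move=> [n _]; rewrite /Fn /= !in_itv/= => /andP[h1 h2].
    have : 0 < VV / n.+3%:R by rewrite divr_gt0.
    by move: (VV / n.+3%:R) h1 h2 => u h1 h2 h; apply/andP; split; lra.
  rewrite /= in_itv/= => /andP[ay yb].
  pose m := minr (y - a) (b - y); have m0 : 0 < m by rewrite lt_min !subr_gt0 ay.
  pose n := Num.bound (VV / m).
  exists n => //; rewrite /Fn /= in_itv/=.
  have : VV / n.+3%:R <= m.
    rewrite ler_pdivrMr// mulrC -ler_pdivrMr// ltW// (lt_le_trans (archi_boundP _))//.
      by rewrite divr_ge0 ?ltW.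
    by rewrite ler_nat -addn3 leq_addr.
  rewrite le_min => /andP[]; move: (VV / n.+3%:R) => u h1 h2; apply/andP; split; lra.
have H := @ge0_nondecreasing_set_cvg_integral _ (measurableTypeR R) R Fn (EFin \o rho Q)
  (@lebesgue_measure R) inc (fun=> measurable_itv _) (fun n => @measurable_rho (Fn n)) _.
have {}H := H (fun n x _ => rho_ge0 Q x); rewrite UF in H.
have := cvg_lim _ H => <- //; apply: lime_le; first by apply/cvg_ex; eexists; exact: H.
near=> n; apply: bound.
- by rewrite ltrDl divr_gt0.
- have : VV / n.+3%:R <= VV / 3.
    by rewrite ler_wpM2l ?(ltW V0)// lef_pV2 ?posrE// ler_nat.
  by have := V0; move: (VV / n.+3%:R) => u; rewrite /VV; lra.
- by rewrite ltrBlDr ltrDl divr_gt0.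
Unshelve. all: by end_near. Qed.

End SlowTime.

Section TotalTime.
Context {R : realType}.
Local Notation mu := (@lebesgue_measure R).
Variables (U : set R) (l : R) (Q : R -> R) (a b k : nat -> R) (B : R).
Hypothesis l0 : 0 < l.
Hypothesis Qcts : forall y, cts setT Q y.
Hypothesis QU : forall y, U y -> 0 < Q y.
Hypothesis U0l : forall y, U y -> 0 < y < l.
Hypothesis ab : forall n, a n <= b n.
Hypothesis abU : forall n y, a n < y < b n -> U y.
Hypothesis disj : forall n m y, a n < y < b n -> a m < y < b m -> n = m.
Hypothesis total : (\sum_(0 <= n <oo) (b n - a n)%:E)%E = l%:E.
Hypothesis k0 : forall n, a n < b n -> 0 < k n.
Hypothesis kQ : forall n y, a n < y < b n -> k n * cbump (a n) (b n) y <= Q y.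
Hypothesis kB : forall n, \sum_(0 <= i < n) (Num.sqrt (k i) * Num.sqrt (b i - a i))^-1 <= B.

Let O : set R := \bigcup_n `]a n, b n[%classic.
Local Notation rh := (rho Q).

Let mO : measurable O. Proof. by apply: bigcupT_measurable. Qed.

Let triv : trivIset setT (fun n => `]a n, b n[%classic).
Proof.
by move=> i j _ _ [y []]; rewrite /= !in_itv/=; exact: disj.
Qed.

Let muO : mu O = l%:E.
Proof.
rewrite (measure_semi_bigcup (@lebesgue_measure R) (fun=> measurable_itv _) triv mO).
by rewrite -total; apply: eq_eseriesr => n _ /=; rewrite mu_itv.
Qed.

Let O_sub : O `<=` `[0, l]%classic.
Proof.
move=> y [n _]; rewrite /= !in_itv/= => /abU/U0l/andP[h1 h2]; by rewrite !ltW.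
Qed.

(** The disjoint intervals have total length [l]. This is how the first equation of (vii) enters:
    off the intervals [Q] has no lower bound that would control the time. *)
Let nullO : mu (`[0, l]%classic `\` O) = 0%E.
Proof.
have fin : (mu `[0%R, l]%classic < +oo)%E by rewrite mu_itv ?ltry// ltW.
rewrite measureD//.
rewrite setIidr//; change (mu `[0%R, l]%classic - mu O = 0)%E.
by rewrite muO mu_itv ?ltW// subr0 subee.
Qed.

Let nullOA (A : set R) : measurable A -> A `<=` `[0, l]%classic -> mu (A `\` O) = 0%E.
Proof.
move=> mA Al; apply/eqP; rewrite eq_le measure_ge0 andbT -nullO.
apply: le_measure; rewrite ?inE; [exact: measurableD|exact: measurableD|].
by move=> y [/Al].
Qed.

Let intO (A : set R) (g : R -> \bar R) : measurable A -> A `<=` `[0, l]%classic ->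
  measurable_fun A g -> (forall y, 0 <= g y)%E ->
  (\int[mu]_(y in A) g y = \int[mu]_(y in A `&` O) g y)%E.
Proof.
move=> mA Al mg g0; have mI : measurable (A `&` O) by exact: measurableI.
have mD : measurable (A `\` O) by exact: measurableD.
rewrite -{1}(setUIDK A O) ge0_integral_setU//; last 2 first.
- by rewrite setUIDK.
- by apply/disj_setPS => y [[_ +] [_]].
rewrite [X in (_ + X)%E](_ : _ = 0%E) ?adde0//.
by apply: null_set_integral => //; [exact: measurable_funS mg|exact: nullOA].
Qed.

Let int_total : (\int[mu]_(y in `[0%R, l]) (rh y)%:E =
  \sum_(0 <= n <oo) \int[mu]_(y in `]a n, b n[) (rh y)%:E)%E.
Proof.
rewrite intO//; last by move=> y; rewrite lee_fin rho_ge0.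
  rewrite setIidr// ge0_integral_bigcup//; first exact: measurable_rho.
  by move=> y _; rewrite lee_fin rho_ge0.
exact: measurable_rho.
Qed.

Let int_fin : (\int[mu]_(y in `[0%R, l]) (rh y)%:E <= (8 * B)%:E)%E.
Proof.
rewrite int_total; apply: lime_le.
  by apply: is_cvg_nneseries => n _ _; apply: integral_ge0 => y _; rewrite lee_fin rho_ge0.
near=> n; apply: (@le_trans _ _ (\sum_(0 <= i < n) (8 / (Num.sqrt (k i) * Num.sqrt (b i - a i)))%:E)%E).
  apply: lee_sum => i _; have [abi|bai] := ltP (a i) (b i).
    apply: rho_bump_integral => //; [exact: k0|exact: kQ].
  rewrite set_itv_ge -?leNgt// integral_set0 lee_fin mulr_ge0// invr_ge0 mulr_ge0// sqrtr_ge0.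
by rewrite sumEFin lee_fin -mulr_sumr ler_wpM2l.
Unshelve. all: by end_near. Qed.

Let rho_int (A : set R) : measurable A -> A `<=` `[0, l]%classic -> mu.-integrable A (EFin \o rh).
Proof.
move=> mA Al; apply: (@integrableS _ (measurableTypeR R) R (@lebesgue_measure R) `[0, l]%classic A) => //.
apply/integrableP; split; first exact: measurable_rho.
apply: le_lt_trans (ltry (8 * B)); apply: le_trans int_fin.
rewrite le_eqVlt; apply/orP; left; apply/eqP; apply: eq_integral => y _.
by rewrite /= ger0_norm// rho_ge0.
Qed.

Let T (y : R) : R := \int[mu]_(t in `[0, y]) rh t.

Let T_diff y z : 0 <= y -> y <= z -> z <= l -> (T z - T y)%:E = (\int[mu]_(t in `]y, z]) (rh t)%:E)%E.
Proof.
move=> y0 yz zl.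
have sub1 : `[0, z] `<=` `[0, l]%classic.
  by move=> t /=; rewrite !in_itv/= => /andP[-> tz]; rewrite (le_trans tz).
have sub2 : `]y, z] `<=` `[0, l]%classic.
  by move=> t /=; rewrite !in_itv/= => /andP[yt tz]; rewrite (le_trans tz)// (le_trans y0)// ltW.
rewrite /T Rintegral_itvB ?bnd_simp//; last by apply: rho_int.
by rewrite /Rintegral fineK//; apply: integrable_fin_num => //; exact: rho_int.
Qed.

(** The witness is the integral of [rho Q] from 0, finite by the sum of the bounds
    [rho_bump_integral]. Its derivative on [U] comes from the fundamental theorem of calculus, and
    its increments over the intervals exhaust the total time because the rest is null. *)
Lemma time_exists : exists S : R -> R, [/\ S 0 = 0,
  (forall y, U y -> der setT S y (Num.sqrt (Q y))^-1),
  (forall y z M, 0 <= y -> y <= z -> z <= l -> 0 < M ->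
    (forall w, y <= w <= z -> Num.sqrt (Q w) <= M) -> z - y <= M * (S z - S y)),
  (forall y, 0 <= y <= l -> cts `[0, l] S y) &
  (\sum_(0 <= n <oo) (S (b n) - S (a n))%:E)%E = (S l)%:E].
Proof.
exists T.
have T0 : T 0 = 0 by rewrite /T set_itv1 Rintegral_set1.
split => //.
- move=> y Uy; have /andP[y0 yl] := U0l Uy.
  have int : mu.-integrable [set` Interval (BLeft 0) (BRight l)] (EFin \o rh) by exact: rho_int.
  have yb : (BLeft 0%R < BRight y)%E by rewrite lte_fin.
  have C : {for y, continuous rh} by apply/ctsT_continuous/rho_cts => //; exact: QU.
  have [D E] := continuous_FTC1 yl int yb C.
  by have := derivable_der D; rewrite E.
- move=> y z M y0 yz zl M0 HM.
  have sub : `]y, z] `<=` `[0, l]%classic.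
    by move=> t /=; rewrite !in_itv/= => /andP[yt tz]; rewrite (le_trans tz)// (le_trans y0)// ltW.
  have mA : measurable (`]y, z]%classic : set R) by [].
  rewrite mulrC -ler_pdivrMr// -lee_fin T_diff// intO//; last 2 first.
  + exact: measurable_rho.
  + by move=> t; rewrite lee_fin rho_ge0.
  (* The lower bound [1 / M] for [rho] may fail where [Q] vanishes, so it is integrated over [O]
     only, which has full measure. *)
  have muI : mu (`]y, z]%classic `&` O) = (z - y)%:E.
    have E : (mu `]y, z]%classic = mu (`]y, z]%classic `\` O) + mu (`]y, z]%classic `&` O))%E
      := measureDI (@lebesgue_measure R) mA mO.
    by move: E; rewrite nullOA// add0e mu_itv.
  have mI : measurable (`]y, z]%classic `&` O) by exact: measurableI.
  apply: (@le_trans _ _ (\int[mu]_(t in `]y, z]%classic `&` O) (cst (M^-1)%:E t))%E).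
    rewrite integral_cst// [X in (_ * X)%E](_ : _ = (z - y)%:E); last exact: muI.
    by rewrite -EFinM lee_fin mulrC.
  apply: ge0_le_integral => //.
  + by move=> t _; rewrite lee_fin invr_ge0 ltW.
  + exact: measurable_rho.
  move=> t [tyz [n _ tn]]; rewrite lee_fin lef_pV2 ?posrE// ?sqrtr_gt0.
    by apply: HM; move: tyz; rewrite /= in_itv/= => /andP[/ltW -> ->].
  by apply/QU/(abU (n := n)); move: tn; rewrite /= in_itv.
- move=> y yl; have := @parameterized_integral_continuous R 0 l rh (ltW l0).
  move=> /(_ (rho_int _ _)); rewrite /parameterized_integral => H.
  have /ctsP : {within `[0, l], continuous T} by apply: H.
  by apply; rewrite /= in_itv.
have E : (T l)%:E = (\int[mu]_(y in `[0%R, l]) (rh y)%:E)%E.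
  by rewrite /T /Rintegral fineK//; apply: integrable_fin_num => //; exact: rho_int.
rewrite E int_total; apply: eq_eseriesr => n _; have [abn|ban] := ltP (a n) (b n); last first.
  have -> : a n = b n by apply/le_anti; rewrite ab ban.
  by rewrite subrr set_itv_ge ?integral_set0// bnd_simp ltxx.
have memU y : a n < y < b n -> 0 < y < l by move=> /abU/U0l.
have bn : b n <= l.
  rewrite leNgt; apply/negP => lb; pose y := (maxr l (a n) + b n) / 2.
  have h : maxr l (a n) < b n by rewrite gt_max lb abn.
  have h1 : l <= maxr l (a n) by rewrite le_max lexx.
  have h2 : a n <= maxr l (a n) by rewrite le_max lexx orbT.
  have : 0 < y < l by apply: memU; rewrite /y; apply/andP; split; lra.
  by rewrite /y => /andP[_]; lra.
have an : 0 <= a n.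
  rewrite leNgt; apply/negP => la; pose y := (minr 0 (b n) + a n) / 2.
  have h : a n < minr 0 (b n) by rewrite lt_min la abn.
  have h1 : minr 0 (b n) <= 0 by rewrite ge_min lexx.
  have h2 : minr 0 (b n) <= b n by rewrite ge_min lexx orbT.
  have : 0 < y < l by apply: memU; rewrite /y; apply/andP; split; lra.
  by rewrite /y => /andP[+ _]; lra.
rewrite T_diff// ?ab//; symmetry; apply: integral_itv_bndo_bndc.
exact: measurable_rho.
Qed.

End TotalTime.

Lemma enum_intervals (R : realType) (S : set (R * R)) : (forall I, S I -> I.1 < I.2) ->
  trivIset S Ioo -> exists J : nat -> R * R,
  [/\ (forall n, S (J n) \/ J n = (0, 0)), (forall I, S I -> exists n, J n = I),
      (forall n m, S (J n) -> J n = J m -> n = m) &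
      forall a : R * R -> \bar R, a (0, 0) = 0%E -> (forall I, S I -> (0 <= a I)%E) ->
        \esum_(I in S) a I = (\sum_(0 <= n <oo) a (J n))%E].
Proof.
move=> Slt tS; have : countable S.
  (* Every index must carry a nonempty open set; []0, 1[] is a dummy for degenerate pairs, which do
     not occur in [S]. *)
  pose B (I : R * R) : set R := if I.1 < I.2 then Ioo I else `]0, 1[%classic.
  apply: (@separated_open_countable R _ B).
  - by move=> I; rewrite /B /Ioo; case: ifP => _; exact: interval_open.
  - move=> I; rewrite /B; case: ifP => [h|_].
      by exists ((I.1 + I.2) / 2); rewrite /Ioo/= in_itv/=; apply/andP; split; lra.
    by exists (1 / 2); rewrite /= in_itv/=; apply/andP; split; lra.
  - move=> I I' SI SI'; rewrite /B !Slt//; exact: tS.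
move=> /countable_injP[f finj].
pose J n := xget (0, 0) [set I | S I /\ f I = n].
have Jf I : S I -> J (f I) = I.
  move=> SI; have [SJ fJ] : S (J (f I)) /\ f (J (f I)) = f I.
    by apply: (xgetPex (0, 0) (P := [set I' | S I' /\ f I' = f I])); exists I.
  by apply: finj => //; rewrite inE.
have Jn n : (S (J n) /\ f (J n) = n) \/ J n = (0, 0).
  have [h|h] := pselect (exists I, S I /\ f I = n).
    by left; exact: (xgetPex (0, 0) h).
  by right; apply: xgetPN => I SI; apply: h; exists I.
have J0 n : S (J n) -> f (J n) = n.
  by case: (Jn n) => [[]//|-> /Slt]; rewrite ltxx.
exists J; split.
- by move=> n; case: (Jn n) => [[]|]; [left|right].
- by move=> I SI; exists (f I); exact: Jf.
- move=> n m Sn E; rewrite -(J0 n Sn) E; apply: J0; by rewrite -E.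
move=> a a0 age.
pose P := [set n | S (J n)].
rewrite (@reindex_esum _ _ _ P S J a); last first.
  split => //.
  - move=> n m; rewrite !inE => Pn Pm E; by rewrite -(J0 n Pn) -(J0 m Pm) E.
  - by move=> I SI; exists (f I); rewrite /P/= Jf.
rewrite esum_mkcond nneseries_esumT.
  apply: eq_esum => n _; case: ifPn => //; rewrite notin_setE => nP.
  by case: (Jn n) => [[]//|->].
by move=> n; case: (Jn n) => [[/age]//|->]; rewrite a0.
Qed.

Section GIntervals.
Context {R : realType} {X : normedModType R} {N : X -> R}.
Hypothesis HN : equivalent_norm N.
Variable f : R -> X.
Hypothesis fbv : BV01 N f.
Hypothesis fcts : forall x, 0 <= x <= 1 -> cts `[0, 1] f x.

Local Notation v := (vfun N f).
Local Notation F := (arclength_map N f).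
Local Notation G := (`[0%R, 1%R]%classic `\` Dset N f : set R).
Local Notation F2 := (derive1n 2 F).

Lemma G_interval I : I.1 < I.2 -> Ioo I `<=` G -> 0 <= I.1 /\ I.2 <= 1.
Proof.
move=> ltI IG; split; rewrite leNgt; apply/negP => h.
  pose y := (minr 0 I.2 + I.1) / 2.
  have h0 : I.1 < minr 0 I.2 by rewrite lt_min h ltI.
  have h1 : minr 0 I.2 <= 0 by rewrite ge_min lexx.
  have h2 : minr 0 I.2 <= I.2 by rewrite ge_min lexx orbT.
  have : 0 < y < 1.
    by apply: (G_01 HN fbv fcts); apply: IG; rewrite /Ioo/= in_itv/= /y; apply/andP; split; lra.
  by rewrite /y => /andP[+ _]; lra.
pose y := (maxr 1 I.1 + I.2) / 2.
have h0 : maxr 1 I.1 < I.2 by rewrite gt_max h ltI.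
have h1 : 1 <= maxr 1 I.1 by rewrite le_max lexx.
have h2 : I.1 <= maxr 1 I.1 by rewrite le_max lexx orbT.
have : 0 < y < 1.
  by apply: (G_01 HN fbv fcts); apply: IG; rewrite /Ioo/= in_itv/= /y; apply/andP; split; lra.
by rewrite /y => /andP[_]; lra.
Qed.

(** The endpoints may lie outside [G], so [G_v_lt] is applied on either side of the midpoint. *)
Lemma v_strict_G I : I.1 < I.2 -> Ioo I `<=` G -> @v_strict R X N f I.1 I.2.
Proof.
move=> ltI IG x y x1 xy y2; have [h1 h2] := G_interval ltI IG.
have Gz : G ((x + y) / 2) by apply: IG; rewrite /Ioo/= in_itv/=; apply/andP; split; lra.
apply: (@lt_trans _ _ (v ((x + y) / 2))).
  by apply: (G_v_lt HN fbv fcts) => //; [lra|lra|lra|right].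
by apply: (G_v_lt HN fbv fcts) => //; [lra|lra|lra|left].
Qed.

Lemma Var_G I : I.1 < I.2 -> Ioo I `<=` G ->
  Var N f (Icc I) = (v I.2 - v I.1)%:E /\ v I.1 < v I.2.
Proof.
move=> ltI IG; have [h1 h2] := G_interval ltI IG; split.
  by rewrite /Icc (VarE HN fbv)// ltW.
exact: (v_strict_G ltI IG).
Qed.

Lemma v_onto_G I y : I.1 < I.2 -> Ioo I `<=` G -> v I.1 < y < v I.2 ->
  exists2 x, I.1 < x < I.2 & v x = y.
Proof.
move=> ltI IG yI; have [h1 h2] := G_interval ltI IG.
have [g [_ gP _ _ _]] := v_homeo HN fbv fcts h1 ltI h2 (v_strict_G ltI IG).
case/andP: yI => y1 y2; have [/andP[g1 g2] E] : I.1 <= g y <= I.2 /\ v (g y) = y.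
  by apply: gP; rewrite !ltW.
exists (g y) => //; rewrite !lt_neqAle g1 g2 !andbT; apply/andP; split; apply/eqP => E2.
  by move: y1; rewrite -E -E2 ltxx.
by move: y2; rewrite -E E2 ltxx.
Qed.

Lemma Ssup_ge I x : I.1 < x < I.2 -> ((N (F2 (v x)))%:E <= Ssup N f I)%E.
Proof.
by move=> xI; apply: ereal_sup_ubound; exists (v x) => //; exists x => //; rewrite /Ioo/= in_itv.
Qed.

Lemma Ssup_le I (s : R) : (forall x, I.1 < x < I.2 -> N (F2 (v x)) <= s) -> (Ssup N f I <= s%:E)%E.
Proof.
by move=> H; apply: ge_ereal_sup => _ [_ [x xI <-] <-]; rewrite lee_fin H//; move: xI; rewrite /Ioo/= in_itv.
Qed.

Lemma Ssup_ge0 I : I.1 < I.2 -> (0 <= Ssup N f I)%E.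
Proof.
move=> ltI; apply: le_trans (@Ssup_ge I ((I.1 + I.2) / 2) _); first by rewrite lee_fin eqn_ge0.
by apply/andP; split; lra.
Qed.

End GIntervals.

(** * Summability estimates and the measure of the complement of [G] *)

Section Assembly.
Context {R : realType}.
Local Notation mu := (@lebesgue_measure R).

(** For [V > 0] and the weight [w], the left side equals [sqrt (w / V) / sqrt c], and
    [w / V = V + V^2 + S V^2] is the sum of the squares of the three terms on the right. These terms
    are the ones that (vii) makes summable. *)
Lemma weight_time (V S c : R) : 0 <= V -> 0 <= S -> 0 <= c -> (0 < V -> 0 < c) ->
  (Num.sqrt (c / (V ^+ 2 + V ^+ 3 + S * V ^+ 3)) * Num.sqrt V)^-1 <=
  (Num.sqrt V + V + V * Num.sqrt S) / Num.sqrt c.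
Proof.
move=> V0 S0 c0 Vc; have s0 := sqrtr_ge0.
move: V0; rewrite le_eqVlt => /orP[/eqP <-|V0].
  by rewrite sqrtr0 mulr0 invr0 mul0r !addr0 mul0r.
have {}c0 := Vc V0; set w := V ^+ 2 + _ + _.
have w0 : 0 < w.
  have v2 : 0 < V ^+ 2 by rewrite exprn_gt0.
  have v3 : 0 <= V ^+ 3 by rewrite exprn_ge0 ?ltW.
  by rewrite /w; have := mulr_ge0 S0 v3; lra.
set al := _ + _ + _.
have al0 : 0 < al.
  have h : 0 < Num.sqrt V by rewrite sqrtr_gt0.
  by rewrite /al; have := mulr_ge0 (ltW V0) (s0 _ S); lra.
have P0 : 0 < Num.sqrt (c / w) * Num.sqrt V by rewrite mulr_gt0 ?sqrtr_gt0// divr_gt0.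
have sc : 0 < Num.sqrt c by rewrite sqrtr_gt0.
rewrite ler_pdivlMr// mulrC ler_pdivrMr//.
have E : Num.sqrt c = Num.sqrt (w / V) * (Num.sqrt (c / w) * Num.sqrt V).
  rewrite -sqrtrM ?divr_ge0 ?ltW// -sqrtrM ?divr_ge0 ?ltW//; congr Num.sqrt.
  by field; rewrite !gt_eqF.
rewrite E ler_pM2r//.
rewrite -(ger0_norm (ltW al0)) -sqrtr_sqr ler_wsqrtr//.
have -> : w / V = V + V ^+ 2 + S * V ^+ 2 by rewrite /w; field; rewrite gt_eqF.
have v2 : Num.sqrt V ^+ 2 = V by rewrite sqr_sqrtr ?ltW.
have s2 : Num.sqrt S ^+ 2 = S by rewrite sqr_sqrtr.
have h1 := s0 _ V; have h2 := s0 _ S.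
rewrite -{1}v2 -{1}s2 /al; move: (Num.sqrt V) (Num.sqrt S) h1 h2 => x y x0 y0.
rewrite -subr_ge0.
have -> : (x + V + V * y) ^+ 2 - (x ^+ 2 + V ^+ 2 + y ^+ 2 * V ^+ 2) =
   2 * (x * V) + 2 * (x * (V * y)) + 2 * (V * (V * y)) by ring.
have V0' := ltW V0; by rewrite !addr_ge0 ?mulr_ge0.
Qed.

Lemma summable_bound (u : nat -> R) : (forall n, 0 <= u n) ->
  (\sum_(0 <= n <oo) (u n)%:E < +oo)%E -> exists A, forall n, \sum_(0 <= i < n) u i <= A.
Proof.
move=> u0 H; have fin : (\sum_(0 <= n <oo) (u n)%:E)%E \is a fin_num.
  by rewrite ge0_fin_numE//; apply: nneseries_ge0 => n _ _; rewrite lee_fin.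
exists (fine (\sum_(0 <= n <oo) (u n)%:E)%E) => n.
rewrite -lee_fin fineK// -sumEFin; apply: nneseries_lim_ge => i _ _.
by rewrite lee_fin.
Qed.

Lemma esum_term (T : choiceType) (S : set T) (a : T -> \bar R) x :
  (forall y, S y -> 0 <= a y)%E -> S x -> (a x <= \esum_(y in S) a y)%E.
Proof.
move=> a0 Sx; apply: esum_ge; exists [set x]; last by rewrite fsbig_set1.
by split; [exact: finite_set1|move=> y ->].
Qed.

Variable G : set R.
Hypothesis Gopen : forall x, G x -> exists2 r : R, 0 < r & forall y, `|y - x| < r -> G y.
Hypothesis G01 : forall x, G x -> 0 < x < 1.

Lemma G_is_open : open G.
Proof.
rewrite openE => x /Gopen[r r0 H]; apply/nbhs_ballP; exists r => // y.
by rewrite /ball/= distrC; exact: H.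
Qed.

Let mG : measurable G. Proof. exact: open_measurable G_is_open. Qed.

(** A clock that stands still on [G], runs strictly across gaps of [G], and is 1-Lipschitz. In
    [total_length] it is used for a set of arc lengths in place of [G]. *)
Definition off_length x : R := fine (mu (`[0%R, x]%classic `\` G)).

Lemma off_length_diff x y : 0 <= x -> x <= y -> 
  (off_length y - off_length x)%:E = mu (`]x, y]%classic `\` G).
Proof.
move=> x0 xy.
have fin z : 0 <= z -> mu (`[0%R, z]%classic `\` G) \is a fin_num.
  move=> z0; rewrite ge0_fin_numE//; apply: (@le_lt_trans _ _ (mu `[0%R, z]%classic)).
    by apply: le_measure; rewrite ?inE//; exact: measurableD.
  by rewrite mu_itv// ltry.
have U : `[0%R, y]%classic `\` G = (`[0%R, x]%classic `\` G) `|` (`]x, y]%classic `\` G).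
  rewrite -setDUl; congr (_ `\` _); apply: itv_bndbnd_setU; rewrite bnd_simp//.
have E : (mu (`[0%R, y]%classic `\` G) = mu (`[0%R, x]%classic `\` G) + mu (`]x, y]%classic `\` G))%E.
  rewrite U measureU//; [exact: measurableD|exact: measurableD|].
  apply/seteqP; split => // t [[+ _] [+ _]]; rewrite /= !in_itv/= => /andP[_ h] /andP[h' _].
  by move: (le_lt_trans h h'); rewrite ltxx.
rewrite /off_length EFinB !fineK ?fin ?(le_trans x0)// E.
by rewrite addeAC subee ?add0e// fin.
Qed.

Lemma off_length_le x y : 0 <= x -> x <= y -> off_length x <= off_length y <= off_length x + (y - x).
Proof.
move=> x0 xy; have E := off_length_diff x0 xy.
have h1 : 0 <= off_length y - off_length x by rewrite -lee_fin E measure_ge0.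
have h2 : off_length y - off_length x <= y - x.
  rewrite -lee_fin E; apply: (@le_trans _ _ (mu `]x, y]%classic)); last by rewrite mu_itv.
  by apply: le_measure; rewrite ?inE//; exact: measurableD.
by apply/andP; split; lra.
Qed.

Lemma off_length_gap x y : 0 <= x -> x < y -> (forall z, x < z < y -> ~ G z) ->
  off_length x < off_length y.
Proof.
move=> x0 xy H; have E := off_length_diff x0 (ltW xy).
rewrite -subr_gt0; apply: (@lt_le_trans _ _ (y - x)); first by rewrite subr_gt0.
rewrite -lee_fin E; apply: (@le_trans _ _ (mu `]x, y[%classic)); first by rewrite mu_itv// ltW.
apply: le_measure; rewrite ?inE//; first exact: measurableD.
move=> z /=; rewrite !in_itv/= => /[dup] zI /andP[-> /ltW ->]; split => //; exact: H.
Qed.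

Lemma off_length_loc x : G x -> exists2 r : R, 0 < r &
  forall y, `|y - x| < r -> off_length y = off_length x.
Proof.
move=> Gx; have [r r0 Hr] := Gopen Gx; exists r => // y yx.
have Gy := Hr y yx; have /andP[x0 _] := G01 Gx; have /andP[y0 _] := G01 Gy.
have key s t : 0 <= s -> s <= t -> `|s - x| < r -> `|t - x| < r -> off_length t = off_length s.
  move=> s0 st sx tx; have := off_length_diff s0 st.
  rewrite (_ : `]s, t]%classic `\` G = set0) ?measure0; last first.
    apply/seteqP; split => // z [+ ]; rewrite /= in_itv/= => /andP[z1 z2]; apply; apply: Hr.
    by move: sx tx; rewrite !ltr_norml => /andP[? ?] /andP[? ?]; apply/andP; split; lra.
  by move=> E; have : off_length t - off_length s = 0 by [apply: EFin_inj]; lra.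
have xx : `|x - x| < r by rewrite subrr normr0.
have [xy|/ltW xy] := leP x y; first by apply: key => //; exact: ltW.
by symmetry; apply: key => //; exact: ltW.
Qed.

Lemma off_length0 : off_length 0 = 0.
Proof.
rewrite /off_length; have -> : mu (`[0%R, 0%R]%classic `\` G) = 0%E; last by [].
apply/eqP; rewrite eq_le measure_ge0 andbT.
apply: (@le_trans _ _ (mu `[0%R, 0%R]%classic)); last by rewrite mu_itv// subrr.
by apply: le_measure; rewrite ?inE//; exact: measurableD.
Qed.

End Assembly.

(** * From the intervals of (vii) to the homeomorphism of (ii) *)

Section Construction.
Context {R : realType} {X : normedModType R} {N : X -> R}.
Hypothesis HN : equivalent_norm N.
Variable f : R -> X.
Hypothesis fbv : BV01 N f.
Hypothesis fcts : forall x, 0 <= x <= 1 -> cts `[0, 1] f x.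

Local Notation mu := (@lebesgue_measure R).
Local Notation v := (vfun N f).
Local Notation F := (arclength_map N f).
Local Notation G := (`[0%R, 1%R]%classic `\` Dset N f : set R).
Local Notation F2 := (derive1n 2 F).

(* The speed [sqrt Q] as a function of the arc length, and the time [T] it
   takes to reach a given arc length. *)
Definition speed_data (Q Q1 T : R -> R) : Prop :=
  [/\ (forall x, der setT Q x (Q1 x)) /\ (forall x, cts setT Q1 x),
      (forall x, cts setT (fun y => Q y *: F2 y) x),
      (forall y, (v @` G) y -> 0 < Q y) /\ (forall y, ~ (v @` G) y -> Q y = 0),
      [/\ T 0 = 0, (forall y, (v @` G) y -> der setT T y (Num.sqrt (Q y))^-1),
        (forall y z M, 0 <= y -> y <= z -> z <= v 1 -> 0 < M ->
          (forall w, y <= w <= z -> Num.sqrt (Q w) <= M) -> z - y <= M * (T z - T y)) &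
        (forall y, 0 <= y <= v 1 -> cts `[0, v 1] T y)] &
      exists J : nat -> R * R, [/\ (forall n, (J n).1 < (J n).2 /\ Ioo (J n) `<=` G \/ J n = (0, 0)),
        (forall n m x, (J n).1 < x < (J n).2 -> (J m).1 < x < (J m).2 -> n = m) &
        (\sum_(0 <= n <oo) (T (v (J n).2) - T (v (J n).1))%:E)%E = (T (v 1))%:E]].

Lemma v_inj_G x y : 0 <= x <= 1 -> 0 <= y <= 1 -> G x -> v x = v y -> x = y.
Proof.
move=> /andP[x0 x1] /andP[y0 y1] Gx E; have [xy|yx|//] := ltgtP x y.
  by have := G_v_lt HN fbv fcts x0 xy y1 (or_introl Gx); rewrite E ltxx.
by have := G_v_lt HN fbv fcts y0 yx x1 (or_intror Gx); rewrite E ltxx.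
Qed.

Lemma speed_data_exists (S : set (R * R)) : 0 < v 1 ->
  (forall J, S J -> J.1 < J.2 /\ Ioo J `<=` G) -> trivIset S Ioo ->
  (\esum_(J in S) Var N f (Icc J) = Var N f `[0%R, 1%R])%E ->
  (\esum_(J in S) sqrte (Var N f (Icc J)) < +oo)%E ->
  (\esum_(J in S) (Var N f (Icc J) * sqrte (Ssup N f J)) < +oo)%E ->
  exists Q Q1 T, speed_data Q Q1 T.
Proof.
move=> l0 HS tS sumV sumsV sumVS; set l := v 1 in l0 *.
have [c [C [c0 C0 HC]]] := eqn_bounds HN.
have normN x : `|x| <= c^-1 * N x.
  by have [h _] := HC x; rewrite mulrC ler_pdivlMr// mulrC.
have ci : 0 < c^-1 by rewrite invr_gt0.
have [J [J1 J2 J3 JE]] := enum_intervals (fun I SI => (HS I SI).1) tS.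
have VI I : S I -> Var N f (Icc I) = (v I.2 - v I.1)%:E /\ v I.1 < v I.2.
  by move=> SI; have [h1 h2] := HS I SI; exact: (Var_G HN fbv fcts).
pose Sr I : R := `|fine (Ssup N f I)|.
(* An infinite [Ssup], multiplied by the positive variation, would make the last sum of (vii)
   infinite. *)
have SI_fin I : S I -> Ssup N f I = (Sr I)%:E.
  move=> SI; have [h1 h2] := VI I SI; have s0 := Ssup_ge0 HN f (HS I SI).1.
  have := @esum_term R _ S (fun J => (Var N f (Icc J) * sqrte (Ssup N f J))%E) I.
  move=> /(_ _ SI) H.
  have /H : forall y, S y -> (0 <= Var N f (Icc y) * sqrte (Ssup N f y))%E.
    by move=> y Sy; rewrite mule_ge0 ?sqrte_ge0// Var_ge0.
  move=> /le_lt_trans/(_ sumVS); rewrite h1 /Sr; case: (Ssup N f I) s0 => [s|_|//] /=.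
    by rewrite lee_fin => s0 _; rewrite ger0_norm.
  by rewrite gt0_muley ?ltxx// lte_fin subr_gt0.
(* The factor [c^-1] converts a bound in [N] into one in the norm of [X], in which continuity is
   expressed. *)
pose p n : (R * R) * R := ((v (J n).1, v (J n).2), Sr (J n) * c^-1).
have dummy n : J n = (0, 0) -> p n = ((v 0, v 0), Sr (0, 0) * c^-1) by rewrite /p => ->.
have pin n y : (p n).1.1 < y < (p n).1.2 -> S (J n) /\
    exists2 x, (J n).1 < x < (J n).2 & v x = y.
  case: (J1 n) => [SJ|/dummy -> /=]; last by move=> /andP[h /(lt_trans h)]; rewrite ltxx.
  by have [h1 h2] := HS _ SJ; split => //; apply: (v_onto_G HN fbv fcts).
have adm n : admissible (v @` G) F2 (p n).
  split.
  - case: (J1 n) => [/VI[_ /ltW]//|/dummy -> /=]; exact: lexx.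
  - by rewrite mulr_ge0 ?normr_ge0 ?(ltW ci).
  - by move=> y /pin[SJ [x xI <-]]; exists x => //; apply: (HS _ SJ).2; rewrite /Ioo/= in_itv.
  - move=> y /pin[SJ [x xI <-]] /=; apply: (le_trans (normN _)).
    rewrite mulrC ler_wpM2r ?(ltW ci)//.
    by have := @Ssup_ge R X N f _ _ xI; rewrite SI_fin// lee_fin.
have GJ n x : S (J n) -> (J n).1 < x < (J n).2 -> G x.
  by move=> SJ xI; apply: (HS _ SJ).2; rewrite /Ioo/= in_itv.
have G01 x : G x -> 0 <= x <= 1 by move=> /(G_01 HN fbv fcts)/andP[/ltW -> /ltW].
have disjx n m x : S (J n) -> S (J m) -> (J n).1 < x < (J n).2 -> (J m).1 < x < (J m).2 -> n = m.
  move=> Sn Sm xn xm; apply: J3 => //; apply: tS => //.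
  by exists x; split; rewrite /Ioo/= in_itv.
have disj n m y : (p n).1.1 < y < (p n).1.2 -> (p m).1.1 < y < (p m).1.2 -> n = m.
  move=> /pin[Sn [x xn xE]] /pin[Sm [x' xm xE']].
  have Gx := GJ _ _ Sn xn; have Gx' := GJ _ _ Sm xm.
  have E : x = x' by apply: v_inj_G => //; [exact: G01|exact: G01|rewrite xE].
  by apply: (disjx n m x) => //; rewrite E.
have total : (\sum_(0 <= n <oo) ((p n).1.2 - (p n).1.1)%:E)%E = l%:E.
  have := JE (fun I => (v I.2 - v I.1)%:E) _ _; rewrite /= subrr => <- //.
    transitivity (\esum_(I in S) Var N f (Icc I)); first by apply: eq_esum => I /VI[].
    by rewrite sumV (VarE HN fbv)// (v0 HN fbv) subr0.
  by move=> I /VI[_ h]; rewrite lee_fin subr_ge0 ltW.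
have V0 n : 0 <= (p n).1.2 - (p n).1.1 by rewrite subr_ge0; case: (adm n).
have [A1 HA1] : exists A, forall n, \sum_(0 <= i < n) ((p i).1.2 - (p i).1.1) <= A.
  by apply: summable_bound => //; rewrite total ltry.
have [A2 HA2] : exists A, forall n, \sum_(0 <= i < n) Num.sqrt ((p i).1.2 - (p i).1.1) <= A.
  apply: summable_bound => [n|]; first exact: sqrtr_ge0.
  have := JE (fun I => (Num.sqrt (v I.2 - v I.1))%:E) _ _; rewrite /= subrr sqrtr0 => <- //.
  by apply: le_lt_trans sumsV; apply: le_esum => I /VI[-> _].
have [A3 HA3] : exists A, forall n, \sum_(0 <= i < n) ((p i).1.2 - (p i).1.1) * Num.sqrt (Sr (J i)) <= A.
  apply: summable_bound => [n|]; first by rewrite mulr_ge0// sqrtr_ge0.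
  have := JE (fun I => ((v I.2 - v I.1) * Num.sqrt (Sr I))%:E) _ _; rewrite /= subrr mul0r => <- //.
    by apply: le_lt_trans sumVS; apply: le_esum => I SI; rewrite (VI I SI).1 SI_fin.
  by move=> I /VI[_ h]; rewrite lee_fin mulr_ge0 ?sqrtr_ge0// subr_ge0 ltW.
(* By [weight_time], [al n / sqrt (cw n)] will bound the travel time of the [n]-th interval up to
   the factor 8; [summable_weights] supplies [cw] tending to 0 with these quotients still
   summable. *)
pose al n : R := Num.sqrt ((p n).1.2 - (p n).1.1) + ((p n).1.2 - (p n).1.1) +
  ((p n).1.2 - (p n).1.1) * Num.sqrt (p n).2.
have al0 n : 0 <= al n.
  apply: addr_ge0; first by apply: addr_ge0; [exact: sqrtr_ge0|exact: V0].
  by apply: mulr_ge0; [exact: V0|exact: sqrtr_ge0].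
have alB n : \sum_(0 <= i < n) al i <= A2 + A1 + A3 * Num.sqrt c^-1.
  rewrite big_split/= big_split/= lerD// ?lerD//.
  have -> : \sum_(0 <= i < n) ((p i).1.2 - (p i).1.1) * Num.sqrt (p i).2 =
     (\sum_(0 <= i < n) ((p i).1.2 - (p i).1.1) * Num.sqrt (Sr (J i))) * Num.sqrt c^-1.
    by rewrite mulr_suml; apply: eq_bigr => i _; rewrite sqrtrM ?normr_ge0// mulrA.
  by rewrite ler_wpM2r ?sqrtr_ge0.
have [cw [cw0 cwp cws [B HB]]] := summable_weights al0 alB.
have Uopen := vG_open HN fbv fcts.
have UF y : (v @` G) y -> cts setT F2 y by move=> /(vG_regular HN fbv fcts)[].
have [Q [Q1 [HQ HQ1 HQF [QU QN] Qge]]] := speed_exists Uopen UF adm disj cw0 cws.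
have U0l y : (v @` G) y -> 0 < y < l by exact: (vG_range HN fbv fcts).
have cwV n : 0 < (p n).1.2 - (p n).1.1 -> 0 < cw n.
  move=> h; apply: cwp; rewrite /al -addrA ltr_pwDl ?sqrtr_gt0//.
  by apply: addr_ge0; [exact: V0|apply: mulr_ge0; [exact: V0|exact: sqrtr_ge0]].
have kp n : (p n).1.1 < (p n).1.2 -> 0 < cw n / weight (p n).
  move=> h; rewrite divr_gt0 ?cwV ?subr_gt0//; case: (adm n) => _ S0 _ _.
  set V := (p n).1.2 - (p n).1.1; have V1 : 0 < V by rewrite subr_gt0.
  have v2 : 0 < V ^+ 2 by rewrite exprn_gt0.
  have v3 : 0 <= V ^+ 3 by rewrite exprn_ge0 ?ltW.
  by rewrite /weight -/V; have := mulr_ge0 S0 v3; lra.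
have kB n : \sum_(0 <= i < n) (Num.sqrt (cw i / weight (p i)) *
    Num.sqrt ((p i).1.2 - (p i).1.1))^-1 <= B.
  apply: le_trans (HB n); apply: ler_sum => i _.
  by apply: weight_time; [exact: V0|case: (adm i)|exact: cw0|exact: cwV].
have pab n : (p n).1.1 <= (p n).1.2 by case: (adm n).
have pU n y : (p n).1.1 < y < (p n).1.2 -> (v @` G) y by case: (adm n) => _ _ h _ /h.
have [T [T0 T_der T_speed T_cts T_sum]] := @time_exists R (v @` G) l Q
  (fun n => (p n).1.1) (fun n => (p n).1.2) (fun n => cw n / weight (p n)) B l0
  (fun y => der_cts (HQ y)) QU U0l pab pU disj total kp (fun n y _ => Qge n y) kB.
exists Q, Q1, T; split => //; exists J; split => //.
  by move=> n; case: (J1 n) => [/HS|]; [left|right].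
move=> n m x.
case: (J1 n) => [Sn|-> /=]; last by move=> /andP[h /(lt_trans h)]; rewrite ltxx.
case: (J1 m) => [Sm|-> /= _]; last by move=> /andP[h /(lt_trans h)]; rewrite ltxx.
exact: disjx.
Qed.

Lemma reparametrize Q Q1 T : 0 < v 1 -> speed_data Q Q1 T -> exists phi,
  [/\ increasing_homeo 0 1 0 1 phi, C2_on 0 1 (f \o phi) &
     forall x : R, x \in `[0, 1] -> G (phi x) -> (f \o phi)^`()%classic x != 0] /\
  ((forall x y, 0 <= x -> x < y -> y <= 1 -> v x < v y) ->
    mu (`[0, 1] `&` phi @^-1` G) = 1%E).
Proof.
move=> l0 [[HQ HQ1] HQF [QU QN] [T0 T_der T_speed T_cts] [J [J1 J2 T_sum]]].
set vinc := (forall x y, 0 <= x -> x < y -> y <= 1 -> v x < v y).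
pose w : R := if `[< vinc >] then 0 else 1.
have w0 : 0 <= w by rewrite /w; case: ifP.
(* [off_length] makes the time strictly increasing on the intervals where f is
   constant; without such intervals it must be dropped, lest positive time be
   spent outside G. *)
pose m x := w * off_length G x.
have Go := G_open HN fbv fcts; have G01 := G_01 HN fbv fcts.
have Qge0 y : 0 <= Q y.
  by have [/QU/ltW//|/QN ->] := pselect ((v @` G) y).
have Qcts y : cts setT Q y by exact: der_cts (HQ y).
(* A global bound on the speed turns [T_speed] into strict monotonicity of [T]. *)
have [M M0 HM] : exists2 M : R, 0 < M & forall y, 0 <= y <= v 1 -> Num.sqrt (Q y) <= M.
  have QC : {within `[0, v 1], continuous Q}.
    by apply/ctsP => y _; apply: cts_sub (Qcts y).
  have [z _ Hz] := EVT_max (ltW l0) QC.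
  exists (Num.sqrt (Q z) + 1); first by rewrite ltr_wpDl ?sqrtr_ge0.
  move=> y yl; apply: (@le_trans _ _ (Num.sqrt (Q z))); last by rewrite lerDl.
  by rewrite ler_wsqrtr// Hz// in_itv.
have T_lt y z : 0 <= y -> y < z -> z <= v 1 -> T y < T z.
  move=> y0 yz zl; have := T_speed y z M y0 (ltW yz) zl M0.
  move=> /(_ _)H; have : z - y <= M * (T z - T y).
    by apply: H => t /andP[yt tz]; apply: HM; rewrite (le_trans y0)// (le_trans tz).
  move=> h; rewrite -subr_gt0 -(pmulr_rgt0 _ M0); apply: lt_le_trans h; lra.
have T_le y z : 0 <= y -> y <= z -> z <= v 1 -> T y <= T z.
  by move=> y0; rewrite le_eqVlt => /orP[/eqP ->//|yz] zl; exact/ltW/T_lt.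
have off x y : 0 <= x -> x <= y -> off_length G x <= off_length G y <= off_length G x + (y - x).
  exact: off_length_le.
have m_le x y : 0 <= x -> x <= y -> y <= 1 -> m x <= m y.
  by move=> x0 xy _; rewrite /m ler_wpM2l//; have /andP[] := off x y x0 xy.
have v01 x : 0 <= x <= 1 -> 0 <= v x <= v 1 by exact: (v_ge0 HN fbv).
pose eta0 x := T (v x) + m x.
have eta0_lt x y : 0 <= x -> x < y -> y <= 1 -> eta0 x < eta0 y.
  move=> x0 xy y1.
  have /andP[vx0 vx1] : 0 <= v x <= v 1 by apply: v01; rewrite x0 (le_trans (ltW xy)).
  have /andP[vy0 vy1] : 0 <= v y <= v 1 by apply: v01; rewrite y1 (le_trans x0 (ltW xy)).
  have := v_le HN fbv x0 (ltW xy) y1; rewrite le_eqVlt => /orP[/eqP E|vxy]; last first.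
    by rewrite /eta0 ltr_leD ?T_lt// m_le// ltW.
  rewrite /eta0 E ltrD2l /m.
  have -> : w = 1.
    by rewrite /w; case: asboolP => // /(_ x y x0 xy y1); rewrite E ltxx.
  rewrite !mul1r; apply: off_length_gap => // z /andP[xz zy] Gz.
  have := G_v_lt HN fbv fcts x0 xz (le_trans (ltW zy) y1) (or_intror Gz).
  have z0 : 0 <= z by rewrite (le_trans x0) ?ltW.
  have := v_le HN fbv z0 (ltW zy) y1; rewrite -E => h1 h2.
  by move: (le_lt_trans h1 h2); rewrite ltxx.
have m0 : m 0 = 0 by rewrite /m (off_length0 Go) mulr0.
have eta00 : eta0 0 = 0 by rewrite /eta0 (v0 HN fbv) T0 m0 addr0.
pose L := eta0 1; have L0 : 0 < L by rewrite -eta00 eta0_lt.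
have m_cts x : 0 <= x <= 1 -> cts `[0, 1] m x.
  move=> /andP[x0 x1] e e0; exists e => // y; rewrite /= in_itv/= => /andP[y0 y1].
  have w1 : w <= 1 by rewrite /w; case: ifP.
  have key a b : 0 <= a -> a <= b -> b - a < e -> `|m b - m a| <= e.
    move=> a0 ab ba; rewrite /m -mulrBr normrM ger0_norm//.
    have /andP[h1 h2] := off a b a0 ab; rewrite ger0_norm ?subr_ge0//.
    apply: (@le_trans _ _ (1 * (off_length G b - off_length G a))); last by lra.
    by rewrite ler_wpM2r ?subr_ge0.
  have [xy|/ltW yx] := leP x y.
    by rewrite ger0_norm ?subr_ge0//; exact: key.
  by rewrite distrC ger0_norm ?subr_ge0// distrC; exact: key.
have eta0_cts x : 0 <= x <= 1 -> cts `[0, 1] eta0 x.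
  move=> x01; apply: ctsD; last exact: m_cts.
  apply: (@cts_comp _ _ `[0, 1] `[0, v 1] v T) => //.
  - exact: (v_cts HN fbv fcts).
  - exact/T_cts/v01.
(* Time is rescaled so that the whole journey takes time 1; the speed is multiplied by [L] and its
   square by [L ^+ 2]. *)
pose T' y := L^-1 * T y; pose m' x := L^-1 * m x; pose Q' y := L ^+ 2 * Q y.
have Li : 0 < L^-1 by rewrite invr_gt0.
have L2 : 0 < L ^+ 2 by rewrite exprn_gt0.
have sQ y : Num.sqrt (Q' y) = L * Num.sqrt (Q y).
  by rewrite /Q' sqrtrM ?ltW// sqrtr_sqr gtr0_norm.
have scd (g : R -> R) (r : R) x d : der setT g x d -> der setT (fun y => r * g y) x (r * d).
  by move=> D; have := derZ (der_cst setT x r) D; rewrite /GRing.scale/= mul0r addr0.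
have eta_lt x y : 0 <= x -> x < y -> y <= 1 -> T' (v x) + m' x < T' (v y) + m' y.
  by move=> x0 xy y1; rewrite -!mulrDr ltr_pM2l// eta0_lt.
have eta_cts x : 0 <= x <= 1 -> cts `[0, 1] (fun x => T' (v x) + m' x) x.
  move=> x01; have -> : (fun x => T' (v x) + m' x) = (fun x => L^-1 *: eta0 x).
    by apply/funext => y; rewrite /T' /m' -mulrDr.
  by apply: (ctsZ (a := fun=> L^-1)); [exact: cts_cst|exact: eta0_cts].
have [phi H] := incr_homeo ler01 eta_lt eta_cts.
have E0 : T' (v 0) + m' 0 = 0 by rewrite -mulrDr -[T _ + _]/(eta0 0) eta00 mulr0.
have E1 : T' (v 1) + m' 1 = 1 by rewrite -mulrDr -[T _ + _]/(eta0 1) mulVf// gt_eqF.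
rewrite E0 E1 in H.
exists phi; split.
  apply: (@reparam_ii R X N HN f fbv fcts Q' T' m' phi _ _ _ _ _ _ _ _ H
    (fun y => L ^+ 2 * Q1 y)).
  - by move=> y; rewrite /Q' mulr_ge0 ?Qge0 ?(ltW L2).
  - by move=> y; apply: (ctsZ (a := fun=> L ^+ 2)) => //; exact: cts_cst.
  - by move=> x Gx; rewrite mulr_gt0//; apply: QU; exists x.
  - by move=> y /QN; rewrite /Q' => ->; rewrite mulr0.
  - move=> y z K y0 yz zl K0 HK; have := T_speed y z (K / L) y0 yz zl (divr_gt0 K0 L0).
    rewrite -mulrA -/(T' z) mulrBr; apply => t /HK; rewrite sQ => h.
    by rewrite ler_pdivlMr// mulrC.
  - move=> y Uy; have := scd _ L^-1 _ _ (T_der y Uy); rewrite sQ invfM; exact.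
  - by move=> x y x0 xy y1; rewrite /m' ler_wpM2l ?(ltW Li)// m_le.
  - move=> x Gx; have [r r0 Hr] := off_length_loc Go G01 Gx; exists r => // y /Hr.
    by rewrite /m' /m => ->.
  - by move=> y; exact: scd.
  - by move=> y; apply: (ctsZ (a := fun=> L ^+ 2)) => //; exact: cts_cst.
  - move=> y yl.
    have -> : (fun y => Q' y *: F2 y) = (fun y => (L ^+ 2) *: (Q y *: F2 y)).
      by apply/funext => t; rewrite /Q' scalerA.
    apply: (ctsZ (a := fun=> L ^+ 2)); first exact: cts_cst.
    exact: cts_sub (HQF y).
move=> vi; have wE : w = 0 by rewrite /w; case: asboolP.
have m'0 x : m' x = 0 by rewrite /m' /m wE mul0r mulr0.
have Hp t : 0 <= t <= 1 -> 0 <= phi t <= 1 /\ T' (v (phi t)) = t.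
  by case: H => _ H2 _ _ _ /H2[h1]; rewrite m'0 addr0.
pose A : set R := `[0%R, 1%R]%classic `&` phi @^-1` G.
have AO : open A.
  rewrite openE => t [t01 Gt]; move: (t01); rewrite /= in_itv/= => t01'.
  have tI : 0 < t < 1.
    have [h1 h2 _ _ _] := homeo_pair_ends ler01 (homeo_pair_sym H).
    have /andP[p0 p1] := G01 _ Gt; case/andP: t01' => t0 t1.
    rewrite !lt_neqAle t0 t1 !andbT; apply/andP; split; apply/eqP => E.
      by move: p0; rewrite -E h1 ltxx.
    by move: p1; rewrite E h2 ltxx.
  have [r r0 Hr] := Go _ Gt; have r2 : 0 < r / 2 by lra.
  have [s s0 Hs] := itv_ball tI.
  have pc : cts `[0, 1] phi t by case: H => _ _ _ _; apply.
  have [d d0 Hd] := pc _ r2.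
  apply/nbhs_ballP; exists (minr s d); first by rewrite /= lt_min s0.
  move=> y; rewrite /ball/= distrC lt_min => /andP[/Hs/andP[y0 y1] yd].
  have yI : `[0%R, 1%R]%classic y by rewrite /= in_itv/= !ltW.
  split => //; apply: Hr; apply: le_lt_trans (Hd y yI yd) _; lra.
have mA : measurable A := open_measurable AO.
apply/eqP; rewrite eq_le; apply/andP; split.
  apply: (@le_trans _ _ (mu `[0%R, 1%R]%classic)); last by rewrite mu_itv// subr0.
  by apply: le_measure; rewrite ?inE// => t [].
(* These are the time intervals spent in the [J n]. They are disjoint, [phi] maps them into [G], and
   their lengths add up to [T (v 1) / L], which is 1 when [m] vanishes. *)
pose K n : set R := `]T' (v (J n).1), T' (v (J n).2)[%classic.
have JI n : 0 <= (J n).1 /\ (J n).2 <= 1 /\ (J n).1 <= (J n).2.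
  case: (J1 n) => [[h1 h2]|-> /=]; last by rewrite lexx ler01.
  by have [j0 j1] := G_interval HN fbv fcts h1 h2; split => //; split => //; exact: ltW.
have TJ n : T (v (J n).1) <= T (v (J n).2).
  have [j0 [j1 jj]] := JI n; apply: T_le; last 1 first.
  - by apply: (v_le HN fbv) => //; exact: le_trans jj.
  - by rewrite -{1}(v0 HN fbv); apply: (v_le HN fbv) => //; exact: le_trans j1.
  - exact: (v_le HN fbv).
have KJ n t : K n t -> 0 <= t <= 1 /\ (J n).1 < phi t < (J n).2.
  rewrite /K /= in_itv/= => /andP[t1 t2]; have [j0 [j1 jj]] := JI n.
  have [ee1 ee2 _ _ _] := homeo_pair_ends ler01 H.
  have T'01 x : 0 <= x <= 1 -> 0 <= T' (v x) <= 1.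
    by move=> x01; case: H => h _ _ _ _; have [] := h x x01; rewrite m'0 addr0.
  have j11 : 0 <= (J n).1 <= 1 by rewrite j0 (le_trans jj).
  have j22 : 0 <= (J n).2 <= 1 by rewrite j1 (le_trans j0).
  have /andP[a1 _] := T'01 _ j11; have /andP[_ a2] := T'01 _ j22.
  have t01 : 0 <= t <= 1 by rewrite (le_trans a1 (ltW t1)) (le_trans (ltW t2) a2).
  split => //; have [/andP[p0 p1] pE] := Hp t t01.
  have T'le x y : 0 <= x -> x <= y -> y <= 1 -> T' (v x) <= T' (v y).
    move=> x0; rewrite le_eqVlt => /orP[/eqP ->//|xy] y1.
    by have := eta_lt x y x0 xy y1; rewrite !m'0 !addr0 => /ltW.
  have j12 : (J n).1 <= 1 by rewrite (le_trans jj).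
  have j20 : 0 <= (J n).2 by rewrite (le_trans j0).
  apply/andP; split; rewrite ltNge; apply/negP => h.
    by move: t1; rewrite -pE ltNge T'le.
  by move: t2; rewrite -pE ltNge T'le.
have trivK : trivIset setT K.
  move=> n k _ _ [t [/KJ[_ h1] /KJ[_ h2]]]; exact: J2 h1 h2.
have KA : \bigcup_n K n `<=` A.
  move=> t [n _ /KJ[t01 pI]]; split; first by rewrite /= in_itv.
  case: (J1 n) => [[h1 h2]|E]; first by apply: h2; rewrite /Ioo/= in_itv.
  by move: pI; rewrite E /= => /andP[h /(lt_trans h)]; rewrite ltxx.
have mK : measurable (\bigcup_n K n) by apply: bigcupT_measurable => n; exact: measurable_itv.
apply: (@le_trans _ _ (mu (\bigcup_n K n))); last by apply: le_measure; rewrite ?inE.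
rewrite (measure_semi_bigcup (@lebesgue_measure R) (fun=> measurable_itv _) trivK mK).
have -> : (\sum_(0 <= n <oo) mu (K n) = \sum_(0 <= n <oo) (L^-1)%:E * (T (v (J n).2) - T (v (J n).1))%:E)%E.
  apply: eq_eseriesr => n _; have [j0 [j1 jj]] := JI n; rewrite /K mu_itv.
    by rewrite -EFinM mulrBr.
  by rewrite /T' ler_wpM2l ?(ltW Li)// TJ.
rewrite nneseriesZl; last first.
  by move=> n _; rewrite lee_fin subr_ge0 TJ.
rewrite T_sum -EFinM lee_fin; have -> : T (v 1) = L by rewrite /L /eta0 /m wE mul0r addr0.
by rewrite mulVf// gt_eqF.
Qed.

End Construction.

(** * Generalized partitions *)

Section Components.
Context {R : realType}.
Variable G : set R.
Hypothesis Gopen : forall x, G x -> exists2 r : R, 0 < r & forall y, `|y - x| < r -> G y.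
Hypothesis G01 : forall x, G x -> 0 < x < 1.

Lemma component_itv x : G x -> exists a b : R,
  connected_component G x = `]a, b[%classic /\ a < x < b.
Proof.
move=> Gx; set C := connected_component G x.
have Cx : C x by exact: connected_component_refl.
have CG : C `<=` G by exact: connected_component_sub.
have CI : is_interval C by apply/connected_intervalP; exact: component_connected.
have Copen y : C y -> exists2 r : R, 0 < r & forall z, `|z - y| < r -> C z.
  move=> Cy; have [r r0 Hr] := Gopen (CG _ Cy); exists r => // z zy.
  rewrite /C (same_connected_component Cy).
  pose B := [set z : R | `|z - y| < r].
  apply: (@connected_component_max _ _ B) => //.
  - by rewrite /B /= subrr normr0.
  - apply/connected_intervalP => s t; rewrite /B /= !ltr_norml => /andP[? ?] /andP[? ?] w /andP[? ?].
    by rewrite /B/= ltr_norml; apply/andP; split; lra.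
have hsup : has_sup C by split; [exists x|exists 1 => y /CG/G01/andP[_ /ltW]].
have hinf : has_inf C by split; [exists x|exists 0 => y /CG/G01/andP[/ltW]].
have E : C = `]inf C, sup C[%classic.
  apply/seteqP; split => y.
    move=> Cy; have [r r0 Hr] := Copen y Cy.
    have h1 : C (y + r / 2) by apply: Hr; rewrite addrAC subrr add0r ger0_norm; lra.
    have h2 : C (y - r / 2) by apply: Hr; rewrite addrAC subrr add0r normrN ger0_norm; lra.
    have := sup_ubound hsup.2 h1; have := inf_lbound hinf.2 h2.
    by rewrite /= in_itv/= => i1 i2; apply/andP; split; lra.
  rewrite /= in_itv/= => /andP[y1 y2].
  have p1 : 0 < y - inf C by lra.
  have p2 : 0 < sup C - y by lra.
  have [s Cs s1] := inf_adherent p1 hinf; have [t Ct t1] := sup_adherent p2 hsup.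
  by apply: (CI s t Cs Ct); apply/andP; split; lra.
exists (inf C), (sup C); split; first exact: E.
by move: Cx; rewrite {1}E /= in_itv.
Qed.

Lemma sub_component (I : R * R) x : Ioo I `<=` G -> Ioo I x -> Ioo I `<=` connected_component G x.
Proof.
move=> IG Ix; apply: connected_component_max => //.
apply/connected_intervalP => s t; rewrite /Ioo /= !in_itv/= => /andP[? ?] /andP[? ?] w /andP[? ?].
by rewrite /= in_itv/=; apply/andP; split; lra.
Qed.

Lemma Zinterval_between (J : set int) i j k : Zinterval J -> J i -> J j -> i <= k -> k <= j -> J k.
Proof.
move=> [l [m ->]] [li im] [lj jm] ik kj; split.
  by apply: lt_le_trans li _; rewrite lee_fin.
by apply: le_lt_trans jm; rewrite lee_fin.
Qed.

Variable P : set (R * R).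
Hypothesis PG : gen_partition G P.

Lemma partition_lt I : P I -> I.1 < I.2. Proof. by case: PG => h _ _; exact: h. Qed.

Lemma partition_sub I : P I -> Ioo I `<=` G.
Proof. by case: PG => _ h _ PI x Ix; apply: h; exists I. Qed.

(** Two intervals with a common interior point lie in the same component, where both are formed by
    consecutive points of one increasing system. *)
Lemma partition_trivI : trivIset P Ioo.
Proof.
move=> I I' PI PI' [y [Iy I'y]].
have Gy := partition_sub PI Iy.
have [a [b [E yab]]] := component_itv Gy.
case: PG => _ _ /(_ a b y Gy E)[J [x [JZ xlt _ _ PE]]].
have H K : P K -> Ioo K y -> exists k, [/\ J k, J (k + 1) & K = (x k, x (k + 1))].
  move=> PK Ky; have : [set I | P I /\ Ioo I `<=` `]a, b[%classic] K.
    by split => //; rewrite -E; apply: sub_component => //; exact: partition_sub.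
  by rewrite PE => -[k [Jk Jk1] <-]; exists k.
have [k [Jk Jk1 EI]] := H I PI Iy; have [k' [Jk' Jk1' EI']] := H I' PI' I'y.
have {H} key i j : J i -> J (i + 1) -> J j -> J (j + 1) -> x i < y < x (i + 1) ->
    x j < y < x (j + 1) -> i < j -> False.
  move=> Ji Ji1 Jj Jj1 /andP[_ y1] /andP[y2 _] ij.
  have : x (i + 1) <= x j.
    have : i + 1 <= j by rewrite lezD1.
    by rewrite le_eqVlt => /orP[/eqP ->//|h]; rewrite ltW// xlt.
  by move=> h; have := lt_trans y2 y1; rewrite ltNge h.
move: Iy I'y; rewrite EI EI' /Ioo/= !in_itv/= => Iy I'y.
have [h|h|-> //] := ltgtP k k'.
  by case: (key k k' Jk Jk1 Jk' Jk1' Iy I'y h).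
by case: (key k' k Jk' Jk1' Jk Jk1 I'y Iy h).
Qed.

(** In the component of [y], whose ends are the infimum and supremum of the system, some [x i] lies
    to the left of [y] and some [x j] to the right. Only finitely many indices lie between [i] and
    [j], so walking up from [i] finds the interval containing [y]. *)
Lemma partition_cover y : G y -> exists2 I, P I & I.1 <= y <= I.2.
Proof.
move=> Gy; have [a [b [E /andP[ay yb]]]] := component_itv Gy.
case: PG => _ _ /(_ a b y Gy E)[J [x [JZ xlt xinf xsup PE]]].
have [i Ji xi] : exists2 i, J i & x i < y.
  have := @ereal_inf_lt R [set (x i)%:E | i in J] y%:E; rewrite xinf lte_fin => /(_ ay).
  by move=> [_ [i Ji <-]]; rewrite lte_fin; exists i.
have [j Jj xj] : exists2 i, J i & y < x i.
  have := @ereal_sup_gt R [set (x i)%:E | i in J] y%:E; rewrite xsup lte_fin => /(_ yb).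
  by move=> [_ [k Jk <-]]; rewrite lte_fin; exists k.
have ij : i < j.
  rewrite ltNge le_eqVlt; apply/negP => /orP[/eqP ji|ji].
    by move: (lt_trans xi xj); rewrite ji ltxx.
  by move: (lt_trans (lt_trans xi xj) (xlt _ _ Jj Ji ji)); rewrite ltxx.
suff [k [Jk Jk1 /andP[k1 k2]]] : exists k, [/\ J k, J (k + 1) & x k <= y <= x (k + 1)].
  exists (x k, x (k + 1)); last by rewrite /= k1.
  have : [set I | P I /\ Ioo I `<=` `]a, b[%classic] (x k, x (k + 1)) by rewrite PE; exists k.
  by case.
pose n := `|j - i|%N; have jE : j = i + n%:Z by rewrite /n gez0_abs ?subr_ge0 ?ltW//; ring.
move: jE Jj xj; clearbody n; clear ij; move: j; elim: n i Ji xi => [|n IH] i Ji xi j jE Jj xj.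
  by move: (lt_trans xi xj); rewrite jE addr0 ltxx.
have Ji1 : J (i + 1) by apply: (Zinterval_between JZ Ji Jj); lia.
have [yi|yi] := leP y (x (i + 1)).
  by exists i; split => //; rewrite (ltW xi).
by apply: (IH (i + 1) Ji1 yi j) => //; lia.
Qed.

End Components.

(** * A null image of [D] leaves the whole length to [G] *)

Section TotalLength.
Context {R : realType} {X : normedModType R} {N : X -> R}.
Hypothesis HN : equivalent_norm N.
Variable f : R -> X.
Hypothesis fbv : BV01 N f.
Hypothesis fcts : forall x, 0 <= x <= 1 -> cts `[0, 1] f x.

Local Notation mu := (@lebesgue_measure R).
Local Notation v := (vfun N f).
Local Notation F := (arclength_map N f).
Local Notation G := (`[0%R, 1%R]%classic `\` Dset N f : set R).

Lemma diam_ge (U : set X) x y : U x -> U y -> ((N (x - y))%:E <= diam N U)%E.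
Proof. by move=> Ux Uy; apply: ereal_sup_ubound; right; exists (x, y). Qed.

Lemma diam_ge0 (U : set X) : (0 <= diam N U)%E.
Proof. by apply: ereal_sup_ubound; left. Qed.

(** The scale 1 already suffices: the premeasure at that scale is at most the Hausdorff measure, and
    only the sum of the diameters matters. *)
Lemma null_cover (E : set X) (e : R) : hausdorff1 N E = 0%E -> 0 < e ->
  exists (U : nat -> set X) (d : nat -> R), [/\ E `<=` \bigcup_i U i,
    (forall i x y, U i x -> U i y -> N (x - y) <= d i),
    (forall i, 0 <= d i) & (\sum_(0 <= i <oo) (d i)%:E < e%:E)%E].
Proof.
move=> E0 e0; have : (hausdorff1_delta N 1 E < e%:E)%E.
  apply: (@le_lt_trans _ _ (hausdorff1 N E)); last by rewrite E0 lte_fin.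
  by apply: ereal_sup_ubound; exists 1 => //=.
move=> /ereal_inf_lt[_ [U [EU dU] <-] sU].
have fin i : diam N (U i) \is a fin_num.
  by rewrite ge0_fin_numE ?diam_ge0// (le_lt_trans (dU i))// ltry.
exists U, (fun i => fine (diam N (U i))); split => //.
- by move=> i x y Ux Uy; rewrite -lee_fin fineK// diam_ge.
- by move=> i; rewrite fine_ge0// diam_ge0.
by under eq_eseriesr do rewrite fineK//.
Qed.


Variable J : nat -> R * R.
Hypothesis JG : forall n, (J n).1 < (J n).2 /\ Ioo (J n) `<=` G \/ J n = (0, 0).
Hypothesis Jcover : forall y, G y -> exists n, (J n).1 <= y <= (J n).2.
Hypothesis Jdisj : forall n m x, (J n).1 < x < (J n).2 -> (J m).1 < x < (J m).2 -> n = m.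
Hypothesis null : hausdorff1 N (f @` Dset N f) = 0%E.

Let K n : set R := `]v (J n).1, v (J n).2[%classic.
Let O : set R := \bigcup_n K n.

Lemma J_range n : [/\ 0 <= (J n).1, (J n).2 <= 1 & (J n).1 <= (J n).2].
Proof.
case: (JG n) => [[h1 h2]|-> /=]; last by rewrite lexx ler01.
by have [j0 j1] := G_interval HN fbv fcts h1 h2; split => //; exact: ltW.
Qed.

Lemma KP n y : K n y -> exists x, [/\ (J n).1 < x < (J n).2, v x = y & G x].
Proof.
rewrite /K /= in_itv/=; case: (JG n) => [[h1 h2]|-> /=].
  move=> /(v_onto_G HN fbv fcts h1 h2)[x xI xE]; exists x; split => //.
  by apply: h2; rewrite /Ioo/= in_itv.
by move=> /andP[h /(lt_trans h)]; rewrite ltxx.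
Qed.

Lemma K_triv : trivIset setT K.
Proof.
move=> n m _ _ [y [/KP[x [xn xE Gx]] /KP[x' [xm xE' Gx']]]].
have /andP[x0 x1] := G_01 HN fbv fcts Gx; have /andP[x'0 x'1] := G_01 HN fbv fcts Gx'.
suff E : x = x' by apply: (Jdisj xn); rewrite E.
have [h|h|//] := ltgtP x x'.
  by have := G_v_lt HN fbv fcts (ltW x0) h (ltW x'1) (or_introl Gx); rewrite xE xE' ltxx.
by have := G_v_lt HN fbv fcts (ltW x'0) h (ltW x1) (or_intror Gx); rewrite xE xE' ltxx.
Qed.

Lemma O_open y : O y -> exists2 r : R, 0 < r & forall z, `|z - y| < r -> O z.
Proof.
move=> [n _]; rewrite /K /= in_itv/= => /itv_ball[r r0 Hr]; exists r => // z /Hr zI.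
by exists n => //; rewrite /K /= in_itv.
Qed.

Let mO : measurable O. Proof. exact: (open_measurable (G_is_open O_open)). Qed.

(* The 1-Lipschitz function y |-> N (F y - f u) maps v(D) to a null set, so its
   values between 0 and N (f w - f u) are attained, up to measure 0, on O. *)
Lemma f_increment_le u w : 0 <= u -> u <= w -> w <= 1 ->
  ((N (f w - f u))%:E <= mu (`]v u, v w]%classic `&` O))%E.
Proof.
move=> u0 uw w1.
have u01 : 0 <= u <= 1 by rewrite u0 (le_trans uw).
have w01 : 0 <= w <= 1 by rewrite w1 (le_trans u0).
have vuw : v u <= v w by exact: (v_le HN fbv).
pose ph (y : R) : R := N (F y - f u).
have lip y z : 0 <= y -> y <= z -> z <= v 1 -> `|ph z - ph y| <= z - y.
  move=> y0 yz zl; apply: le_trans (F_lip HN fbv fcts y0 yz zl).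
  apply: le_trans (eqn_lip HN _ _) _.
  by rewrite opprB addrA subrK.
have /andP[vu0 vu1] := v_ge0 HN fbv u01; have /andP[vw0 vw1] := v_ge0 HN fbv w01.
have ph_cts a b : 0 <= a -> b <= v 1 -> {within `[a, b], continuous ph}.
  move=> a0 b1; apply/ctsP => y; rewrite /= in_itv/= => /andP[ay yb] e e0; exists e => // z.
  rewrite /= in_itv/= => /andP[az zb].
  have [yz|/ltW zy] := leP y z.
    rewrite (ger0_norm (_ : 0 <= z - y)) ?subr_ge0// => h; apply: le_trans (ltW h).
    apply: lip => //; lra.
  rewrite distrC (distrC (ph z)) (ger0_norm (_ : 0 <= y - z)) ?subr_ge0// => h; apply: le_trans (ltW h).
  apply: lip => //; lra.
pose s n := maxr (v (J n).1) (v u); pose t n := minr (v (J n).2) (v w).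
(* [ph] is 1-Lipschitz, so with [q] its minimum on the clipped interval its values there fill at
   most the length of that interval. *)
have st n : exists q : R, (s n <= t n -> forall y, s n <= y <= t n -> q <= ph y <= q + (t n - s n)).
  have [h|h] := leP (s n) (t n); last by exists 0.
  have s0 : 0 <= s n by rewrite le_max vu0 orbT.
  have t1 : t n <= v 1 by rewrite ge_min vw1 orbT.
  have [c] := EVT_min h (ph_cts _ _ s0 t1); rewrite in_itv/= => /andP[sc ct] Hc.
  exists (ph c) => _ y /andP[sy yt]; rewrite Hc ?in_itv/= ?sy//=.
  have [cy|/ltW yc] := leP c y.
    have := lip c y (le_trans s0 sc) cy (le_trans yt t1); rewrite ler_norml => /andP[_]; lra.
  have := lip y c (le_trans s0 sy) yc (le_trans ct t1); rewrite ler_norml => /andP[h1 _]; lra.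
have [q Hq] := boolp.choice st.
have mI n : measurable (`]v u, v w]%classic `&` K n) by apply: measurableI; exact: measurable_itv.
have muO : (mu (`]v u, v w]%classic `&` O) = \sum_(0 <= n <oo) mu (`]v u, v w]%classic `&` K n))%E.
  rewrite /O setI_bigcupr measure_semi_bigcup//.
    by apply: trivIset_setIl; exact: K_triv.
  by apply: bigcupT_measurable.
apply/lee_addgt0Pr => e e0; have e2 : 0 < e / 2 by lra.
have [U [d [DU dU d0 sd]]] := null_cover null e2.
(* The values on [U i] lie within [d i] of the value at one of its points, hence in an interval of
   length [2 * d i]; this explains the choice of [e / 2] for the sum of the [d i]. *)
have pt i : exists p : R, forall z, U i z -> p - d i <= N (z - f u) <= p + d i.
  have [[z0 Uz0]|nU] := pselect (exists z, U i z); last by exists 0 => z Uz; case: nU; exists z.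
  exists (N (z0 - f u)) => z Uz; have := eqn_lip HN (z - f u) (z0 - f u).
  rewrite opprB addrA subrK => h; have := le_trans h (dU _ _ _ Uz Uz0).
  by rewrite ler_norml => /andP[? ?]; apply/andP; split; lra.
have [p Hp] := boolp.choice pt.
pose A n : set R := (if s n <= t n then `[q n, q n + (t n - s n)] else set0)%classic.
pose B i : set R := `[p i - d i, p i + d i]%classic.
have mA n : measurable (A n) by rewrite /A; case: ifP.
have cov : `[0%R, N (f w - f u)]%classic `<=` \bigcup_n (A n `|` B n).
  move=> r; rewrite /= in_itv/= => /andP[r0 r1].
  have phu : ph (v u) = 0 by rewrite /ph (F_v HN fbv u01) subrr eqn0.
  have phw : ph (v w) = N (f w - f u) by rewrite /ph (F_v HN fbv w01).
  have := @IVT _ ph (v u) (v w) r vuw (ph_cts _ _ vu0 vw1).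
  rewrite phu phw (min_idPl (eqn_ge0 HN _)) (max_idPr (eqn_ge0 HN _)) r0 r1 => /(_ isT)[y].
  rewrite in_itv/= => /andP[y1 y2] Ey.
  have [x x01 xE] : exists2 x, 0 <= x <= 1 & v x = y.
    by apply: (v_surj HN fbv fcts); rewrite (le_trans vu0 y1) (le_trans y2).
  (* A point of [D] is caught by the null cover, any other point by a closed interval [J n]; closed
     intervals are taken because partition points may belong to [G]. *)
  have [Dx|nDx] := pselect (Dset N f x).
    have [i _ Ui] : (\bigcup_i U i) (f x) by apply: DU; exists x.
    exists i => //; right; rewrite /B /= in_itv/= -Ey -xE /ph (F_v HN fbv x01); exact: Hp.
  have Gx : G x by split => //; rewrite /= in_itv.
  have [n /andP[xn1 xn2]] := Jcover Gx; exists n => //; left; rewrite /A.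
  have [j0 j1 _] := J_range n.
  have sy : s n <= y by rewrite ge_max y1 andbT -xE; apply: (v_le HN fbv) => //; case/andP: x01.
  have yt : y <= t n by rewrite le_min y2 andbT -xE; apply: (v_le HN fbv) => //; case/andP: x01.
  have h : s n <= t n by exact: le_trans yt.
  by rewrite h /= in_itv/= -Ey; apply: Hq => //; rewrite sy.
have rE : (N (f w - f u))%:E = mu `[0%R, N (f w - f u)]%classic.
  by rewrite mu_itv ?(eqn_ge0 HN)// subr0.
rewrite rE.
have mAB n : measurable (A n `|` B n) by apply: measurableU; [exact: mA|exact: measurable_itv].
apply: le_trans (measure_sigma_subadditive (@lebesgue_measure R) mAB _ cov) _ => //.
apply: (@le_trans _ _ (\sum_(0 <= n <oo) (mu (A n) + mu (B n)))%E).
  apply: lee_nneseries => [n *|n *]; first exact: measure_ge0.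
  by apply: measureU2; [exact: mA|exact: measurable_itv].
rewrite nneseriesD; [|by move=> *; exact: measure_ge0..].
apply: leeD.
  rewrite muO; apply: lee_nneseries => [n *|n *]; first exact: measure_ge0.
  rewrite /A; case: ifP => h; last by rewrite measure0 measure_ge0.
  rewrite mu_itv; last by lra.
  apply: (@le_trans _ _ (mu `]s n, t n[%classic)); first by rewrite mu_itv// lee_fin; lra.
  apply: le_measure; rewrite ?inE//; first exact: mI.
  move=> y; rewrite /K /= !in_itv/= => /andP[]; rewrite gt_max lt_min => /andP[-> ->] /andP[-> yw].
  by rewrite ltW.
have -> : (\sum_(0 <= n <oo) mu (B n) = \sum_(0 <= n <oo) 2%:E * (d n)%:E)%E.
  apply: eq_eseriesr => n _; rewrite /B mu_itv; last by have := d0 n; lra.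
  by rewrite -EFinM; congr (_%:E); ring.
rewrite nneseriesZl; last by move=> n _; rewrite lee_fin.
have -> : e%:E = (2%:E * (e / 2)%:E)%E by rewrite -EFinM; congr (_%:E); field.
by rewrite lee_pmul2l// ltW.
Qed.

(* Each increment of f is at most the arc length spent in the intervals J n, so v
   minus the length of the rest still dominates all increments of f; as v is the
   variation, the rest is null. *)
Lemma total_length : (\sum_(0 <= n <oo) (v (J n).2 - v (J n).1)%:E)%E = (v 1)%:E.
Proof.
have l0 : 0 <= v 1 by rewrite -(v0 HN fbv); exact: (v_le HN fbv).
have vJ n : v (J n).1 <= v (J n).2 by have [? ? ?] := J_range n; exact: (v_le HN fbv).
have muO : mu O = (\sum_(0 <= n <oo) (v (J n).2 - v (J n).1)%:E)%E.
  rewrite (measure_semi_bigcup (@lebesgue_measure R) (fun=> measurable_itv _) K_triv mO).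
  by apply: eq_eseriesr => n _; transitivity (mu (K n)); rewrite // /K mu_itv.
have Osub : O `<=` `[0, v 1]%classic.
  move=> y [n _ /KP[x [_ <- /(G_01 HN fbv fcts)/andP[x0 x1]]]]; rewrite /= in_itv/=.
  by apply: (v_ge0 HN fbv); rewrite !ltW.
have key u w : 0 <= u -> u <= w -> w <= 1 -> N (f w - f u) <=
   (v w - off_length O (v w)) - (v u - off_length O (v u)).
  move=> u0 uw w1; have := f_increment_le u0 uw w1.
  have u01 : 0 <= u <= 1 by rewrite u0 (le_trans uw).
  have vu0 : 0 <= v u by have /andP[] := v_ge0 HN fbv u01.
  have vuw : v u <= v w by exact: (v_le HN fbv).
  have E1 := off_length_diff O_open vu0 vuw.
  have E2 : (mu `]v u, v w]%classic = mu (`]v u, v w]%classic `\` O) + mu (`]v u, v w]%classic `&` O))%E.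
    exact: measureDI.
  rewrite -E1 mu_itv// in E2.
  have fin : mu (`]v u, v w]%classic `&` O) \is a fin_num.
    rewrite ge0_fin_numE//; apply: (@le_lt_trans _ _ (mu `]v u, v w]%classic)); last by rewrite mu_itv// ltry.
    by apply: le_measure; rewrite ?inE//; exact: measurableI.
  by move: E2; rewrite -(fineK fin) -EFinD lee_fin => -[E2]; lra.
have h : v 1 <= (v 1 - off_length O (v 1)) - (v 0 - off_length O (v 0)).
  pose g x := v x - off_length O (v x).
  have key' u w : 0 <= u -> u <= w -> w <= 1 -> N (f w - f u) <= g w - g u by exact: key.
  clear key.
  rewrite -/(g 1) -/(g 0); clearbody g.
  have := key' 0 1 (lexx _) ler01 (lexx _); have := eqn_ge0 HN (f 1 - f 0) => k1 k2.
  apply: (vv_le HN fbv) => //; first exact: le_trans k2.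
  move=> x s /(sub_path (@ltW _ _)) ps ms.
  apply: (@le_trans _ _ (g 1 - g x)).
    elim: s x ps ms => [|y s IH] x /= => [_ ms|/andP[xy ps] ms].
      have /andP[x0 x1] := ms x (mem_head _ _).
      exact: le_trans (eqn_ge0 HN _) (key' x 1 x0 x1 (lexx _)).
    have /andP[x0 _] := ms x (mem_head _ _).
    have /andP[_ y1] : 0 <= y <= 1 by apply: ms; rewrite !inE eqxx orbT.
    have -> : g 1 - g x = (g y - g x) + (g 1 - g y) by ring.
    apply: lerD; first exact: key'.
    by apply: IH => // z zs; apply: ms; rewrite inE zs orbT.
  have /andP[x0 x1] := ms x (mem_head _ _).
  rewrite lerD2l lerN2 -subr_ge0; exact: le_trans (eqn_ge0 HN _) (key' 0 x (lexx _) x0 x1).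
have o0 : off_length O (v 0) = 0 by rewrite (v0 HN fbv) off_length0//; exact: O_open.
have ol : off_length O (v 1) <= 0.
  by move: h; rewrite o0 (v0 HN fbv) subrr subr0 lerDl oppr_ge0.
have E3 : (mu `[0%R, v 1]%classic = mu (`[0%R, v 1]%classic `\` O) + mu (`[0%R, v 1]%classic `&` O))%E.
  exact: measureDI.
rewrite -muO; move: E3; rewrite setIidr// mu_itv// subr0 => ->.
suff -> : mu (`[0%R, v 1]%classic `\` O) = 0%E by rewrite add0e.
have fin : mu (`[0%R, v 1]%classic `\` O) \is a fin_num.
  rewrite ge0_fin_numE//; apply: (@le_lt_trans _ _ (mu `[0%R, v 1]%classic)); last by rewrite mu_itv// ltry.
  by apply: le_measure; rewrite ?inE//; exact: measurableD.
apply/eqP; rewrite eq_le measure_ge0 andbT -(fineK fin) lee_fin; exact: ol.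
Qed.

End TotalLength.

(** * Greedy partitions of an interval *)

Section Greedy.
Context {R : realType}.
Implicit Types (W h : R -> R).

(* [below] and [above] bound sup h * (W q - W p) over ]p, q[ by dl; stated with
   upper bounds of h because the supremum may be infinite. *)
Definition below W h (dl p q : R) : Prop :=
  exists s, [/\ 0 <= s, forall z, p < z < q -> h z <= s & s * (W q - W p) <= dl].

Definition above W h (dl p q : R) : Prop :=
  forall s, (forall z, p < z < q -> h z <= s) -> dl <= s * (W q - W p).

Section Forward.
Variables (W h : R -> R) (a b dl : R).
Hypothesis dl0 : 0 < dl.
Hypothesis Wlt : forall x y, a < x -> x < y -> y <= b -> W x < W y.
Hypothesis Wcts : forall x, a < x -> x <= b -> cts `]a, b] W x.
Hypothesis hcts : forall x, a < x < b -> cts setT h x.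
Hypothesis h0 : forall x, 0 <= h x.

(** [y] is the supremum of the right ends up to which the bound [dl] holds. By continuity of [W] it
    holds up to [y] as well. If [y < b] and [above] failed, there would be room to go beyond [y], by
    continuity of [h] and [W]; [near_ok] is this prolongation, and also gives the first step. *)
Lemma greedy_step x : a < x < b -> exists y, [/\ x < y, y <= b, below W h dl x y &
  (y < b -> above W h dl x y)].
Proof.
move=> /andP[ax xb].
pose A := [set t : R | x < t < b /\ exists s, [/\ 0 <= s, forall z, x < z < t -> h z <= s & s * (W t - W x) <= dl]].
have near_ok c s e : x <= c -> c < b -> 0 <= s -> (forall z, x < z < c -> h z <= s) ->
    (x < c -> h c <= s) -> h c <= s + e / 2 -> 0 < e -> (s + e) * (W c - W x + e) <= dl -> exists2 t, c < t & A t.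
  move=> xc cb s0 hs hcs hc e0 He.
  have ac : a < c by lra.
  have e2 : 0 < e / 2 by lra.
  have acb : a < c < b by rewrite ac.
  have [d1 d10 H1] := hcts acb e2; have [d2 d20 H2] := Wcts ac (ltW cb) e0.
  pose d := minr d1 (minr d2 (b - c)); have d0 : 0 < d by rewrite !lt_min d10 d20 subr_gt0.
  have dd1 : d <= d1 by rewrite ge_min lexx.
  have dd2 : d <= d2 by rewrite !ge_min lexx orbT.
  have dd3 : d <= b - c by rewrite !ge_min lexx !orbT.
  exists (c + d / 2); first by lra.
  split; first by apply/andP; split; lra.
  exists (s + e); split; first by lra.
  - move=> z /andP[xz zt]; have [zc|cz] := ltP z c.
      by have := hs z; rewrite xz zc => /(_ isT); lra.
    have := H1 z I; rewrite ger0_norm ?subr_ge0// => H; have {}H : `|h z - h c| <= e / 2 by apply: H; lra.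
    by move: H; rewrite ler_norml => /andP[_]; lra.
  - have := H2 (c + d / 2); rewrite /= in_itv/= => H.
    have {}H : `|W (c + d / 2) - W c| <= e.
      by apply: H; [apply/andP; split; lra|rewrite addrAC subrr add0r ger0_norm; lra].
    move: H; rewrite ler_norml => /andP[_ H].
    by apply: le_trans He; rewrite ler_wpM2l; lra.
have [t0 xt0 At0] : exists2 t, x < t & A t.
  pose s := h x; have s0 : 0 <= s by exact: h0.
  (* With [e <= 1] this gives [(s + e) * e <= dl], as [near_ok] requires at [c = x]. *)
  pose e := minr 1 (dl / (s + 1)).
  have e0 : 0 < e by rewrite lt_min ltr01 divr_gt0//; lra.
  have e1 : e <= 1 by rewrite ge_min lexx.
  have e2 : e <= dl / (s + 1) by rewrite ge_min lexx orbT.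
  apply: (near_ok x s e) => //.
  - by move=> z /andP[h1 /(lt_trans h1)]; rewrite ltxx.
  - by rewrite /s; lra.
  - rewrite subrr add0r; have : e * (s + 1) <= dl by rewrite -ler_pdivlMr//; lra.
    apply: le_trans; rewrite mulrC ler_wpM2l; lra.
have hsA : has_sup A by split; [exists t0|exists b => t [/andP[_ /ltW]]].
set y := sup A.
have t0y : t0 <= y by exact: (sup_ubound hsA.2).
have xy : x < y by lra.
have yb : y <= b by apply: ge_sup; [exists t0|move=> t [/andP[_ /ltW]]].
have ay : a < y by lra.
have Wxy : 0 < W y - W x by rewrite subr_gt0 Wlt.
have hW z : x < z < y -> h z * (W y - W x) <= dl.
  move=> /andP[xz zy]; apply/ler_addgt0Pr => e e0.
  have hz1 : 0 < h z + 1 by have := h0 z; lra.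
  have e1 : 0 < e / (h z + 1) by rewrite divr_gt0.
  have [d d0 Hd] := Wcts ay yb e1.
  have r0 : 0 < minr d (y - z) by rewrite lt_min d0 subr_gt0.
  have [t At ty] := sup_adherent r0 hsA.
  have tY : t <= y by exact: (sup_ubound hsA.2).
  have m1 : minr d (y - z) <= d by rewrite ge_min lexx.
  have m2 : minr d (y - z) <= y - z by rewrite ge_min lexx orbT.
  rewrite -/y in ty; have zt : z < t by lra.
  case: At => /andP[xt tb] [s [s0 hs sW]].
  have hzs : h z <= s by apply: hs; rewrite xz.
  have Wxt : 0 <= W t - W x by rewrite subr_ge0; apply/ltW/Wlt => //; exact: ltW.
  have hWt : h z * (W t - W x) <= dl by apply: le_trans sW; rewrite ler_wpM2r.
  have := Hd t; rewrite /= in_itv/= => H; have {}H : `|W t - W y| <= e / (h z + 1).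
    by apply: H; [apply/andP; split; lra|rewrite ler0_norm; lra].
  have : W y - W t <= e / (h z + 1) by move: H; rewrite ler_norml => /andP[H _]; lra.
  rewrite ler_pdivlMr// => H2.
  have W1 : 0 <= W y - W t by move: tY; rewrite le_eqVlt => /orP[/eqP ->|ty']; rewrite ?subrr// subr_ge0 ltW// Wlt//; lra.
  have E : h z * (W y - W x) = h z * (W t - W x) + h z * (W y - W t) by ring.
  rewrite E lerD//; apply: le_trans H2; rewrite mulrC ler_wpM2l//; lra.
exists y; split => //.
  (* The largest [s] compatible with the product bound; it dominates [h] by [hW]. *)
  exists (dl / (W y - W x)); split; first by rewrite divr_ge0 ?ltW.
    by move=> z zI; rewrite ler_pdivlMr// hW.
  by rewrite mulfVK// gt_eqF.
move=> ylb s hs; rewrite leNgt; apply/negP => slt.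
have xm : x < (x + y) / 2 < y by apply/andP; split; lra.
have s0 : 0 <= s by apply: le_trans (h0 _) (hs _ xm).
have hy : h y <= s.
  apply/ler_addgt0Pr => e e0; have ayb : a < y < b by rewrite ay.
  have [d d0 Hd] := hcts ayb e0.
  pose r := minr d (y - x); have r0 : 0 < r by rewrite lt_min d0 subr_gt0.
  have r1 : r <= d by rewrite ge_min lexx.
  have r2 : r <= y - x by rewrite ge_min lexx orbT.
  have := Hd (y - r / 2) I; rewrite addrAC subrr add0r normrN ger0_norm; last lra.
  move=> H; have {}H : `|h (y - r / 2) - h y| <= e by apply: H; lra.
  have := hs (y - r / 2); have -> : x < y - r / 2 < y by apply/andP; split; lra.
  by move=> /(_ isT); move: H; rewrite ler_norml => /andP[H _]; lra.
pose g := dl - s * (W y - W x); have g0 : 0 < g by rewrite subr_gt0.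
pose D := s + (W y - W x) + 1; have D0 : 0 < D by rewrite /D; lra.
pose e := minr 1 (g / D).
have e0 : 0 < e by rewrite lt_min ltr01 divr_gt0.
have e1 : e <= 1 by rewrite ge_min lexx.
have e2 : e * D <= g by rewrite -ler_pdivlMr// ge_min lexx orbT.
have [t yt At] : exists2 t, y < t & A t.
  apply: (near_ok y s e) => //; [lra|lra|].
  have -> : (s + e) * (W y - W x + e) = s * (W y - W x) + e * (s + (W y - W x) + e) by ring.
  have : e * (s + (W y - W x) + e) <= e * D by rewrite ler_wpM2l ?(ltW e0)// /D; lra.
  rewrite /g in e2; lra.
by have := sup_ubound hsA.2 At; rewrite -/y leNgt yt.
Qed.

Lemma greedy_seq c : a < c < b -> exists x : nat -> R, [/\ x 0%N = c,
  (forall k, x k <= b),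
  (forall k, x k < b -> [/\ x k < x k.+1, below W h dl (x k) (x k.+1) &
    (x k.+1 < b -> above W h dl (x k) (x k.+1))]),
  (forall z, z < b -> exists k, z < x k) &
  (forall k, x k.+1 < b -> x k < b)].
Proof.
move=> cab.
have /(@boolp.choice _ _ (fun x y => a < x < b -> [/\ x < y, y <= b, below W h dl x y &
  (y < b -> above W h dl x y)]))[nx nxP] : forall x, exists y, a < x < b ->
    [/\ x < y, y <= b, below W h dl x y & (y < b -> above W h dl x y)].
  by move=> x; have [/greedy_step[y yP]|n] := boolP (a < x < b); [exists y|exists x].
pose x := fix x k := if k is k'.+1 then (if x k' < b then nx (x k') else b) else c.
have xS k : x k.+1 = if x k < b then nx (x k) else b by [].
have xI k : a < x k <= b.
  elim: k => [|k IH]; first by case/andP: cab => /= -> /ltW.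
  rewrite xS; case: ifP => [xb|_]; last by rewrite lexx andbT; case/andP: cab; exact: lt_trans.
  have xk : a < x k < b by rewrite xb andbT; case/andP: IH.
  by have [/(lt_trans (proj1 (andP xk))) -> ->] := nxP _ xk.
have step k : x k < b -> [/\ x k < x k.+1, below W h dl (x k) (x k.+1) &
    (x k.+1 < b -> above W h dl (x k) (x k.+1))].
  move=> xb; have xk : a < x k < b by rewrite xb andbT; case/andP: (xI k).
  by rewrite xS xb; case: (nxP _ xk).
exists x; split => //; first by move=> k; case/andP: (xI k).
  2: by move=> k; rewrite xS; case: ifP => // _; rewrite ltxx.
move=> z zb; apply: contrapT => nz.
have xz k : x k <= z by rewrite leNgt; apply/negP => hz; apply: nz; exists k.
have xb k : x k < b by exact: le_lt_trans (xz k) zb.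
have cz : c <= z by exact: (xz 0%N).
have [M M0 HM] : exists2 M : R, 0 < M & forall t, c <= t <= z -> h t <= M.
  have hC : {within `[c, z], continuous h}.
    apply/ctsP => t; rewrite /= in_itv/= => /andP[ct tz]; apply: (@cts_sub _ _ setT) => //.
    by apply: hcts; case/andP: cab => ac _; rewrite (lt_le_trans ac ct) (le_lt_trans tz zb).
  have [t _ Ht] := EVT_max cz hC; exists (h t + 1); first by have := h0 t; lra.
  by move=> u ucz; have := Ht u; rewrite in_itv/= ucz => /(_ isT); lra.
have cx k : c <= x k.
  by elim: k => [|k IH]; [rewrite /= lexx|have [/ltW + _ _] := step k (xb k); exact: le_trans].
have grow k : W c + dl / M * k%:R <= W (x k).
  elim: k => [|k IH]; first by rewrite mulr0 addr0.
  have [_ _ ab] := step k (xb k).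
  have : dl <= M * (W (x k.+1) - W (x k)).
    apply: ab => // t /andP[t1 t2]; apply: HM.
    by rewrite (le_trans (cx k) (ltW t1)) (le_trans (ltW t2) (xz _)).
  rewrite mulrC -ler_pdivrMr// -natr1 mulrDr mulr1; lra.
have dM : 0 < dl / M by rewrite divr_gt0.
have WcB k : W (x k) <= W b.
  by rewrite ltW// Wlt//; case/andP: (xI k).
pose k := Num.bound ((W b - W c) / (dl / M)).
have WcB0 : 0 <= (W b - W c) / (dl / M).
  by rewrite divr_ge0 ?(ltW dM)// subr_ge0 (WcB 0%N).
have := archi_boundP WcB0; rewrite -/k ltr_pdivrMr// mulrC => hk.
have := grow k; have := WcB k; lra.
Qed.

End Forward.
End Greedy.

(** The upper end is the least natural number outside [J], or infinity if there is none; the lower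
    end is found likewise among the negatives. *)
Lemma Zinterval_convex (J : set int) : J 0 ->
  (forall i j k, J i -> J j -> i <= k -> k <= j -> J k) -> Zinterval J.
Proof.
move=> J0 Jc.
have up : exists m : \bar int, forall k, 0 <= k -> J k <-> (k%:E < m)%E.
  have [h|h] := pselect (exists n : nat, ~ J n%:Z); last first.
    exists +oo%E => k k0; rewrite ltry; split => // _.
    by apply: contrapT => nJ; apply: h; exists `|k|%N; rewrite gez0_abs.
  have ex : exists n : nat, `[< ~ J n%:Z >] by case: h => n nJ; exists n; exact/asboolP.
  exists (ex_minn ex)%:Z%:E => k k0; case: ex_minnP => m /asboolP nJ mmin.
  rewrite lte_fin; split => [Jk|km].
    by rewrite ltNge; apply/negP => mk; apply: nJ; apply: (Jc 0 k).
  apply: contrapT => nJk; have /mmin : `[< ~ J `|k|%N%:Z >] by apply/asboolP; rewrite gez0_abs.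
  by move: km k0; lia.
have dn : exists l : \bar int, forall k, k <= 0 -> J k <-> (l < k%:E)%E.
  have [h|h] := pselect (exists n : nat, ~ J (- n%:Z)); last first.
    exists -oo%E => k k0; rewrite ltNyr; split => // _.
    apply: contrapT => nJ; apply: h; exists `|k|%N.
    by have -> : - `|k|%N%:Z = k by lia.
  have ex : exists n : nat, `[< ~ J (- n%:Z) >] by case: h => n nJ; exists n; exact/asboolP.
  exists (- (ex_minn ex)%:Z)%:E => k k0; case: ex_minnP => m /asboolP nJ mmin.
  rewrite lte_fin; split => [Jk|km].
    by rewrite ltNge; apply/negP => mk; apply: nJ; apply: (Jc k 0) => //; lia.
  apply: contrapT => nJk; have /mmin : `[< ~ J (- `|k|%N%:Z) >].
    by apply/asboolP; have -> : - `|k|%N%:Z = k by lia.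
  by move: km k0; lia.
case: up dn => m mP [l lP]; exists l, m; apply/seteqP; split => k /=.
  have l0 : (l < 0%:E)%E by apply/(lP 0).
  have m0 : (0%:E < m)%E by apply/(mP 0).
  move=> Jk; have [k0|/ltW k0] := leP 0 k.
    by split; [apply: lt_le_trans l0 _; rewrite lee_fin|apply/mP].
  by split; [apply/lP|apply: le_lt_trans m0; rewrite lee_fin].
by move=> [lk km]; have [k0|/ltW k0] := leP 0 k; [apply/mP|apply/lP].
Qed.

Section ItvPartition.
Context {R : realType}.
Variables (W h : R -> R) (a b dl : R).
Hypothesis dl0 : 0 < dl.
Hypothesis Wlt : forall x y, a <= x -> x < y -> y <= b -> W x < W y.
Hypothesis Wcts : forall x, a <= x <= b -> cts `[a, b] W x.
Hypothesis hcts : forall x, a < x < b -> cts setT h x.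
Hypothesis h0 : forall x, 0 <= h x.

Lemma below_opp p q : below (fun t => - W (- t)) (fun t => h (- t)) dl p q ->
  below W h dl (- q) (- p).
Proof.
move=> [s [s0 hs sW]]; exists s; split => //; last by move: sW; rewrite opprK addrC.
move=> z zI; have := hs (- z); rewrite opprK; apply.
by move: zI => /andP[? ?]; apply/andP; split; lra.
Qed.

Lemma above_opp p q : above (fun t => - W (- t)) (fun t => h (- t)) dl p q ->
  above W h dl (- q) (- p).
Proof.
move=> H s hs; have := H s; rewrite opprK addrC; apply=> z zI; apply: hs.
by move: zI => /andP[? ?]; apply/andP; split; lra.
Qed.

Lemma greedy_left c : a < c < b -> exists x : nat -> R, [/\ x 0%N = c,
  (forall k, a <= x k),
  (forall k, a < x k -> [/\ x k.+1 < x k, below W h dl (x k.+1) (x k) &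
    (a < x k.+1 -> above W h dl (x k.+1) (x k))]),
  (forall z, a < z -> exists k, x k < z) &
  (forall k, a < x k.+1 -> a < x k)].
Proof.
move=> /andP[ac cb]; have cab : - b < - c < - a by rewrite !ltrN2 cb.
have [| | | |x [x0 xb xs xz xd]] := @greedy_seq R (fun t => - W (- t)) (fun t => h (- t)) (- b) (- a) dl dl0 _ _ _ _ (- c) cab.
- by move=> s t bs st ta; rewrite ltrN2; apply: Wlt; rewrite ?ltrN2//; lra.
- move=> t bt ta e e0; have tI : a <= - t <= b by apply/andP; split; lra.
  have [d d0 Hd] := Wcts tI e0; exists d => // y; rewrite /= in_itv/= => /andP[y1 y2] yt.
  have -> : - W (- y) - - W (- t) = - (W (- y) - W (- t)) by ring.
  rewrite normrN; apply: Hd; last by have -> : - y - - t = - (y - t) by [ring]; rewrite normrN.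
  by rewrite /= in_itv/=; apply/andP; split; lra.
- move=> t tI e e0; have tI' : a < - t < b by move: tI => /andP[? ?]; apply/andP; split; lra.
  have [d d0 Hd] := hcts tI' e0; exists d => // y _ yt; apply: Hd => //.
  by have -> : - y - - t = - (y - t) by [ring]; rewrite normrN.
- by move=> t; exact: h0.
exists (fun k => - x k); split.
- by rewrite x0 opprK.
- by move=> k; have := xb k; lra.
- move=> k ak; have xk : x k < - a by lra.
  have [h1 h2 h3] := xs k xk; split; [by rewrite ltrN2|exact: below_opp|].
  by move=> ak1; apply: above_opp; apply: h3; lra.
  by move=> z az; have za : - z < - a by [lra]; have [k zk] := xz _ za; exists k; lra.
by move=> k h1; have := xd k; lra.
Qed.

Lemma greedy_partition : a < b -> exists P : set (R * R), gen_partition_itv a b P /\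
  forall I, P I -> [/\ a <= I.1, I.1 < I.2, I.2 <= b, below W h dl I.1 I.2 &
    (a < I.1 -> I.2 < b -> above W h dl I.1 I.2)].
Proof.
move=> ab; pose c := (a + b) / 2.
have cab : a < c < b by rewrite /c; apply/andP; split; lra.
have [| |x [x0 xb xs xz xd]] := @greedy_seq R W h a b dl dl0 _ _ hcts h0 c cab.
- by move=> s t sa st tb; apply: Wlt => //; exact: ltW.
- move=> t at_ tb; apply: (@cts_sub _ _ `[a, b]); last by apply: Wcts; rewrite tb ltW.
  by move=> y; rewrite /= !in_itv/= => /andP[/ltW -> ->].
have [y [y0 ya ys yz yd]] := greedy_left cab.
(* Both sequences start at [c], and [Negz n] is [-(n + 1)], hence the index [n.+1]. An index is in
   [J] as long as the point before it, counted from the middle, is inside []a, b[]; so an end that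
   is reached is listed exactly once. *)
pose X (k : int) : R := match k with Posz n => x n | Negz n => y n.+1 end.
pose J := [set k : int | match k with Posz n => (n = 0)%N \/ x n.-1 < b | Negz n => a < y n end].
have J0 : J 0 by left.
have JposS n : J n.+1%:Z -> J n%:Z.
  by move=> [//|h1]; case: n h1 => [_|n /xd h1]; [left|right].
have JnegS n : J (Negz n.+1) -> J (Negz n) by exact: yd.
have Jpos n m : (m <= n)%N -> J n%:Z -> J m%:Z.
  move=> /subnK <-; elim: (n - m)%N => [//|d IH]; rewrite addSn => /JposS; exact: IH.
have Jneg n m : (m <= n)%N -> J (Negz n) -> J (Negz m).
  move=> /subnK <-; elim: (n - m)%N => [//|d IH]; rewrite addSn => /JnegS; exact: IH.
have Jconv i j k : J i -> J j -> i <= k -> k <= j -> J k.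
  move=> Ji Jj ik kj; case: k ik kj => k ik kj.
    case: j Jj kj => j Jj kj; last by move: kj; lia.
    by apply: (Jpos j) => //; lia.
  case: i Ji ik => i Ji ik; first by move: ik; lia.
  by apply: (Jneg i) => //; lia.
have step k : J k -> J (k + 1) -> [/\ X k < X (k + 1), below W h dl (X k) (X (k + 1)) &
    (a < X k -> X (k + 1) < b -> above W h dl (X k) (X (k + 1)))].
  case: k => [n|[|n]].
  - have -> : n%:Z + 1 = n.+1 by lia.
    by move=> _ [//|/= /xs[h1 h2 h3]]; split => // _; exact: h3.
  - have -> : Negz 0 + 1 = 0 by lia.
    move=> /= ay0 _; have [h1 h2 h3] := ys 0%N ay0; rewrite y0 -x0 in h1 h2 h3.
    by split => // /h3 h4 _; exact: h4.
  - have -> : Negz n.+1 + 1 = Negz n by lia.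
    move=> /= ayn _; have [h1 h2 h3] := ys _ ayn.
    by split => // /h3 h4 _; exact: h4.
have Xlt i j : J i -> J j -> i < j -> X i < X j.
  move=> Ji Jj ij; have [n jE] : exists n : nat, j = i + n.+1%:Z by exists (`|j - i|%N).-1; lia.
  elim: n j jE Jj {ij} => [|n IH] j jE Jj.
    by rewrite jE in Jj *; case: (step i Ji Jj).
  have jE' : j = i + n.+1%:Z + 1 by lia.
  have Jn : J (i + n.+1%:Z) by apply: (Jconv i j) => //; lia.
  apply: lt_trans (IH _ erefl Jn) _; rewrite jE' in Jj *; by case: (step _ Jn Jj).
have Xge k : J k -> a <= X k.
  case: k => [n|n] Jn; last by exact: ya.
  have ac : a < c by case/andP: cab.
  case: n Jn => [_|n Jn]; first by rewrite /= x0 ltW.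
  by apply/ltW; apply: lt_trans (Xlt 0 n.+1%:Z J0 Jn _); rewrite //= x0.
have Xle k : J k -> X k <= b.
  case: k => [n|n] Jn; first exact: xb.
  have cb : c < b by case/andP: cab.
  by apply/ltW; apply: lt_trans (Xlt (Negz n) 0 Jn J0 _) _; rewrite //= x0.
exists [set (X k, X (k + 1)) | k in [set k | J k /\ J (k + 1)]]; split; last first.
  move=> _ [k [Jk Jk1] <-] /=; have [h1 h2 h3] := step k Jk Jk1.
  by split => //; [exact: Xge|exact: Xle].
exists J, X; split => //.
- exact: Zinterval_convex.
- apply/eqP; rewrite eq_le; apply/andP; split; last first.
    by apply: le_ereal_inf_tmp => _ [k Jk <-]; rewrite lee_fin Xge.
  apply/lee_addgt0Pr => e e0; have ae : a < a + e by rewrite ltrDl.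
  have [n yn] := yz _ ae.
  have [k Jk Xk] : exists2 k, J k & X k < a + e.
    elim: n yn => [|n IH] yn; first by exists 0 => //; rewrite /= x0 -y0.
    have [an|na] := ltP a (y n); first by exists (Negz n).
    by apply: IH; exact: le_lt_trans ae.
  by apply: le_trans (ereal_inf_lbound _) _; [exists k; [exact: Jk|reflexivity]|rewrite lee_fin ltW].
- apply/eqP; rewrite eq_le; apply/andP; split.
    by apply: ge_ereal_sup => _ [k Jk <-]; rewrite lee_fin Xle.
  apply/lee_addgt0Pr => e e0; have be : b - e < b by rewrite ltrBlDr ltrDl.
  have [n xn] := xz _ be.
  have [k Jk Xk] : exists2 k, J k & b - e < X k.
    elim: n xn => [|n IH] xn; first by exists 0.
    have [nb|bn] := ltP (x n) b; first by exists n.+1%:Z => //; right.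
    by apply: IH; exact: lt_le_trans bn.
  apply: (@le_trans _ _ ((X k)%:E + e%:E)%E); first by rewrite -EFinD lee_fin; lra.
  by rewrite leeD2r//; apply: ereal_sup_ubound; exists k.
Qed.

End ItvPartition.

Lemma itv_oo_inj (R : realType) (a b c d : R) : a < b ->
  `]a, b[%classic = `]c, d[%classic -> a = c /\ b = d.
Proof.
move=> ab E.
have H x : (a < x < b) = (c < x < d).
  by have := congr1 (fun A : set R => A x) E; rewrite /= !in_itv/= => h; apply/idP/idP; rewrite h.
have mab : a < (a + b) / 2 < b by apply/andP; split; lra.
have /andP[m1 m2] := mab; move: (mab); rewrite H => /andP[m3 m4].
split; apply/eqP; rewrite eq_le; apply/andP; split; rewrite leNgt; apply/negP => h.
- by have := H ((c + minr a ((a + b) / 2)) / 2); rewrite (min_idPl (ltW m1)) => h1;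
   have : c < (c + a) / 2 < d; [apply/andP; split; lra|rewrite -h1 => /andP[h2 _]; lra].
- by have : a < (a + c) / 2 < b; [apply/andP; split; lra|rewrite H => /andP[h2 _]; lra].
- by have : a < (b + d) / 2 < b; [apply/andP; split; lra|rewrite H => /andP[_ h2]; lra].
- by have : c < (b + d) / 2 < d; [apply/andP; split; lra|rewrite -H => /andP[_ h2]; lra].
Qed.

(** * Existence of partitions with prescribed curvature bounds *)

Section PartitionExists.
Context {R : realType} {X : normedModType R} {N : X -> R}.
Hypothesis HN : equivalent_norm N.
Variable f : R -> X.
Hypothesis fbv : BV01 N f.
Hypothesis fcts : forall x, 0 <= x <= 1 -> cts `[0, 1] f x.

Local Notation v := (vfun N f).
Local Notation F := (arclength_map N f).
Local Notation G := (`[0%R, 1%R]%classic `\` Dset N f : set R).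
Local Notation F2 := (derive1n 2 F).

Let good (ab : R * R) := exists x, G x /\ connected_component G x = Ioo ab.

(** An end belonging to [G] could be added to the component, giving a larger connected subset of
    [G]. *)
Lemma component_bounds ab : good ab -> [/\ ab.1 < ab.2, Ioo ab `<=` G, ~ G ab.1 & ~ G ab.2].
Proof.
move=> [x [Gx E]].
have Cx : Ioo ab x by rewrite -E; exact: connected_component_refl.
have CG : Ioo ab `<=` G by rewrite -E; exact: connected_component_sub.
move: (Cx); rewrite /Ioo /= in_itv/= => /andP[ax xb].
split => //; first exact: lt_trans xb.
  move=> Ga; pose B := [set z : R | ab.1 <= z <= x].
  have : B `<=` Ioo ab.
    rewrite -E; apply: connected_component_max.
    - by rewrite /B/= lexx ltW.
    - move=> z /andP[]; rewrite le_eqVlt => /orP[/eqP <- //|az zx].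
      by apply: CG; rewrite /Ioo/= in_itv/= az (le_lt_trans zx).
    - apply/connected_intervalP => s t /andP[? ?] /andP[? ?] w /andP[? ?].
      by apply/andP; split; lra.
  move=> /(_ ab.1); rewrite /B/= lexx ltW// /Ioo/= in_itv/= ltxx/= => h.
  by have := h isT.
move=> Gb; pose B := [set z : R | x <= z <= ab.2].
have : B `<=` Ioo ab.
  rewrite -E; apply: connected_component_max.
  - by rewrite /B/= lexx ltW.
  - move=> z /andP[xz]; rewrite le_eqVlt => /orP[/eqP -> //|zb].
    by apply: CG; rewrite /Ioo/= in_itv/= zb (lt_le_trans ax).
  - apply/connected_intervalP => s t /andP[? ?] /andP[? ?] w /andP[? ?].
    by apply/andP; split; lra.
move=> /(_ ab.2); rewrite /B/= lexx andbT ltW// /Ioo/= in_itv/= ltxx andbF => h.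
by have := h isT.
Qed.

Lemma N_cts (A : set R) (g : R -> X) x : cts A g x -> cts A (fun y => N (g y)) x.
Proof.
have [c [C [c0 C0 HC]]] := eqn_bounds HN => H e e0.
have eC : 0 < e / C by rewrite divr_gt0.
have [d d0 Hd] := H _ eC; exists d => // y Ay yx.
apply: le_trans (eqn_lip HN _ _) _; have [_ h] := HC (g y - g x); apply: (le_trans h).
by rewrite mulrC -ler_pdivlMr//; exact: Hd.
Qed.

(** Each component is partitioned greedily with [W = v] and [h = N (F2 o v)], whose supremum over an
    interval is [Ssup]. An interval contained in [G] together with its endpoints reaches neither end
    of its component, as those ends are not in [G]; so [above] applies to it. *)
Lemma fdK_partition_exists (dl : R) : 0 < dl -> exists P, fdK_partition N f dl dl%:E G P.
Proof.
move=> dl0.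
pose h z : R := N (F2 (v z)).
pose Q ab (P : set (R * R)) := gen_partition_itv ab.1 ab.2 P /\
  forall I, P I -> [/\ ab.1 <= I.1, I.1 < I.2, I.2 <= ab.2, below v h dl I.1 I.2 &
    (ab.1 < I.1 -> I.2 < ab.2 -> above v h dl I.1 I.2)].
have /boolp.choice[Pf PfP] : forall ab : R * R, exists P : set (R * R), good ab -> Q ab P.
  move=> ab; have [gab|ng] := pselect (good ab); last by exists set0.
  have [ablt abG _ _] := component_bounds gab.
  have [a0 b1] := G_interval HN fbv fcts ablt abG.
  have wc x : ab.1 <= x <= ab.2 -> cts `[ab.1, ab.2] v x.
    move=> /andP[ax xb]; apply: (@cts_sub _ _ `[0, 1]).
      by move=> z; rewrite /= !in_itv/= => /andP[az zb]; rewrite (le_trans a0 az) (le_trans zb b1).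
    by apply: (v_cts HN fbv fcts); rewrite (le_trans a0 ax) (le_trans xb b1).
  have hc x : ab.1 < x < ab.2 -> cts setT h x.
    move=> xI; have Gx : G x by apply: abG; rewrite /Ioo/= in_itv.
    have vc : cts setT v x.
      have x01 := G_01 HN fbv fcts Gx; apply: (cts_interior x01).
      by apply: (v_cts HN fbv fcts); case/andP: x01 => /ltW -> /ltW.
    apply: N_cts; apply: (@cts_comp _ _ setT setT v F2) => //.
    by have [] : [/\ der setT F (v x) (F^`()%classic (v x)),
       der setT F^`()%classic (v x) (F2 (v x)), cts setT F2 (v x) & N (F^`()%classic (v x)) = 1]
      by apply: (vG_regular HN fbv fcts); exists x.
  have [P PP] := @greedy_partition R v h ab.1 ab.2 dl dl0
    (v_strict_G HN fbv fcts ablt abG) wc hc (fun x => eqn_ge0 HN _) ablt.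
  by exists P.
pose P := [set I | exists2 ab, good ab & Pf ab I].
have PI I : P I -> exists ab, [/\ good ab, Pf ab I, I.1 < I.2, Ioo I `<=` Ioo ab & Ioo I `<=` G].
  move=> [ab gab PI]; exists ab; have [_ /(_ I PI)[h1 h2 h3 _ _]] := PfP ab gab.
  have sub : Ioo I `<=` Ioo ab.
    by move=> z; rewrite /Ioo/= !in_itv/= => /andP[z1 z2]; rewrite (le_lt_trans h1) ?(lt_le_trans z2).
  by split => //; have [_ hG _ _] := component_bounds gab => z /sub /hG.
exists P; split.
- split.
  + by move=> I /PI[ab []].
  + by move=> z [I /PI[ab [_ _ _ _ sub]] /sub].
  move=> a b x Gx E; have gab : good (a, b) by exists x.
  have [ablt _ _ _] := component_bounds gab.
  have [+ H] := PfP _ gab.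
  suff -> : [set I | P I /\ Ioo I `<=` `]a, b[%classic] = Pf (a, b) by [].
  apply/seteqP; split => I /=; last first.
    move=> PfI; split; first by exists (a, b).
    have [h1 h2 h3 _ _] := H I PfI.
    by move=> z; rewrite /Ioo/= !in_itv/= => /andP[z1 z2]; rewrite (le_lt_trans h1) ?(lt_le_trans z2).
  move=> [/PI[[a' b'] [gab' PfI I12 sub subG]] sub'].
  pose y := (I.1 + I.2) / 2; have Iy : Ioo I y by rewrite /Ioo/= in_itv/= /y; apply/andP; split; lra.
  have E1 : connected_component G y = `]a, b[%classic.
    by rewrite -E; apply/esym/same_connected_component; rewrite E; exact: sub'.
  have E2 : connected_component G y = `]a', b'[%classic.
    case: gab' => x' [_ E']; rewrite -[RHS]E'; apply/esym/same_connected_component; rewrite E'; exact: sub.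
  by have [-> ->] := @itv_oo_inj R a b a' b' ablt (etrans (esym E1) E2).
- move=> I /PI[ab [gab PfI I12 sub IG]].
  have [_ /(_ I PfI)[_ _ _ [s [s0 hs sW]] _]] := PfP ab gab.
  have [VE Vlt] := Var_G HN fbv fcts I12 IG.
  have Ss : (Ssup N f I <= s%:E)%E by apply: Ssup_le.
  split; first exact: le_lt_trans Ss (ltry _).
  rewrite VE; apply: (@le_trans _ _ (s%:E * (v I.2 - v I.1)%:E)%E).
    by rewrite lee_wpmul2r// lee_fin subr_ge0 ltW.
  by rewrite -EFinM lee_fin.
move=> I /PI[ab [gab PfI I12 sub IG]] IccG.
have [_ /(_ I PfI)[h1 h2 h3 [s [s0 hs sW]] ab']] := PfP ab gab.
have [_ _ nGa nGb] := component_bounds gab.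
have [VE Vlt] := Var_G HN fbv fcts I12 IG.
have Ss : (Ssup N f I <= s%:E)%E by apply: Ssup_le.
have S0 := Ssup_ge0 HN f I12.
have fin : Ssup N f I \is a fin_num by rewrite ge0_fin_numE// (le_lt_trans Ss)// ltry.
rewrite VE -(fineK fin) -EFinM lee_fin; apply: ab'.
- rewrite lt_neqAle h1 andbT; apply/eqP => E; apply: nGa; rewrite E; apply: IccG.
  by rewrite /Icc/= in_itv/= lexx ltW.
- rewrite lt_neqAle h3 andbT; apply/eqP => E; apply: nGb; rewrite -E; apply: IccG.
  by rewrite /Icc/= in_itv/= lexx ltW.
by move=> z zI; rewrite -lee_fin fineK//; exact: Ssup_ge.
Qed.

End PartitionExists.

(** * Smooth reparametrizations *)

Section NormDerivative.
Context {R : realType} {X : normedModType R} {N : X -> R}.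
Hypothesis HN : equivalent_norm N.
Hypothesis Nsm : frechet_smooth N.

Let dN (u w : X) : R := 'D_w N u.

Lemma dN_der u w : u != 0 -> der setT (fun s => N (u + s *: w)) 0 (dN u w).
Proof.
move=> u0; apply/derP; have /(diff_derivable (v := w)) h := Nsm u0.
apply: (@cvg_trans _ ((fun y : R => (y - 0)^-1 *: (N (u + y *: w) - N (u + 0 *: w))) @ 0^')).
  by apply: cvg_app; exact: cvg_within.
rewrite (_ : (fun y => _) = (fun s : R => s^-1 *: ((N \o shift u) (s *: w) - N u))).
  exact: h.
by apply/funext => s; rewrite /= scale0r addr0 subr0 (addrC u).
Qed.

Lemma N_convex u w s t : 0 < s -> s <= t -> N (u + s *: w) - N u <= s / t * (N (u + t *: w) - N u).
Proof.
move=> s0 st; have t0 := lt_le_trans s0 st.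
have E : u + s *: w = (1 - s / t) *: u + (s / t) *: (u + t *: w).
  by rewrite scalerDr addrA scalerA -mulrA mulVf ?gt_eqF// mulr1 -scalerDl subrK scale1r.
have r0 : 0 <= s / t by rewrite divr_ge0// ltW.
have r1 : 0 <= 1 - s / t by rewrite subr_ge0 ler_pdivrMr// mul1r.
have := eqnD HN ((1 - s / t) *: u) ((s / t) *: (u + t *: w)).
by rewrite -E !(eqnZ HN) (ger0_norm r0) (ger0_norm r1); lra.
Qed.

(** By [N_convex] the difference quotient over [t] is at least the one over any smaller [s], and the
    latter approaches [dN u w]. *)
Lemma dN_le u w t : u != 0 -> 0 < t -> t * dN u w <= N (u + t *: w) - N u.
Proof.
move=> u0 t0; apply/ler_addgt0Pr => e e0.
have [d d0 h] := dN_der w u0 (divr_gt0 e0 t0).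
pose s := minr (d / 2) t.
have s0 : 0 < s by rewrite /s lt_min t0 divr_gt0.
have st : s <= t by rewrite /s ge_min lexx orbT.
have sd : s < d by rewrite /s gt_min; apply/orP; left; lra.
have := h s I; rewrite subr0 gtr0_norm// => /(_ sd); rewrite scale0r addr0 => h1.
have := N_convex u w s0 st => h2.
have h3 : s * dN u w <= s / t * (N (u + t *: w) - N u) + e / t * s.
  have := ler_norm (- (N (u + s *: w) - N u - s *: dN u w)).
  by rewrite normrN => /le_trans/(_ h1); rewrite /GRing.scale/= => h3; lra.
rewrite -(ler_pM2l (divr_gt0 s0 t0)).
have -> : s / t * (t * dN u w) = s * dN u w by field; rewrite gt_eqF.
by apply: (le_trans h3); rewrite (mulrDr _ (_ - _) e) (_ : s / t * e = e / t * s)//; ring.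
Qed.

Lemma dN_ge u w t : u != 0 -> 0 < t -> N u - N (u - t *: w) <= t * dN u w.
Proof.
move=> u0 t0; apply/ler_addgt0Pr => e e0.
have [d d0 h] := dN_der w u0 (divr_gt0 e0 t0).
pose s := minr (d / 2) t.
have s0 : 0 < s by rewrite /s lt_min t0 divr_gt0.
have st : s <= t by rewrite /s ge_min lexx orbT.
have sd : s < d by rewrite /s gt_min; apply/orP; left; lra.
have := h (- s) I; rewrite subr0 normrN gtr0_norm// => /(_ sd); rewrite scale0r addr0 => h1.
have := N_convex u (- w) s0 st; rewrite !scalerN => h2.
have h3 : - (s * dN u w) <= s / t * (N (u - t *: w) - N u) + e / t * s.
  have := ler_norm (- (N (u + (- s) *: w) - N u - (- s) *: dN u w)).
  by rewrite normrN => /le_trans/(_ h1); rewrite scaleNr /GRing.scale/= => h3; lra.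
rewrite -(ler_pM2l (divr_gt0 s0 t0)).
have E : s / t * (t * dN u w) = s * dN u w by field; rewrite gt_eqF.
have -> : s / t * (t * dN u w + e) = s * dN u w + e / t * s by rewrite mulrDr E; ring.
by move: h3; rewrite -(opprB (N u)) mulrN; lra.
Qed.

Lemma dN_bound u w : u != 0 -> `|dN u w| <= N w.
Proof.
move=> u0; have := dN_le w u0 ltr01; have := dN_ge w u0 ltr01.
rewrite !mul1r scale1r => h1 h2; rewrite ler_norml.
have := eqn_lip HN (u + w) u; rewrite {2}(addrC u w) addrK ler_norml => /andP[_ h3].
have := eqn_lip HN (u - w) u; rewrite {2}(addrC u (- w)) addrK (eqnN HN) ler_norml => /andP[_ h4].
by lra.
Qed.

(** Replacing [k y] by [k x + (y - x) *: w] costs little because [N] is Lipschitz; what remains is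
    the derivative of [N] along a line. *)
Lemma der_N (A : set R) k x w : k x != 0 -> der A k x w ->
  der A (fun y => N (k y)) x (dN (k x) w).
Proof.
have [c [C [c0 C0 HC]]] := eqn_bounds HN => k0 H e e0.
have eC : 0 < e / 2 / C by rewrite !divr_gt0.
have e2 : 0 < e / 2 by rewrite divr_gt0.
have [d d0 Hd] := H _ eC; have [d' d'0 Hd'] := dN_der w k0 e2.
exists (minr d d'); first by rewrite lt_min d0.
move=> y Ay; rewrite lt_min => /andP[yd yd'].
have := Hd' (y - x) I; rewrite subr0 scale0r addr0 => /(_ yd') h1.
have h2 := Hd y Ay yd.
have h3 : `|N (k y) - N (k x + (y - x) *: w)| <= e / 2 * `|y - x|.
  apply: le_trans (eqn_lip HN _ _) _; rewrite opprD addrA.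
  have [_ h] := HC (k y - k x - (y - x) *: w); apply: (le_trans h).
  rewrite -ler_pdivlMl//; apply: (le_trans h2).
  by have -> : e / 2 / C * `|y - x| = C^-1 * (e / 2 * `|y - x|) by ring.
have -> : N (k y) - N (k x) - (y - x) *: dN (k x) w =
  (N (k y) - N (k x + (y - x) *: w)) + (N (k x + (y - x) *: w) - N (k x) - (y - x) *: dN (k x) w).
  by rewrite addrA addrA subrK.
apply: le_trans (ler_normD _ _) _; rewrite (splitr e) mulrDl.
exact: lerD.
Qed.

(* By convexity [t * dN u w] lies between [N u - N (u - t w)] and
   [N (u + t w) - N u], which gives joint continuity of [dN] from mere
   Frechet differentiability. *)
Lemma cts_dN (A : set R) k w x : (forall y, A y -> k y != 0) -> A x -> cts A k x -> cts A w x ->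
  cts A (fun y => dN (k y) (w y)) x.
Proof.
have [c [C [c0 C0 HC]]] := eqn_bounds HN => k0 Ax Hk Hw e e0.
have e2 : 0 < e / 2 by rewrite divr_gt0.
have [d d0 Hd] := dN_der (w x) (k0 x Ax) e2.
pose t := d / 2; have t0 : 0 < t by rewrite divr_gt0.
have td : t < d by rewrite /t; lra.
have := Hd t I; have := Hd (- t) I; rewrite !subr0 normrN gtr0_norm// scale0r addr0.
move=> /(_ td) + /(_ td); rewrite !scaleNr -[t *: dN _ _]/(t * dN _ _) !ler_norml.
move=> /andP[_ h1] /andP[_ h2].
(* Moving [k x] and [w x] changes [N (k x)] by at most [r] and [N (k x + t *: w x)] by at most
   [r + t * r]; the total [r * (2 + t)] is meant to be [e / 2 * t]. *)
have eta0 : 0 < e / 2 * t / (2 + t) / C by rewrite !divr_gt0// ?mulr_gt0// ?addr_gt0.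
have [d1 d10 Hd1] := Hk _ eta0; have [d2 d20 Hd2] := Hw _ eta0.
exists (minr d1 d2); first by rewrite lt_min d10.
move=> y Ay; rewrite lt_min => /andP[y1 y2].
have NC u r : `|u| <= r / C -> N u <= r.
  by rewrite ler_pdivlMr// mulrC => /(le_trans (HC u).2).
have a1 := NC _ _ (Hd1 y Ay y1); have a2 := NC _ _ (Hd2 y Ay y2).
move: a1 a2; set r := e / 2 * t / (2 + t) => a1 a2.
have rE : r * (2 + t) = e / 2 * t by rewrite /r divfK// gt_eqF// addr_gt0.
have b1 := dN_le (w y) (k0 y Ay) t0; have b2 := dN_ge (w y) (k0 y Ay) t0.
have c1 : `|N (k y) - N (k x)| <= r by exact: le_trans (eqn_lip HN _ _) a1.
have c2 (s : R) : `|s| = t -> `|N (k y + s *: w y) - N (k x + s *: w x)| <= r + t * r.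
  move=> st; apply: le_trans (eqn_lip HN _ _) _.
  have -> : k y + s *: w y - (k x + s *: w x) = (k y - k x) + s *: (w y - w x).
    by rewrite scalerBr opprD addrACA.
  apply: le_trans (eqnD HN _ _) _; rewrite lerD// (eqnZ HN) st.
  by apply: ler_wpM2l => //; exact: ltW.
have := c2 t (gtr0_norm t0); have := c2 (- t); rewrite normrN gtr0_norm// => /(_ erefl).
rewrite !scaleNr; move: c1; rewrite !ler_norml => /andP[p1 p2] /andP[p3 p4] /andP[p5 p6].
clear Hd Hd1 Hd2 c2 NC Hk Hw HC; clearbody t r.
move: (dN (k y) (w y)) (dN (k x) (w x)) b1 b2 h1 h2 => p q b1 b2 h1 h2.
have tp : t * (p - q) <= t * e by rewrite mulrBr; lra.
have tq : t * (- e) <= t * (p - q) by rewrite mulrBr mulrN; lra.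
by apply/andP; split; [rewrite -(ler_pM2l t0)|rewrite -(ler_pM2l t0)].
Qed.

End NormDerivative.

(** * Arc length of a C^2 curve away from its critical points *)

Section SmoothReparametrization.
Context {R : realType} {X : normedModType R} {N : X -> R}.
Hypothesis HN : equivalent_norm N.
Hypothesis Nsm : frechet_smooth N.
Variable f : R -> X.
Hypothesis fbv : BV01 N f.
Hypothesis fcts : forall x, 0 <= x <= 1 -> cts `[0, 1] f x.
Variables (h hi : R -> R) (g1 g2 : R -> X).
Hypothesis H : homeo_pair 0 1 0 1 h hi.
Hypothesis D1 : forall x : R, 0 <= x <= 1 -> der `[0, 1] (f \o h) x (g1 x).
Hypothesis D2 : forall x : R, 0 <= x <= 1 -> der `[0, 1] g1 x (g2 x).
Hypothesis C2 : forall x : R, 0 <= x <= 1 -> cts `[0, 1] g2 x.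

Local Notation v := (vfun N f).
Local Notation F := (arclength_map N f).
Local Notation G := (`[0%R, 1%R]%classic `\` Dset N f : set R).
Local Notation F2 := (derive1n 2 F).
Local Notation g := (f \o h).
Local Notation sigma := (fun x => v (h x)).

Lemma h01 (x : R) : 0 <= x <= 1 -> 0 <= h x <= 1. Proof. by case: H => hP _ _ _ _ /hP[]. Qed.

Lemma sigma_der (x : R) : 0 <= x <= 1 -> der `[0, 1] sigma x (N (g1 x)).
Proof.
move=> x01; have [h0 h1 _ _ _] := homeo_pair_ends ler01 H.
have gbv : (Var N g `[0%R, 1%R] < +oo)%E.
  by rewrite (Var_homeo HN f H)// h0 h1.
have C1 t : 0 <= t <= 1 -> cts `[0, 1] g1 t by move=> /D2/der_cts.
have E y : 0 <= y <= 1 -> v (h y) = @variation R X N g 0 y.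
  move=> /andP[y0 y1]; rewrite /variation (Var_homeo HN f H)// h0.
  by [].
have Hv := vv_der HN gbv ler01 D1 C1 x01.
apply: (der_loc ltr01 _ _ Hv); last exact: E.
by move=> y yI _; split => //; apply: E; move: yI; rewrite /= in_itv.
Qed.

Lemma sigma_le (x y : R) : 0 <= x -> x <= y -> y <= 1 -> sigma x <= sigma y.
Proof.
move=> x0 xy y1; have := h01 (x := x); have := h01 (x := y).
rewrite x0 (le_trans x0 xy) y1 (le_trans xy y1) => /(_ erefl)/andP[_ hy] /(_ erefl)/andP[hx _].
apply: (v_le HN fbv) => //; exact: (homeo_pair_le H).
Qed.

Variables (a b : R).
Hypotheses (a0 : 0 <= a) (ab : a < b) (b1 : b <= 1).
Hypothesis g1_neq0 : forall x : R, a <= x <= b -> g1 x != 0.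

Let ab01 (x : R) : a <= x <= b -> 0 <= x <= 1.
Proof. by move=> /andP[ax xb]; rewrite (le_trans a0)// (le_trans xb). Qed.

Let sub : `[a, b]%classic `<=` `[0%R, 1%R]%classic.
Proof. by move=> x; rewrite /= !in_itv/=; exact: ab01. Qed.

Lemma sigma_lt (x y : R) : a <= x -> x < y -> y <= b -> sigma x < sigma y.
Proof.
move=> ax xy yb; have x01 : 0 <= x <= 1 by apply: ab01; rewrite ax (le_trans (ltW xy)).
have [x0 x1] := andP x01.
have p0 : 0 < N (g1 x) by apply/(eqn_gt0 HN)/g1_neq0; rewrite ax (le_trans (ltW xy)).
have [d d0 Hd] := sigma_der x01 (divr_gt0 p0 (ltr0Sn R 1)).
pose z := minr y (x + d / 2).
have xz : x < z by rewrite /z lt_min xy ltrDl divr_gt0.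
have zy : z <= y by rewrite /z ge_min lexx.
have zd : z <= x + d / 2 by rewrite /z ge_min lexx orbT.
have z1 : z <= 1 by rewrite (le_trans zy)// (le_trans yb).
have := Hd z; rewrite /= in_itv/= (le_trans x0 (ltW xz)) z1 gtr0_norm ?subr_gt0// => /(_ erefl).
have zxd : z - x < d by lra.
move=> /(_ zxd); rewrite ler_norml /GRing.scale/= => /andP[H1 _].
apply: (@lt_le_trans _ _ (sigma z)).
  rewrite -subr_gt0; have : 0 < (z - x) * N (g1 x) by rewrite mulr_gt0// subr_gt0.
  by move: H1; lra.
by apply: sigma_le => //; [exact: le_trans (ltW xz)|exact: le_trans b1].
Qed.

(** The unit tangent as a function of time. In arc length it becomes [F']; smoothness of [N] is what
    makes it C^1. *)
Let k x := (N (g1 x))^-1 *: g1 x.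
Let dN (u w : X) : R := 'D_w N u.
Let k' x := (N (g1 x))^-1 *: g2 x + (dN (g1 x) (g2 x) * - (N (g1 x) ^- 2)) *: g1 x.

Let g1_gt0 x : a <= x <= b -> 0 < N (g1 x).
Proof. by move=> /g1_neq0 /(eqn_gt0 HN). Qed.

Lemma cts_inv (A : set R) (u : R -> R) x : cts A u x -> u x != 0 -> cts A (fun y => (u y)^-1) x.
Proof.
move=> Hu u0; apply: (@cts_comp _ _ A setT u (@GRing.inv R) x) => //.
have : der setT (@GRing.inv R) (u x) (((@GRing.inv R)^`())%classic (u x)).
  by apply: derivable_der; exact: derivableV.
exact: der_cts.
Qed.

Lemma der_inv_fun (A : set R) (u : R -> R) x p : der A u x p -> u x != 0 ->
  der A (fun y => (u y)^-1) x (p * - (u x ^- 2)).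
Proof.
move=> Hu u0; apply: (@der_comp _ _ A setT u (@GRing.inv R) x p) => //.
have -> : - (u x ^- 2) = ((@GRing.inv R)^`())%classic (u x).
  by rewrite derive1E deriveV// derive_id /GRing.scale/= mulr1.
by apply: derivable_der; exact: derivableV.
Qed.

Lemma der_k x : a <= x <= b -> der `[a, b] k x (k' x).
Proof.
move=> xab; have E := der_sub sub (D2 (ab01 xab)).
have := derZ (der_inv_fun (der_N HN Nsm (g1_neq0 xab) E) (lt0r_neq0 (g1_gt0 xab))) E.
by [].
Qed.

Lemma cts_k' x : a <= x <= b -> cts `[a, b] k' x.
Proof.
move=> xab; have E := cts_sub sub (C2 (ab01 xab)).
have E1 := der_cts (der_sub sub (D2 (ab01 xab))).
have E2 := N_cts HN E1.
have E3 := cts_inv E2 (lt0r_neq0 (g1_gt0 xab)).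
apply: ctsD; first exact: ctsZ.
apply: (@ctsZ _ _ `[a, b] (fun y => dN (g1 y) (g2 y) * - (N (g1 y) ^- 2)) g1 x) => //.
apply: (@ctsZ _ _ `[a, b] (fun y => dN (g1 y) (g2 y)) (fun y => - (N (g1 y) ^- 2) : R^o) x).
  apply: (cts_dN HN Nsm _ _ E1 E); last by rewrite /= in_itv.
  by move=> y; rewrite /= in_itv/= => /g1_neq0.
have -> : (fun y => - (N (g1 y) ^- 2)) = (fun y => (- 1) *: ((N (g1 y))^-1 *: ((N (g1 y))^-1 : R^o))).
  by apply/funext => y; rewrite /GRing.scale/= mulN1r expr2 invfM.
by apply: ctsZ; [exact: cts_cst|exact: ctsZ].
Qed.

(** Here [sigma] has a differentiable inverse [tau], and [F = g o tau] gives [F' = k o tau] and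
    [F'' = (k' o tau) / N (g1 o tau)]. The factor 2 arises because [k'] has two terms, from
    differentiating [g1] and from differentiating its norm, and each is at most
    [N (g2 x) / N (g1 x)], the second by [dN_bound]. *)
Lemma regular_piece : [/\ @v_strict R X N f (h a) (h b), C2_on (v (h a)) (v (h b)) F &
  forall x : R, a < x < b -> N (F2 (v (h x))) * N (g1 x) ^+ 2 <= 2 * N (g2 x)].
Proof.
have cs x : a <= x <= b -> cts `[a, b] sigma x.
  by move=> xab; apply: cts_sub (der_cts (sigma_der (ab01 xab))).
have [tau T] := incr_homeo (ltW ab) sigma_lt cs.
have [sP tP _ _ tC] := T.
have tauI y : `[sigma a, sigma b]%classic y -> `[a, b]%classic (tau y).
  by rewrite /= !in_itv/= => /tP[].
have tD y : sigma a <= y <= sigma b -> der `[sigma a, sigma b] tau y (N (g1 (tau y)))^-1.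
  move=> yI; have [tI E] := tP y yI; rewrite -[in X in der _ _ X _]E.
  apply: (@der_inverse R `[a, b] `[sigma a, sigma b] sigma tau (tau y)) => //.
  - exact: g1_gt0.
  - by move=> z; rewrite /= in_itv/= => /tP[].
  - by rewrite E.
  - exact: der_sub sub (sigma_der (ab01 tI)).
  - by rewrite E; exact: tC.
have FE y : sigma a <= y <= sigma b -> F y = g (tau y).
  move=> yI; have [tI E] := tP y yI.
  by rewrite -{1}E (F_v HN fbv)//; exact/h01/ab01.
have dF y : sigma a <= y <= sigma b -> der `[sigma a, sigma b] F y (k (tau y)).
  move=> yI; have [tI E] := tP y yI.
  have Hc := der_comp tauI (tD y yI) (der_sub sub (D1 (ab01 tI))).
  apply: (der_loc ltr01 _ (FE y yI) Hc).
  by move=> z zI _; split => //; apply: FE; move: zI; rewrite /= in_itv.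
have dk y : sigma a <= y <= sigma b ->
    der `[sigma a, sigma b] (k \o tau) y ((N (g1 (tau y)))^-1 *: k' (tau y)).
  by move=> yI; have [tI _] := tP y yI; exact: der_comp tauI (tD y yI) (der_k tI).
split.
- move=> s t hs st ht; have [H1 H2 H3 _ _] := homeo_pair_sym H.
  have [hP _ _ _ _] := H.
  have aI : a <= a <= b by rewrite lexx ltW.
  have bI : a <= b <= b by rewrite lexx ltW.
  have [/andP[ha0 _] Ea] := hP a (ab01 aI); have [/andP[_ hb1] Eb] := hP b (ab01 bI).
  have [s0 t1] := (le_trans ha0 hs, le_trans ht hb1).
  have s01 : 0 <= s <= 1 by rewrite s0 (le_trans (ltW st)).
  have t01 : 0 <= t <= 1 by rewrite t1 (le_trans s0 (ltW st)).
  have s1 : s <= 1 by have /andP[] := s01.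
  have [_ Es] := H1 s s01; have [_ Et] := H1 t t01.
  rewrite -{1}Es -{1}Et; apply: sigma_lt; last 2 first.
  + exact: H3.
  + have /andP[t0 _] := t01.
    by have := homeo_pair_le (homeo_pair_sym H) t0 ht hb1; rewrite Eb.
  by have := homeo_pair_le (homeo_pair_sym H) ha0 hs s1; rewrite Ea.
- apply/C2_onP; exists (k \o tau), (fun y => (N (g1 (tau y)))^-1 *: k' (tau y)); split => // y yI.
  have [tI _] := tP y yI.
  have Ct : cts `[sigma a, sigma b] tau y by exact: tC.
  apply: ctsZ; last exact: (cts_comp tauI Ct (cts_k' tI)).
  apply: cts_inv; last exact: lt0r_neq0 (g1_gt0 tI).
  apply: (@cts_comp _ _ _ `[a, b] tau (fun x => N (g1 x)) y tauI Ct); apply: (N_cts HN).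
  exact: der_cts (der_sub sub (D2 (ab01 tI))).
move=> x /andP[ax xb]; have xI : a <= x <= b by rewrite !ltW.
have [sI tx] := sP x xI.
have sI' : sigma a < sigma x < sigma b by rewrite !sigma_lt// ltW.
have E1 z : sigma a < z < sigma b -> (F^`()%classic) z = k (tau z).
  move=> zI; apply/der_derive1/(der_interior zI)/dF.
  by case/andP: zI => /ltW -> /ltW.
have -> : F2 (v (h x)) = (N (g1 x))^-1 *: k' x.
  apply: der_derive1; have [r r0 Hr] := itv_ball sI'.
  have := dk _ sI; rewrite /= tx => /(der_interior sI').
  apply: (der_loc r0) => [z _ /Hr zI|]; first by split=> //; exact: E1.
  exact: E1.
have p0 := g1_gt0 xI; have := dN_bound HN Nsm (g2 x) (g1_neq0 xI).
rewrite -/(dN _ _) (eqnZ HN) (gtr0_norm (_ : 0 < (N (g1 x))^-1)) ?invr_gt0// => db.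
have := eqnD HN ((N (g1 x))^-1 *: g2 x) ((dN (g1 x) (g2 x) * - (N (g1 x) ^- 2)) *: g1 x).
rewrite -/(k' x) !(eqnZ HN) (gtr0_norm (_ : 0 < (N (g1 x))^-1)) ?invr_gt0// normrM normrN (gtr0_norm (_ : 0 < _ ^- 2)); last first.
  by rewrite invr_gt0 exprn_gt0.
move: (N (k' x)) (N (g2 x)) (`|dN (g1 x) (g2 x)|) (N (g1 x)) p0 db => K B C m m0 db hK.
have -> : m^-1 * K * m ^+ 2 = K * m by field; rewrite gt_eqF.
rewrite -ler_pdivlMr//; apply: (le_trans hK).
have -> : 2 * B / m = m^-1 * B + B * m ^- 2 * m by field; rewrite gt_eqF.
by rewrite lerD2l ler_pM2r// ler_pM2r// invr_gt0 exprn_gt0.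
Qed.

End SmoothReparametrization.

Lemma disjoint_length (R : realType) n (J : 'I_n -> R * R) :
  (forall k, [/\ 0 <= (J k).1, (J k).1 < (J k).2 & (J k).2 <= 1]) ->
  trivIset setT (fun k => Ioo (J k)) -> \sum_k ((J k).2 - (J k).1) <= 1.
Proof.
move=> H T; pose mu := @lebesgue_measure R.
have mJ k : setT k -> measurable (Ioo (J k)) by move=> _; exact: measurable_itv.
have E := measure_fin_bigcup mu (@finite_finset _ setT) T mJ.
rewrite (fsbigE (index_enum _)) ?index_enum_uniq// in E; last first.
  by move=> i _; rewrite mem_index_enum.
rewrite (eq_bigl xpredT) in E; last by move=> i; rewrite in_setT.
rewrite -lee_fin -sumEFin; have -> : (\sum_(k < n) ((J k).2 - (J k).1)%:E)%E =
   (\sum_(k < n) mu (Ioo (J k)))%E.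
  by apply: eq_bigr => k _; rewrite /mu mu_itv//; have [_ /ltW] := H k.
rewrite -E; have <- : mu `[0%R, 1%R]%classic = 1%E by rewrite /mu mu_itv ?ler01// subr0.
apply: le_measure; rewrite ?inE//.
  by apply: fin_bigcup_measurable => //; exact: finite_finset.
move=> x [k _]; rewrite /Ioo/= !in_itv/= => /andP[x1 x2]; have [? ? ?] := H k.
by apply/andP; split; lra.
Qed.

Lemma sum_indicator_le (R : realType) n (p : pred 'I_n) (c : R) : 0 <= c ->
  (forall i j, p i -> p j -> i = j) -> \sum_i (if p i then c else 0) <= c.
Proof.
move=> c0 H; have [[k pk]|no] := pselect (exists k, p k).
  rewrite (bigD1 k)//= pk big1 ?addr0// => i ik; case: ifP => // pi.
  by rewrite (H i k pi pk) eqxx in ik.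
by rewrite big1// => i _; case: ifP => // pi; case: no; exists i.
Qed.

(** * From a C^2 curve to condition (iii) *)

Section NecessaryConditions.
Context {R : realType} {X : normedModType R} {N : X -> R}.
Hypothesis HN : equivalent_norm N.
Hypothesis Nsm : frechet_smooth N.
Variable f : R -> X.
Hypothesis fbv : BV01 N f.
Hypothesis fcts : forall x, 0 <= x <= 1 -> cts `[0, 1] f x.
Variables (h hi : R -> R) (g1 g2 : R -> X).
Hypothesis H : homeo_pair 0 1 0 1 h hi.
Hypothesis D1 : forall x : R, 0 <= x <= 1 -> der `[0, 1] (f \o h) x (g1 x).
Hypothesis D2 : forall x : R, 0 <= x <= 1 -> der `[0, 1] g1 x (g2 x).
Hypothesis C2 : forall x : R, 0 <= x <= 1 -> cts `[0, 1] g2 x.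

Local Notation v := (vfun N f).
Local Notation F := (arclength_map N f).
Local Notation G := (`[0%R, 1%R]%classic `\` Dset N f : set R).
Local Notation F2 := (derive1n 2 F).
Local Notation sigma := (fun x => v (h x)).

Lemma regular_point x : 0 < x < 1 -> g1 x != 0 ->
  G (h x) /\ N (F2 (v (h x))) * N (g1 x) ^+ 2 <= 2 * N (g2 x).
Proof.
move=> xI gx; have x01 : 0 <= x <= 1 by case/andP: xI => /ltW -> /ltW.
have p0 : 0 < `|g1 x| / 2 by rewrite divr_gt0// normr_gt0.
have [d d0 Hd] := der_cts (D2 x01) p0; have [r r0 Hr] := itv_ball xI.
pose s := minr d r / 2.
have s0 : 0 < s by rewrite /s divr_gt0// lt_min d0.
have [sd sr] : s < d /\ s < r.
  have s2 : minr d r = 2 * s by rewrite /s; field.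
  have : minr d r <= d by rewrite ge_min lexx.
  have : minr d r <= r by rewrite ge_min lexx orbT.
  by rewrite s2; lra.
have near y : x - s <= y <= x + s -> 0 < y < 1 /\ g1 y != 0.
  move=> yI; have ys : `|y - x| <= s by rewrite ler_norml; lra.
  have y01 : 0 < y < 1 by apply: Hr; exact: le_lt_trans sr.
  split=> //; apply/eqP => g0; have yd : `|y - x| < d by exact: le_lt_trans sd.
  have yM : `[0%R, 1%R]%classic y by rewrite /= in_itv/=; case/andP: y01 => /ltW -> /ltW.
  have := Hd y yM yd; rewrite g0 sub0r normrN.
  have := p0; lra.
have xs : x - s < x < x + s by lra.
have [a0 _] : 0 < x - s < 1 /\ g1 (x - s) != 0 by apply: near; lra.
have [b0 _] : 0 < x + s < 1 /\ g1 (x + s) != 0 by apply: near; lra.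
have ab : x - s < x + s by lra.
have a0' : 0 <= x - s by case/andP: a0 => /ltW.
have b1 : x + s <= 1 by case/andP: b0 => _ /ltW.
have [vs CF bd] := regular_piece HN Nsm fbv H D1 D2 C2 a0' ab b1 (fun y yI => proj2 (near y yI)).
split; last exact: bd.
have [hP _ hI _ _] := H.
case/andP: xs => xs1 xs2.
apply: (@G_intro _ _ _ HN f fbv fcts (h (x - s)) (h (x + s)) _ _ _ _ vs CF).
- by have [/andP[]] := hP (x - s) ltac:(lra).
- by have [/andP[]] := hP (x + s) ltac:(lra).
- by rewrite !hI//; lra.
Qed.

(** By compactness and the mean value inequality. Both work in the norm of [X], so the constant [C]
    of the equivalence enters [K]. *)
Lemma C2_bound : exists2 K : R, 0 < K & (forall x, 0 <= x <= 1 -> N (g2 x) <= K) /\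
  forall x y, 0 <= x <= 1 -> 0 <= y <= 1 -> N (g1 y) <= N (g1 x) + K * `|y - x|.
Proof.
have [c [C [c0 C0 HC]]] := eqn_bounds HN.
have Nc : {within `[0, 1], continuous (fun x => `|g2 x|)}.
  apply/ctsP => x; rewrite /= in_itv/= => x01 e e0; have [d d0 Hd] := C2 x01 e0.
  by exists d => // y Ay yx; apply: le_trans (ler_dist_dist _ _) (Hd y Ay yx).
have [z _ Hz] := EVT_max ler01 Nc.
pose M := `|g2 z| + 1; have M0 : 0 < M by rewrite /M ltr_wpDl.
have HM x : 0 <= x <= 1 -> `|g2 x| <= M.
  by move=> x01; apply: (le_trans (Hz x _)); rewrite ?in_itv// /M lerDl.
exists (C * M); first exact: mulr_gt0.
split=> [x x01|].
  by have [_ Hx] := HC (g2 x); apply: (le_trans Hx); rewrite ler_wpM2l ?HM// ltW.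
have lip x y : 0 <= x -> x <= y -> y <= 1 -> N (g1 y - g1 x) <= C * M * (y - x).
  move=> x0 xy y1; have [_ Hx] := HC (g1 y - g1 x); apply: (le_trans Hx).
  rewrite -mulrA ler_pM2l//.
  have I t : x <= t <= y -> 0 <= t <= 1 by lra.
  apply: (mean_value_ineq xy (f1 := g2)) => t /I tI; last exact: HM.
  by apply: der_sub (D2 tI) => u; rewrite /= !in_itv/=; exact: I.
move=> x y /andP[x0 x1] /andP[y0 y1].
have T := eqn_lip HN (g1 y) (g1 x).
suff S : N (g1 y - g1 x) <= C * M * `|y - x|.
  by rewrite -lerBlDl; exact: le_trans (ler_norm _) (le_trans T S).
have [xy|/ltW xy] := leP x y; first by rewrite ger0_norm ?subr_ge0//; exact: lip.
by rewrite (eqnB HN) distrC ger0_norm ?subr_ge0//; exact: lip.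
Qed.

Lemma sigma_increment a b m : 0 <= a -> a <= b -> b <= 1 ->
  (forall x, a <= x <= b -> N (g1 x) <= m) -> v (h b) - v (h a) <= m * (b - a).
Proof.
move=> a0 ab b1 Hm; have I t : a <= t <= b -> 0 <= t <= 1 by lra.
apply: le_trans (ler_norm _) _.
apply: (@mean_value_ineq R R^o (fun x => v (h x)) (fun x => N (g1 x)) a b m ab) => t tI.
  apply: der_sub (sigma_der HN fbv H D1 D2 (I t tI)) => u; rewrite /= !in_itv/=; exact: I.
by rewrite ger0_norm ?Hm// (eqn_ge0 HN).
Qed.

Let hK x : 0 <= x <= 1 -> hi (h x) = x. Proof. by case: H => hP _ _ _ _ /hP[]. Qed.
Let hiK x : 0 <= x <= 1 -> h (hi x) = x. Proof. by case: H => _ hP _ _ _ /hP[]. Qed.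
Let hi01 x : 0 <= x <= 1 -> 0 <= hi x <= 1. Proof. by case: H => _ hP _ _ _ /hP[]. Qed.
Let hi_lt x y : 0 <= x -> x < y -> y <= 1 -> hi x < hi y.
Proof. by have [_ _ hI _ _] := homeo_pair_sym H; exact: hI. Qed.
Let hi_le x y : 0 <= x -> x <= y -> y <= 1 -> hi x <= hi y.
Proof. exact: (homeo_pair_le (homeo_pair_sym H)). Qed.
Let hi_0 : hi 0 = 0. Proof. by have [_ _ ? _ _] := homeo_pair_ends ler01 H. Qed.
Let hi_1 : hi 1 = 1. Proof. by have [_ _ _ ? _] := homeo_pair_ends ler01 H. Qed.

(* With [L] the length of the time interval: either [N g1 <= 2 K L] on it, or
   [N g1] varies there by at most a factor 2 and [Ssup * Var >= dl] forces
   [N g1 = O(L)] again. *)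
Lemma interval_bound (dl : R) : 0 < dl -> exists2 C : R, 0 <= C &
  forall I, I.1 < I.2 -> Ioo I `<=` G ->
    (Icc I `<=` G -> (dl%:E <= Ssup N f I * Var N f (Icc I))%E) ->
    [\/ I.1 = 0, I.2 = 1 | Num.sqrt (v I.2 - v I.1) <= C * (hi I.2 - hi I.1)].
Proof.
move=> dl0; have [K K0 [HK Hlip]] := C2_bound.
(* The first term serves the case [N g1 <= K * L] somewhere. In the other case, with [p] the value
   of [N g1] at [a], the bounds [Ssup <= 8 K / p^2] and [V <= 2 p L] turn [dl <= Ssup * V] into
   [dl * V <= 32 K L^2]. *)
pose C0 := 2 * K + 32 * K / dl.
have C00 : 0 <= C0 by rewrite addr_ge0// ?divr_ge0// ?mulr_ge0// ltW.
exists (Num.sqrt C0); first exact: sqrtr_ge0.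
move=> I I12 IG big.
have [I0 I1] := G_interval HN fbv fcts I12 IG.
(* 0 and 1 lie in [D] whether or not [g1] vanishes there, so for an interval reaching them [big]
   says nothing; a disjoint system contains at most two such intervals. *)
have [E1|N1] := eqVneq I.1 0; first by constructor 1.
have [E2|N2] := eqVneq I.2 1; first by constructor 2.
constructor 3; set a := hi I.1; set b := hi I.2.
have ab : a < b by exact: hi_lt.
have a0 : 0 < a by rewrite -hi_0; apply: hi_lt => //; [rewrite lt_def N1|exact: le_trans (ltW I12) I1].
have b1 : b < 1 by rewrite -hi_1; apply: hi_lt => //; [exact: le_trans I0 (ltW I12)|rewrite lt_def eq_sym N2].
have ha : h a = I.1 by rewrite hiK// I0 (le_trans (ltW I12)).
have hb : h b = I.2 by rewrite hiK// I1 (le_trans I0 (ltW I12)).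
suff Vb : v I.2 - v I.1 <= C0 * (b - a) ^+ 2.
  apply: le_trans (ler_wsqrtr Vb) _; rewrite sqrtrM// sqrtr_sqr gtr0_norm// subr_gt0//.
set L := b - a; have L0 : 0 < L by rewrite subr_gt0.
have I01 t : a <= t <= b -> 0 < t < 1 by move: a0 b1; lra.
have W01 t : a <= t <= b -> 0 <= t <= 1 by move: a0 b1; lra.
have near s t : a <= s <= b -> a <= t <= b -> N (g1 t) <= N (g1 s) + K * L.
  move=> sI tI; apply: le_trans (Hlip s t (W01 _ sI) (W01 _ tI)) _.
  by rewrite lerD2l ler_pM2l// ler_norml /L; move: sI tI; lra.
have VE : v I.2 - v I.1 = v (h b) - v (h a) by rewrite ha hb.
have [[x0 x0I Hx0]|no] := pselect (exists2 x, a <= x <= b & N (g1 x) <= K * L).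
  have : v (h b) - v (h a) <= (2 * K * L) * (b - a).
    by apply: sigma_increment => [|||x xI]; [exact: ltW|exact: ltW|exact: ltW|move: (near _ _ x0I xI); lra].
  rewrite -VE -/L => /le_trans; apply; rewrite /C0 expr2.
  have : 0 <= 32 * K / dl * (L * L) by rewrite !mulr_ge0// ?invr_ge0// ltW.
  by clearbody L; lra.
have reg x : a <= x <= b -> K * L < N (g1 x).
  by move=> xI; rewrite ltNge; apply/negP => Hx; apply: no; exists x.
have KL0 : 0 < K * L by rewrite mulr_gt0.
have g0 x : a <= x <= b -> g1 x != 0.
  by move=> xI; apply/eqP => E; have := reg x xI; rewrite E (eqn0 HN); move: KL0; lra.
have onto y : I.1 <= y <= I.2 -> a <= hi y <= b /\ h (hi y) = y.
  move=> /andP[y1 y2]; split; last by apply: hiK; rewrite (le_trans I0)// (le_trans y2).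
  by apply/andP; split; apply: hi_le => //; [exact: le_trans y2 I1|exact: le_trans I0 y1].
(* Without zeros of [g1] even the endpoints of [I] are regular points, so the condition [big] takes
   effect. *)
have IccG : Icc I `<=` G.
  move=> y; rewrite /Icc/= in_itv/= => /onto[yI <-].
  by have [] := regular_point (I01 _ yI) (g0 _ yI).
have aI : a <= a <= b by rewrite lexx ltW.
set p := N (g1 a); have p0 : 0 < p by exact: lt_trans (reg a aI).
have Sle : (Ssup N f I <= (8 * K / p ^+ 2)%:E)%E.
  apply: Ssup_le => y /andP[y1 y2].
  have [yI <-] : a <= hi y <= b /\ h (hi y) = y by apply: onto; rewrite !ltW.
  have [_ Fb] := regular_point (I01 _ yI) (g0 _ yI).
  have gp : p / 2 <= N (g1 (hi y)) by have := near _ _ yI aI; have := reg _ yI; rewrite -/p; lra.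
  rewrite ler_pdivlMr ?exprn_gt0//.
  have := HK _ (W01 _ yI); move: Fb; move: gp; set q := N (g1 _); set A := N _.
  have A0 : 0 <= A by exact: (eqn_ge0 HN).
  move=> gp Fb Kb; have : p ^+ 2 <= 4 * q ^+ 2.
    have -> : 4 * q ^+ 2 = (2 * q) ^+ 2 by ring.
    by rewrite ler_sqr ?nnegrE; lra.
  by move=> /(ler_wpM2l A0); lra.
have [VarE Vpos] := Var_G HN fbv fcts I12 IG.
have := big IccG; rewrite VarE.
set V := v I.2 - v I.1; have V0 : 0 < V by rewrite subr_gt0.
have V2 : V <= 2 * p * L.
  rewrite /V VE; apply: sigma_increment => [|||x xI]; [exact: ltW|exact: ltW|exact: ltW|].
  by have := near _ _ aI xI; have := reg _ aI; rewrite -/p; lra.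
move=> /le_trans/(_ (lee_wpmul2r _ Sle)); rewrite lee_fin (ltW V0) => /(_ erefl).
rewrite -EFinM lee_fin => dV.
have V3 : dl * V <= 32 * K * L ^+ 2.
  apply: (@le_trans _ _ (8 * K / p ^+ 2 * V ^+ 2)).
    by rewrite expr2 mulrA ler_pM2r.
  have -> : 32 * K * L ^+ 2 = 8 * K / p ^+ 2 * (2 * p * L) ^+ 2 by field; rewrite gt_eqF.
  rewrite ler_pM2l ?divr_gt0 ?mulr_gt0// ?exprn_gt0//.
  by rewrite ler_sqr ?nnegrE// ?ltW// ?mulr_gt0// ltW// mulr_gt0.
rewrite /C0 mulrDl.
have V4 : V <= 32 * K / dl * L ^+ 2.
  by rewrite mulrAC ler_pdivlMr// mulrC.
have : 0 <= 2 * K * L ^+ 2 by rewrite !mulr_ge0// ltW.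
by move: V4; lra.
Qed.

(** The time intervals are disjoint in [[0, 1]], so the bounds of [interval_bound] add up to at most
    [C]. At most one interval starts at 0 and at most one ends at 1; each of these contributes at
    most [m]. *)
Lemma W_lt_pinfty (dl : R) : 0 < dl -> (W N dl f G < +oo)%E.
Proof.
move=> dl0; have [C C0 HC] := interval_bound dl0.
pose m := Num.sqrt (v 1).
apply: (@le_lt_trans _ _ (C + m + m)%:E); last exact: ltry.
apply: ge_ereal_sup => _ [n [I [IG T big ->]]].
have I01 k : 0 <= (I k).1 /\ (I k).2 <= 1 by have [] := IG k; exact: G_interval.
have E k : sqrte (Var N f (Icc (I k))) = (Num.sqrt (v (I k).2 - v (I k).1))%:E.
  by have [i1 i2] := IG k; have [-> _] := Var_G HN fbv fcts i1 i2.
rewrite (eq_bigr _ (fun k _ => E k)) sumEFin lee_fin.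
have L1 : \sum_(k < n) (hi (I k).2 - hi (I k).1) <= 1.
  apply: (@disjoint_length R n (fun k => (hi (I k).1, hi (I k).2))).
    move=> k /=; have [k0 k1] := I01 k; have [k01 _] := IG k; split.
    - by have /andP[] := hi01 (x := (I k).1) ltac:(lra).
    - exact: hi_lt.
    - by have /andP[] := hi01 (x := (I k).2) ltac:(lra).
  move=> i j _ _ [x [xi xj]]; apply: T => //; exists (h x).
  have tr k : Ioo (hi (I k).1, hi (I k).2) x -> Ioo (I k) (h x).
    rewrite /Ioo/= !in_itv/= => /andP[x1 x2]; have [k0 k1] := I01 k; have [k01 _] := IG k.
    have /andP[h0 _] := hi01 (x := (I k).1) ltac:(lra).
    have /andP[_ h1] := hi01 (x := (I k).2) ltac:(lra).
    have [_ _ hI _ _] := H.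
    rewrite -{1}[(I k).1]hiK -1?[(I k).2 in X in _ && X]hiK; try lra.
    by rewrite !hI//; lra.
  by split; exact: tr.
have ind (p : pred 'I_n) : (forall i j, p i -> p j -> i = j) -> \sum_i (if p i then m else 0) <= m.
  by apply: sum_indicator_le; exact: sqrtr_ge0.
have u1 i j : (I i).1 == 0 -> (I j).1 == 0 -> i = j.
  move=> /eqP Ei /eqP Ej; apply: T => //; exists (minr (I i).2 (I j).2 / 2).
  have [i12 _] := IG i; have [j12 _] := IG j; rewrite Ei in i12; rewrite Ej in j12.
  rewrite /Ioo/= !in_itv/= Ei Ej.
  have : 0 < minr (I i).2 (I j).2 by rewrite lt_min i12.
  have : minr (I i).2 (I j).2 <= (I i).2 by rewrite ge_min lexx.
  have : minr (I i).2 (I j).2 <= (I j).2 by rewrite ge_min lexx orbT.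
  by set z := minr _ _; move=> z1 z2 z3; split; apply/andP; split; lra.
have u2 i j : (I i).2 == 1 -> (I j).2 == 1 -> i = j.
  move=> /eqP Ei /eqP Ej; apply: T => //; exists ((maxr (I i).1 (I j).1 + 1) / 2).
  have [i12 _] := IG i; have [j12 _] := IG j; rewrite Ei in i12; rewrite Ej in j12.
  rewrite /Ioo/= !in_itv/= Ei Ej.
  have : maxr (I i).1 (I j).1 < 1 by rewrite gt_max i12.
  have : (I i).1 <= maxr (I i).1 (I j).1 by rewrite le_max lexx.
  have : (I j).1 <= maxr (I i).1 (I j).1 by rewrite le_max lexx orbT.
  by set z := maxr _ _; move=> z1 z2 z3; split; apply/andP; split; lra.
apply: (@le_trans _ _ (\sum_(k < n) (C * (hi (I k).2 - hi (I k).1) +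
   (if (I k).1 == 0 then m else 0) + (if (I k).2 == 1 then m else 0)))).
  apply: ler_sum => k _; have [i1 i2] := IG k; have [k0 k1] := I01 k.
  have m0 : 0 <= m by exact: sqrtr_ge0.
  have Vm : Num.sqrt (v (I k).2 - v (I k).1) <= m.
    have /andP[v0' _] : 0 <= v (I k).1 <= v 1 by apply: (v_ge0 HN fbv); lra.
    have /andP[_ v1'] : 0 <= v (I k).2 <= v 1 by apply: (v_ge0 HN fbv); lra.
    by apply: ler_wsqrtr; lra.
  have L0 : 0 <= C * (hi (I k).2 - hi (I k).1).
    by rewrite mulr_ge0// subr_ge0; apply/ltW/hi_lt.
  have [E1|E1|E1] := HC _ i1 i2 (big k).
  - by rewrite (introT eqP E1); case: ifP => _; lra.
  - by rewrite (introT eqP E1); case: ifP => _; lra.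
  - by case: ifP => _; case: ifP => _; lra.
rewrite !big_split/= -mulr_sumr.
apply: lerD; last exact: (ind _ u2).
apply: lerD; last exact: (ind _ u1).
by rewrite -[leRHS]mulr1; exact: ler_wpM2l.
Qed.

(* Sard: a time interval of length [1/n] containing a zero of [g1] has an image of
   diameter at most [K / n^2]. *)
Lemma image_Dset_null : hausdorff1 N (f @` Dset N f) = 0%E.
Proof.
have [K K0 [_ Hlip]] := C2_bound.
have D0 E (d : R) : (0 <= hausdorff1_delta N d E)%E.
  apply: le_ereal_inf_tmp => _ [U _ <-]; apply: nneseries_ge0 => i _ _; exact: diam_ge0.
apply/eqP; rewrite eq_le; apply/andP; split; last first.
  by apply: le_trans (D0 _ 1) _; apply: ereal_sup_ubound; exists 1 => //=; exact: ltr01.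
apply: ge_ereal_sup => _ [d d0 <-]; apply/lee_addgt0Pr => e e0; rewrite add0e.
(* [K / n <= e] will bound the sum of the [n] diameters [K / n^2], and [K / n <= d] makes each of
   them at most [d]. *)
pose n := (Num.bound (K / e + K / d)).+1.
have n0 : 0 < n%:R :> R by rewrite ltr0n.
have [ne nd] : K / n%:R <= e /\ K / n%:R <= d.
  have Ke : 0 <= K / e by rewrite divr_ge0// ltW.
  have Kd : 0 <= K / d by rewrite divr_ge0// ltW.
  have B : K / e + K / d < n%:R.
    apply: (lt_trans (archi_boundP (addr_ge0 Ke Kd))); rewrite ltr_nat//.
  rewrite !ler_pdivrMr//; split; [rewrite mulrC -ler_pdivrMr//|rewrite mulrC -ler_pdivrMr//]; lra.
pose D' i := [set x | [/\ Dset N f x, 0 < x < 1 & i%:R / n%:R <= hi x <= i.+1%:R / n%:R]].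
(* The two additional sets are needed because [g1] may be nonzero at 0 and 1, although both points
   lie in [D]; as singletons they have diameter 0. *)
pose U i : set X := if (i < n)%N then f @` D' i
  else if i == n then [set f 0] else if i == n.+1 then [set f 1] else set0.
pose c := K / n%:R ^+ 2.
have c0 : 0 <= c by rewrite divr_ge0// ltW// exprn_gt0.
have cd : c <= d.
  apply: le_trans nd; rewrite /c ler_pM2l// lef_pV2 ?posrE ?exprn_gt0//.
  by rewrite ler_eXnr// ler1n.
have dU i : (diam N (U i) <= (if (i < n)%N then c else 0)%:E)%E.
  apply: ge_ereal_sup => _ [->|[[p q] /= [Ux Uy] <-]].
    by rewrite lee_fin; case: ifP.
  rewrite lee_fin; move: Ux Uy; rewrite /U; case: ltnP => ni; last first.
    case: ifP => _; first by move=> /= -> ->; rewrite subrr (eqn0 HN).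
    by case: ifP => _; [move=> /= -> ->; rewrite subrr (eqn0 HN)|case].
  move=> [x' [Dx x01 xI] <-] [y' [Dy y01 yI] <-].
  have crit z : Dset N f z -> 0 < z < 1 -> g1 (hi z) = 0.
    move=> Dz /andP[z0 z1]; apply/eqP/negPn/negP => gz.
    have zI : 0 < hi z < 1.
      by apply/andP; split; [rewrite -hi_0; apply: hi_lt => //; exact: ltW|rewrite -hi_1; apply: hi_lt => //; exact: ltW].
    have [[_ nD] _] := regular_point zI gz; apply: nD.
    by rewrite hiK// !ltW.
  have key x y : D' i x -> D' i y -> x <= y -> N (f y - f x) <= c.
    move=> [Dx' /andP[px1 px2] /andP[qx1 qx2]] [Dy' /andP[py1 py2] /andP[qy1 qy2]] xy.
    apply: (le_trans (f_lip HN fbv (ltW px1) xy (ltW py2))).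
    have x01' : 0 <= x <= 1 by rewrite !ltW.
    have y01' : 0 <= y <= 1 by rewrite !ltW.
    rewrite -{1}(hiK y01') -{1}(hiK x01').
    have hxy : hi x <= hi y by apply: hi_le => //; exact: ltW.
    have /andP[hx0 hx1] := hi01 x01'; have /andP[hy0 hy1] := hi01 y01'.
    have n1 : hi y - hi x <= n%:R^-1.
      have : i.+1%:R / n%:R = i%:R / n%:R + n%:R^-1 :> R by rewrite -natr1 mulrDl mul1r.
      by lra.
    apply: (@le_trans _ _ (K / n%:R * (hi y - hi x))).
      apply: sigma_increment => // t /andP[xt ty].
      have t01 : 0 <= t <= 1 by rewrite (le_trans hx0)// (le_trans ty).
      have hx01 : 0 <= hi x <= 1 by rewrite hx0.
      have := Hlip _ _ hx01 t01; rewrite crit// ?px1// (eqn0 HN) add0r => /le_trans; apply.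
      by rewrite ler_pM2l// ger0_norm ?subr_ge0//; lra.
    rewrite /c expr2 invfM mulrA ler_wpM2l// divr_ge0// ltW//.
  have [xy|/ltW xy] := leP x' y'; last by exact: key.
  by rewrite (eqnB HN); exact: key.
have cover : f @` Dset N f `<=` \bigcup_i U i.
  move=> _ [x Dx <-]; have [x01 _] := Dx; move: x01; rewrite /= in_itv/= => /andP[x0 x1].
  have [->|nx0] := eqVneq x 0; first by exists n => //; rewrite /U ltnn eqxx.
  have [->|nx1] := eqVneq x 1.
    by exists n.+1 => //; rewrite /U ltnNge leqnSn/= gtn_eqF// eqxx.
  have xp : 0 < x by rewrite lt_def nx0.
  have xl : x < 1 by rewrite lt_def eq_sym nx1.
  have t0 : 0 <= hi x by rewrite -hi_0; exact: hi_le.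
  have t1 : hi x < 1 by rewrite -hi_1; exact: hi_lt.
  have /andP[i1 i2] := truncn_itv (mulr_ge0 t0 (ltW n0)).
  exists (Num.trunc (hi x * n%:R)) => //; rewrite /U ifT; last first.
    by rewrite -(ltr_nat R); apply: le_lt_trans i1 _; rewrite gtr_pMl.
  exists x => //; split => //; first by rewrite xp.
  by rewrite ler_pdivrMr// ler_pdivlMr// i1 ltW.
apply: (@le_trans _ _ (\sum_(0 <= i <oo) diam N (U i))%E).
  apply: ereal_inf_lbound; exists U => //; split=> // i.
  by apply: le_trans (dU i) _; rewrite lee_fin; case: ifP => _ //; exact: ltW.
apply: lime_le; first by apply: is_cvg_nneseries => i _ _; exact: diam_ge0.
apply: nearW => m.
apply: (@le_trans _ _ (\sum_(0 <= i < m) (if (i < n)%N then c else 0)%:E)%E).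
  by apply: lee_sum => i _; exact: dU.
rewrite sumEFin lee_fin; apply: (@le_trans _ _ ((minn m n)%:R * c)).
  elim: m => [|m IH]; first by rewrite big_nil min0n mul0r.
  rewrite big_nat_recr//=; apply: (le_trans (lerD IH (lexx _))).
  have [mn|nm] := ltnP m n.
    by rewrite (minn_idPl mn) -natr1 mulrDl mul1r.
  by rewrite (minn_idPr (leqW nm)) addr0.
apply: (@le_trans _ _ (n%:R * c)); first by rewrite ler_wpM2r// ler_nat geq_minr.
apply: le_trans ne; suff -> : n%:R * c = K / n%:R by [].
by rewrite /c; field; rewrite gt_eqF.
Qed.

End NecessaryConditions.

(** * The equivalences *)

Section Implications.
Context {R : realType} {X : normedModType R} {N : X -> R}.
Hypothesis HN : equivalent_norm N.
Hypothesis Nsm : frechet_smooth N.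
Variable f : R -> X.
Hypothesis fbv : BV01 N f.
Hypothesis fcts : forall x, 0 <= x <= 1 -> cts `[0, 1] f x.

Local Notation v := (vfun N f).
Local Notation G := (`[0%R, 1%R]%classic `\` Dset N f : set R).

Lemma v_lt_nonconst a b x y : 0 <= a -> b <= 1 -> a <= x <= b -> a <= y <= b ->
  f x <> f y -> v a < v b.
Proof.
move=> a0 b1 xI yI; wlog xy : x y xI yI / x <= y.
  by move=> W nf; have [xy|/ltW xy] := leP x y; [exact: (W x y)|apply: (W y x) => // E; exact: nf].
move=> nf; have := f_lip HN fbv (x := x) (y := y) ltac:(lra) xy ltac:(lra).
have p0 : 0 < N (f y - f x).
  by apply: (eqn_gt0 HN); rewrite subr_eq0; apply/eqP => E; exact: nf.
have := v_le HN fbv (x := a) (y := x) ltac:(lra) ltac:(lra) ltac:(lra).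
have := v_le HN fbv (x := y) (y := b) ltac:(lra) ltac:(lra) ltac:(lra).
by lra.
Qed.

Lemma partition_sum_le_W (dl : R) K P : fdK_partition N f dl K G P ->
  (\esum_(I in P) sqrte (Var N f (Icc I)) <= W N dl f G)%E.
Proof.
move=> [PG _ Pd]; apply: ge_ereal_sup => _ [Y [finY YP] <-].
rewrite fsbig_finite//; set s := finmap.enum_fset (fset_set Y).
have us : uniq s by exact: finmap.fset_uniq.
have sP k : P (tnth (in_tuple s) k).
  by apply: YP; have := mem_tnth k (in_tuple s); rewrite /s in_fset_set// inE.
rewrite big_tnth; apply: ereal_sup_ubound; exists (size s), (tnth (in_tuple s)); split => //.
- by move=> k; split; [exact: (partition_lt PG)|exact: (partition_sub PG)].
- move=> i j _ _ ne.
  have E : tnth (in_tuple s) i = tnth (in_tuple s) j.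
    exact: (partition_trivI (G_open HN fbv fcts) (G_01 HN fbv fcts) PG).
  move: E; rewrite !(tnth_nth (0, 0)) => /eqP.
  by rewrite nth_uniq// => /eqP/val_inj.
- by move=> k; exact: Pd.
Qed.

(** The null image of [D] yields the total length through [total_length], as the closed intervals of
    the partition cover [G]. The last sum is bounded by writing [V sqrt S] as
    [sqrt V sqrt (S V)]. *)
Lemma vi_vii (K : R) P : hausdorff1 N (f @` Dset N f) = 0%E -> 0 < K ->
  fdK_partition N f 0 K%:E G P ->
  (\esum_(I in P) sqrte (Var N f (Icc I)) < +oo)%E ->
  [/\ (forall J, P J -> J.1 < J.2 /\ Ioo J `<=` G), trivIset P Ioo,
      (\esum_(J in P) Var N f (Icc J) = Var N f `[0%R, 1%R])%E &
      (\esum_(J in P) (Var N f (Icc J) * sqrte (Ssup N f J)) < +oo)%E].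
Proof.
move=> null K0 [PG PS _] fin.
have Go := G_open HN fbv fcts; have G01 := G_01 HN fbv fcts.
have PI J : P J -> J.1 < J.2 /\ Ioo J `<=` G.
  by move=> PJ; split; [exact: (partition_lt PG)|exact: (partition_sub PG)].
have PT : trivIset P Ioo by exact: (partition_trivI Go G01 PG).
have V I : P I -> Var N f (Icc I) = (v I.2 - v I.1)%:E /\ v I.1 < v I.2.
  by move=> /PI[]; exact: Var_G.
have [J [J1 J2 J3 Jsum]] := enum_intervals (partition_lt PG) PT.
split=> //.
  rewrite (eq_esum (fun I PI => proj1 (V I PI))) Jsum/= ?subrr//; last first.
    by move=> I /V[_ h]; rewrite lee_fin subr_ge0 ltW.
  rewrite (VarE HN fbv)// (v0 HN fbv) subr0; apply: (total_length HN fbv fcts) => //.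
  - by move=> n; have [/PI|] := J1 n; [left|right].
  - by move=> y /(partition_cover Go G01 PG)[I /J2[n <-]]; exists n.
  - move=> n m x xn xm.
    have Pn k : (J k).1 < x < (J k).2 -> P (J k).
      by have [//|->/=] := J1 k; lra.
    apply: J3; first exact: Pn.
    apply: PT; [exact: Pn|exact: Pn|].
    by exists x; split; rewrite /Ioo/= in_itv.
apply: (@le_lt_trans _ _ (\esum_(I in P) ((Num.sqrt K)%:E * sqrte (Var N f (Icc I)))%E)).
  apply: le_esum => I PI'; have [-> Vp] := V I PI'; have [Sf SV] := PS I PI'.
  have [I12 IG] := PI _ PI'.
  have S0 := Ssup_ge0 HN f I12.
  move: SV Sf S0; have [-> _] := V I PI'; case: (Ssup N f I) => [s||]//.
  set w := v I.2 - v I.1; rewrite -EFinM !lee_fin => sV _ s0.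
  change ((w * Num.sqrt s)%:E <= (Num.sqrt K * Num.sqrt w)%:E)%E; rewrite lee_fin.
  have w0 : 0 <= w by rewrite subr_ge0 ltW.
  rewrite -{1}(sqr_sqrtr w0) expr2 -mulrA mulrC ler_wpM2r ?sqrtr_ge0//.
  by rewrite -sqrtrM// ler_wsqrtr// mulrC.
have E : (\esum_(I in P) ((Num.sqrt K)%:E * sqrte (Var N f (Icc I))) =
   \esum_(I in P) ((Num.sqrt K)%:E * (Num.sqrt (v I.2 - v I.1))%:E))%E.
  by apply: eq_esum => I /V[-> _].
have E' : (\esum_(I in P) sqrte (Var N f (Icc I)) = \esum_(I in P) (Num.sqrt (v I.2 - v I.1))%:E)%E.
  by apply: eq_esum => I /V[-> _].
rewrite E Jsum/= ?subrr ?sqrtr0 ?mule0//.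
rewrite nneseriesZl; last by move=> n _; rewrite lee_fin sqrtr_ge0.
move: fin; rewrite E' Jsum/= ?subrr ?sqrtr0//.
by move=> fin; apply: lte_mul_pinfty => //; rewrite lee_fin sqrtr_ge0.
Qed.

End Implications.

Theorem theorem4p5 (R : realType) (X : completeNormedModType R) (N : X -> R)
    (N_norm : equivalent_norm N) (N_smooth : frechet_smooth N)
    (f : R -> X) (f_bv : BV01 N f)
    (f_cont : {within `[0, 1], continuous f})
    (f_nonconst : exists x y : R, [/\ x \in `[0, 1], y \in `[0, 1] & f x <> f y]) :
  let D := Dset N f in
  let G : set R := `[0, 1] `\` D in
  let null := hausdorff1 N (f @` D) = 0%E in
  let ii phi :=
    [/\ increasing_homeo 0 1 0 1 phi, C2_on 0 1 (f \o phi) &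
        forall x : R, x \in `[0, 1] -> G (phi x) -> (f \o phi)^`()%classic x != 0] in
  [<->
    (* (i) *)
    exists h, increasing_homeo 0 1 0 1 h /\ C2_on 0 1 (f \o h);
    (* (ii) *)
    exists phi, ii phi;
    (* (iii) *)
    null /\ forall delta, 0 < delta -> (W N delta f G < +oo)%E;
    (* (iv) *)
    null /\ exists delta, 0 < delta /\ (W N delta f G < +oo)%E;
    (* (v) *)
    null /\ forall delta P, 0 < delta -> fdK_partition N f delta +oo%E G P ->
      (\esum_(I in P) sqrte (Var N f (Icc I)) < +oo)%E;
    (* (vi) *)
    null /\ exists (K : R) (P : set (R * R)),
      [/\ 0 < K, fdK_partition N f 0 K%:E G P &
          (\esum_(I in P) sqrte (Var N f (Icc I)) < +oo)%E];
    (* (vii) *)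
    exists S : set (R * R),
      [/\ (forall J, S J -> J.1 < J.2 /\ Ioo J `<=` G),
          trivIset S Ioo,
          \esum_(J in S) Var N f (Icc J) = Var N f `[0, 1],
          (\esum_(J in S) sqrte (Var N f (Icc J)) < +oo)%E &
          (\esum_(J in S) (Var N f (Icc J) * sqrte (Ssup N f J)) < +oo)%E]]
  /\
  ((forall a b : R, 0 <= a -> a < b -> b <= 1 ->
      exists x y : R, [/\ x \in `[a, b], y \in `[a, b] & f x <> f y]) ->
   (exists phi, ii phi) ->
   exists phi, ii phi /\
     lebesgue_measure (`[0, 1] `&` phi @^-1` G) = 1%E).
Proof.
move=> D G null ii.
have fcts (x : R) : 0 <= x <= 1 -> cts `[0, 1] f x.
  by move=> x01; move/ctsP : f_cont; apply; rewrite /= in_itv.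
have l0 : 0 < vfun N f 1.
  have [x [y [x01 y01 nf]]] := f_nonconst.
  rewrite -(v0 N_norm f_bv); rewrite !in_itv/= in x01 y01.
  exact: (v_lt_nonconst N_norm f_bv (lexx 0) (lexx 1) x01 y01 nf).
set Pi := (X in [<-> X; _; _; _; _; _; _]).
set Piii := (X in [<-> _; _; X; _; _; _; _]).
set Pv := (X in [<-> _; _; _; _; X; _; _]).
set Pvi := (X in [<-> _; _; _; _; _; X; _]).
set Pvii := (X in [<-> _; _; _; _; _; _; X]).
have i_iii : Pi -> Piii.
  move=> [h [/increasing_homeoP[hi H] /C2_onP[g1 [g2 [D1 D2 C2]]]]]; split.
    exact: (image_Dset_null N_norm N_smooth f_bv fcts H D1 D2 C2).
  move=> dl dl0; exact: (W_lt_pinfty N_norm N_smooth f_bv fcts H D1 D2 C2).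
have iii_v : Piii -> Pv.
  move=> [nul W]; split=> // dl P dl0 PP.
  by apply: le_lt_trans (W dl dl0); exact: (partition_sum_le_W N_norm f_bv fcts PP).
have iv_vi : (null /\ exists delta, 0 < delta /\ (W N delta f G < +oo)%E) -> Pvi.
  move=> [nul [dl [dl0 Wl]]]; split=> //.
  have [P PP] := fdK_partition_exists N_norm f_bv fcts dl0; exists dl, P; split=> //.
    have [PG PS Pd] := PP; split=> // I PI IG.
    by apply: le_trans (Pd I PI IG); rewrite lee_fin ltW.
  by apply: le_lt_trans Wl; exact: (partition_sum_le_W N_norm f_bv fcts PP).
have v_vi : Pv -> Pvi.
  move=> [nul H]; split=> //.
  have [P PP] := fdK_partition_exists N_norm f_bv fcts (@ltr01 R); have [PG PS Pd] := PP.
  exists 1, P; split=> //.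
    by split=> // I PI IG; apply: le_trans (Pd I PI IG); rewrite lee_fin ler01.
  apply: (H 1 P ltr01); split=> // I PI; split; last exact: leey.
  by have [] := PS I PI.
have vi_vii : Pvi -> Pvii.
  move=> [nul [K [P [K0 PP fin]]]]; exists P.
  by have [] := vi_vii N_norm f_bv fcts nul K0 PP fin; split.
have vii_ii : Pvii -> exists phi, ii phi /\ 
    ((forall x y, 0 <= x -> x < y -> y <= 1 -> vfun N f x < vfun N f y) ->
    lebesgue_measure (`[0, 1] `&` phi @^-1` G) = 1%E).
  move=> [S [S1 S2 S3 S4 S5]].
  have [Q [Q1 [T SD]]] := speed_data_exists N_norm f_bv fcts l0 S1 S2 S3 S4 S5.
  by have [phi [H1 H2]] := reparametrize N_norm f_bv fcts l0 SD; exists phi.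
have ii_i : (exists phi, ii phi) -> Pi by move=> [phi [h c _]]; exists phi.
have vii_ii' : Pvii -> exists phi, ii phi by move=> /vii_ii[phi [h _]]; exists phi.
split.
  (* The implications established form the cycle (i), (iii), (v), (vi), (vii), (ii), (i), with a
     detour from (iii) through (iv) to (vi); the cyclic goals are composed from these. *)
  tfae => //.
  - by move=> /i_iii/iii_v/v_vi/vi_vii/vii_ii'.
  - by move=> /ii_i/i_iii.
  - by move=> [nul W]; split=> //; exists 1; split=> //; exact: W.
  - by move=> /iv_vi/vi_vii/vii_ii'/ii_i/i_iii/iii_v.
  - by move=> /vii_ii'/ii_i.
move=> nonconst /ii_i/i_iii/iii_v/v_vi/vi_vii/vii_ii[phi [h m]]; exists phi; split=> //.
apply: m => x y x0 xy y1; have [s [t [sI tI nf]]] := nonconst x y x0 xy y1.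
rewrite !in_itv/= in sI tI; exact: (v_lt_nonconst N_norm f_bv x0 y1 sI tI nf).
Qed.
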